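(* Let $P$ be a generalized truncation polytope of type $(k;n_1,\ldots,n_r)$ with $r\ge 1$, that is, $P=\mathrm{vc}^{k}(\Delta^{n_1}\times\ldots\times\Delta^{n_r})$ with $n_1\ge\ldots\ge n_r\ge 1$ and $k\ge 0$; it has dimension $d=n_1+\ldots+n_r$ and $m=n_1+\ldots+n_r+r+k$ facets. Denote by $a$ the number of 1's among $n_1,\ldots,n_r$. Then the bigraded Betti numbers of $P$ are given by the following formulae, for $1\le i\le k+r-1$ and $1<l<d-1$: (a) $$\beta^{-i,2(i+l)}(P)=\sum_{\{i_1,\ldots,i_s\}\subset\{1,\ldots,r\}:\ n_{i_1}+\ldots+n_{i_s}=l}\binom{k}{i-s},$$ where the sum is over all subsets (of any size $s$) satisfying the indicated condition; (b) $$\beta^{-i,2(i+1)}(P)=\beta^{-(k+r-i),2(d+k+r-i-1)}(P)=k\binom{k+r-1}{i}-\binom{k}{i+1}+a\binom{k}{i-1};$$ (c) $$\beta^{0,0}(P)=\beta^{-(m-d),2m}(P)=1.$$ The other bigraded Betti numbers are zero. (Here $\binom{b}{c}=0$ if $b<c$ or if one of $b,c$ is negative.)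
   Context: Let $\mathbf{k}$ be a field of characteristic zero or the ring of integers. For a simplicial complex $K$ on $[m]=\{1,\ldots,m\}$, the face (Stanley--Reisner) ring is $\mathbf{k}[K]=\mathbf{k}[v_1,\ldots,v_m]/\mathcal I_K$, $\deg v_i=2$, where $\mathcal I_K$ is generated by the square-free monomials $v_{i_1}\cdots v_{i_q}$ with $\{i_1,\ldots,i_q\}\notin K$. The bigraded Betti numbers are $\beta^{-i,2j}(\mathbf{k}[K])=\dim_{\mathbf{k}}\mathrm{Tor}^{-i,2j}_{\mathbf{k}[v_1,\ldots,v_m]}(\mathbf{k}[K],\mathbf{k})$, $0\le i,j\le m$, where $-i$ is the homological degree and $2j$ the internal degree. For a simple polytope $P$ with facets $F_1,\ldots,F_m$, $K_P$ is the boundary complex of the dual simplicial polytope: the simplicial complex on $[m]$ whose simplices are the subsets $\{i_1,\ldots,i_q\}$ with $F_{i_1}\cap\ldots\cap F_{i_q}\ne\varnothing$. Put $\beta^{-i,2j}(P):=\beta^{-i,2j}(\mathbf{k}[K_P])$. Vertex cut: for a simple polytope $P$ with a vertex $v$, choose a hyperplane $H$ separating $v$ from all other vertices, with $v$ in the halfspace $H_{\ge}$; then $P\cap H_{\le}$ is a simple polytope, denoted $\mathrm{vc}(P)$. $\mathrm{vc}^k(P)$ denotes any polytope obtained from $P$ by iterating the vertex cut operation $k$ times (with arbitrary choices of the vertices cut at each step). $\Delta^n$ is the $n$-simplex. A polytope $P=\mathrm{vc}^{k}(\Delta^{n_{1}}\times\ldots\times\Delta^{n_{r}})$ with $n_1\ge\ldots\ge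 n_r\ge 1$, $r\ge 1$, $k\ge 0$ is called a generalized truncation polytope of type $(k;n_1,\ldots,n_r)$.
   Formalization: The case d=1, k≥1 is excluded (a cut segment still has 2 facets, not 2+k), and (b) is stated only for k=0 or d≥3: for d=2, k≥1 it is false (vc(Δ²) is a quadrilateral with β^{-1,4}=2, but (b) gives 1). *)

(* Defs.v *)
From HB Require Import structures.
From mathcomp Require Import all_boot all_order all_algebra.
From mathcomp Require Import generic_quotient ring_quotient.
From mathcomp Require Import mpoly.
From mathcomp Require Import boolp classical_sets reals.

Set Implicit Arguments.
Unset Strict Implicit.
Unset Printing Implicit Defensive.

Import GRing.Theory.

Local Open Scope ring_scope.
Local Open Scope classical_set_scope.

Section Polytopes.
Variables (R : realType) (d : nat).
Implicit Types (P Q F : set 'rV[R]_d).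

Definition dot (x : 'rV[R]_d) (c : 'cV[R]_d) : R := (x *m c) 0 0.

Definition affinely_independent s (p : 'I_s -> 'rV[R]_d) : bool :=
  row_free (\matrix_(i < s) row_mx (1%:M : 'M[R]_1) (p i)).

Definition has_dim F (e : nat) : Prop :=
  (exists2 p : 'I_e.+1 -> 'rV[R]_d,
     affinely_independent p & forall i, F (p i)) /\
  (forall p : 'I_e.+2 -> 'rV[R]_d,
     (forall i, F (p i)) -> ~~ affinely_independent p).

Definition face P F : Prop :=
  exists (c : 'cV[R]_d) (b : R),
    (forall x, P x -> dot x c <= b) /\ F = P `&` [set x | dot x c = b].

Definition vertex P (v : 'rV[R]_d) : Prop := face P [set v].

Definition facet P F : Prop :=
  face P F /\ exists e, has_dim P e.+1 /\ has_dim F e.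

(* Q = vc(P), for some choice of the vertex v and of the hyperplane
   {x | dot x c = b}; v lies strictly on the side that is removed. *)
Definition vertex_cut P Q : Prop :=
  exists (v : 'rV[R]_d) (c : 'cV[R]_d) (b : R),
    [/\ vertex P v, c != 0, b < dot v c,
        forall w, vertex P w -> w <> v -> dot w c < b
      & Q = P `&` [set x | dot x c <= b]].

Fixpoint iterated_vertex_cut (k : nat) P Q : Prop :=
  if k is k'.+1 then
    exists2 P', iterated_vertex_cut k' P P' & vertex_cut P' Q
  else Q = P.

Definition simplex (S : set 'rV[R]_d) : Prop :=
  exists2 p : 'I_d.+1 -> 'rV[R]_d, affinely_independent p &
    S = [set x | exists w : 'I_d.+1 -> R,
           [/\ forall i, 0 <= w i, \sum_i w i = 1 & x = \sum_i w i *: p i]].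

Definition facet_labelling P m (F : 'I_m -> set 'rV[R]_d) : Prop :=
  injective F /\ forall G, facet P G <-> exists i, F i = G.

End Polytopes.

(* R^(n_1 + ... + n_r) is split into the consecutive blocks R^(n_i) by
   submxrow. *)
Definition polytope_prod (R : realType) r (n : 'I_r -> nat)
    (S : forall i, set 'rV[R]_(n i)) : set 'rV[R]_(\sum_i n i) :=
  [set x | forall i, S i (submxrow x i)].

Definition generalized_truncation_polytope (R : realType) (k : nat)
    r (n : 'I_r -> nat) (P : set 'rV[R]_(\sum_i n i)) : Prop :=
  exists2 S : forall i, set 'rV[R]_(n i),
    forall i, simplex (S i) & iterated_vertex_cut k (polytope_prod S) P.

Arguments generalized_truncation_polytope {R} k {r} n P.

Record simplicial_complex m := SimplicialComplex {
  simplices :> {set {set 'I_m}};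
  empty_simplex : finset.set0 \in simplices;
  simplices_closed : forall I J : {set 'I_m},
    J \subset I -> I \in simplices -> J \in simplices }.

Section FacetComplex.
Variables (R : realType) (d m : nat) (F : 'I_m -> set 'rV[R]_d).

Definition meeting_facets : {set {set 'I_m}} :=
  [set I : {set 'I_m} | `[< exists x, forall i, i \in I -> F i x >]]%SET.

Lemma meeting_facets0 : finset.set0 \in meeting_facets.
Proof. by rewrite inE; apply/asboolP; exists 0 => i; rewrite inE. Qed.

Lemma meeting_facets_closed (I J : {set 'I_m}) :
  J \subset I -> I \in meeting_facets -> J \in meeting_facets.
Proof.
move=> /fintype.subsetP sJI; rewrite !finset.in_set => /asboolP[x Fx].
apply/asboolP; exists x => i iJ; exact/Fx/sJI.
Qed.

(* The complex K_P, when F is a labelling of the facets of P by [m]. *)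
Definition facet_complex : simplicial_complex m :=
  SimplicialComplex meeting_facets0 meeting_facets_closed.

End FacetComplex.

Section FaceRing.
Variables (k : idomainType) (m : nat) (K : simplicial_complex m).

Definition sr_ideal : {pred {mpoly k[m]}} := fun p =>
  `[< exists q : {set 'I_m} -> {mpoly k[m]},
        p = \sum_(I : {set 'I_m} | I \notin simplices K)
              q I * \prod_(i in I) 'X_i >].

Lemma sr_ideal_idealr_closed : idealr_closed sr_ideal.
Proof.
split.
- apply/asboolP; exists (fun=> 0).
  by rewrite big1 // => I _; rewrite mul0r.
- apply/asboolP => -[q /(congr1 (mcoeff 0%MM))] /eqP.
  rewrite mcoeff1 eqxx raddf_sum big1 ?oner_eq0 // => I IK.
  rewrite /= rmorphM rmorph_prod /=.
  have [I0|[i iI]] := set_0Vmem I.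
    by move: IK; rewrite I0 empty_simplex.
  by rewrite (bigD1 i) //= mcoeffX mnm1_eq0 mul0r mulr0.
- move=> a u v /asboolP[q ->] /asboolP[q' ->].
  apply/asboolP; exists (fun I => a * q I + q' I).
  rewrite mulr_sumr -big_split /=; apply: eq_bigr => I _.
  by rewrite mulrDl mulrA.
Qed.

HB.instance Definition _ :=
  isIdealr.Build {mpoly k[m]} sr_ideal sr_ideal_idealr_closed.

Definition face_ring := {ideal_quot sr_ideal}.

Definition to_face_ring (p : {mpoly k[m]}) : face_ring :=
  \pi_({ideal_quot sr_ideal})%qT p.

End FaceRing.

(* Since deg v_i = 2, the internal degree 2j is the polynomial degree j. All
   degrees below are polynomial degrees. *)
Section BettiNumbers.
Variables (k : idomainType) (m : nat).
Local Notation S := {mpoly k[m]}.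

(* p * e has degree j, where e is a generator of degree a *)
Definition shifted_homog (a j : nat) (p : S) : bool :=
  if (a <= j)%N then p \is (j - a).-homog else p == 0.

(* A graded free resolution
     ... -> S^(res_rank 1) -> S^(res_rank 0) -> k -> 0
   of the trivial S-module k = S / (v_1, ..., v_m), placed in degree 0. The q-th
   generator of the p-th module has degree res_deg q, and the maps are right
   multiplications of row vectors by matrices. *)
Record graded_resolution := GradedResolution {
  res_rank : nat -> nat;
  res_deg : forall p, 'I_(res_rank p) -> nat;
  res_diff : forall p, 'M[S]_(res_rank p.+1, res_rank p);
  res_aug : 'cV[k]_(res_rank 0);
  res_diff_homog : forall p (q : 'I_(res_rank p.+1)) (l : 'I_(res_rank p)),
    shifted_homog (res_deg l) (res_deg q) (res_diff p q l);
  res_aug_homog : forall q : 'I_(res_rank 0),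
    res_deg q <> 0%N -> res_aug q 0 = 0;
  res_aug_surj : exists x : 'rV[k]_(res_rank 0), x *m res_aug = 1%:M;
  res_exact0 : forall x : 'rV[S]_(res_rank 0),
    map_mx (mcoeff 0%MM) x *m res_aug = 0 <->
    exists y : 'rV[S]_(res_rank 1), x = y *m res_diff 0;
  res_exactS : forall p (x : 'rV[S]_(res_rank p.+1)),
    x *m res_diff p = 0 <->
    exists y : 'rV[S]_(res_rank p.+2), x = y *m res_diff p.+1 }.

Variables (K : simplicial_complex m) (G : graded_resolution).
Local Notation A := (face_ring k K).
Local Notation phi := (@to_face_ring k m K).

(* The complex A (x)_S G, with p-th term A^(res_rank p), whose homology is
   Tor_S(A, k). *)
Definition tor_cycle (i : nat) : 'rV[A]_(res_rank G i) -> Prop :=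
  match i with
  | 0 => fun _ => True
  | p.+1 => fun x => x *m map_mx phi (res_diff G p) = 0
  end.

Definition tor_boundary (i : nat) (x : 'rV[A]_(res_rank G i)) : Prop :=
  exists y : 'rV[A]_(res_rank G i.+1), x = y *m map_mx phi (res_diff G i).

Definition tor_homog (i j : nat) (x : 'rV[A]_(res_rank G i)) : Prop :=
  exists2 y : 'rV[S]_(res_rank G i),
    forall q, shifted_homog (res_deg q) j (y 0 q) & x = map_mx phi y.

Definition tor_independent (i j s : nat) : Prop :=
  exists2 z : 'I_s -> 'rV[A]_(res_rank G i),
    forall t, tor_cycle (z t) /\ tor_homog j (z t) &
    forall c : 'I_s -> k,
      tor_boundary (\sum_t phi (c t)%:MP *: z t) -> forall t, c t = 0.

(* The rank of the k-module Tor_i(A, k)_j; it is the dimension when k is a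
   field. *)
Definition tor_rank (i j : nat) : nat :=
  xget 0%N [set s | tor_independent i j s /\
                    forall s', tor_independent i j s' -> (s' <= s)%N].

End BettiNumbers.

(* betti k K i j is beta^{-i,2j}(k[K]). The Tor module does not depend on the
   resolution, so any resolution can be picked. *)
Definition betti (k : idomainType) m (K : simplicial_complex m) (i j : nat) :
    nat :=
  xget 0%N [set b | exists G : graded_resolution k m, b = tor_rank K G i j].

Inductive char0_field_or_int : idomainType -> Prop :=
  | Char0Field (k : fieldType) of [pchar k] =i pred0 : char0_field_or_int k
  | Integers : char0_field_or_int int.

Definition binz (b c : int) : int :=
  match b, c with
  | Posz b', Posz c' => ('C(b', c'))%:Z
  | _, _ => 0
  end.

(* Main.v *)
From HB Require Import structures.
From mathcomp Require Import boolp classical_sets reals.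
From mathcomp Require Import all_boot all_order all_algebra.
From mathcomp Require Import generic_quotient ring_quotient fraction mpoly.
From mathcomp Require Import zify ring lra.
Require Import Defs.

Set Implicit Arguments.
Unset Strict Implicit.
Unset Printing Implicit Defensive.

Import GRing.Theory.

(** The proof has an algebraic, a combinatorial and a geometric part.

    Algebra. Tor can be computed from any resolution
    ([tor_independent_transfer]), in particular from the Koszul resolution
    ([koszul_resolution]). The Koszul complex of the face ring is
    multigraded. In a multidegree with some exponent at least 2, exchanging
    a factor of the corresponding variable for an exterior generator is a
    contraction ([koszul_toggle]); in the square-free multidegree of a set
    J, the complex is the cochain complex of the full subcomplex K_J. This
    gives Hochster's formula [betti_hochster]: the Betti number in
    homological degree i and polynomial degree j is the sum, over the sets
    J of j vertices, of the dimensions of the reduced cohomology of K_J in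
    degree j - i - 1. Over a domain the rank of Tor is a dimension over the
    field of fractions ([homology_rank]), so that fields and the integers
    are treated alike.

    Combinatorics. A vertex cut replaces a facet I of K by the cone with a
    new apex w over the boundary of I. This affects the cohomology of the
    full subcomplexes in a controlled way. If J does not contain w, then
    K_J loses the facet I whenever I is a subset of J, which creates a
    class in degree d - 2 unless J is the whole old vertex set
    ([coh_step_old]). If J contains w, then in nonnegative degrees K_J has
    the cohomology of the old full subcomplex on J minus w, except that w
    is an isolated point when J misses I ([coh_step_new]). All that has to
    be known of K for this is that it behaves like a sphere ([sphere_inv]),
    a property that the joins of boundaries of simplices have
    ([sphere_inv_base]) and that is preserved ([sphere_inv_step]). Summing
    over J gives recursions of Pascal type in the number of cuts
    ([total_formula]), with a term for the spheres in the initial join, one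
    for the isolated points and one for the removed facets. The second has
    a closed form ([point_termE]), and Alexander duality turns it into the
    third ([hole_termE]).

    Geometry. A simple polytope is described by inequalities whose normals
    are linearly independent wherever they are active ([presentation]).
    Products of simplices have such a description ([product_presentation]),
    vertex cuts keep it ([cut_presentation]), and the sets of inequalities
    that are active at a common point form a join of boundaries of
    simplices in the first case and a stellar subdivision in the second
    ([stellar_cut]). The facets are exactly the faces given by single
    inequalities ([facet_pres_facet]), so any labelling of the facets
    yields this complex. *)

(** * Ranks of matrices indexed by finite sets *)

Section Blocks.
Local Open Scope ring_scope.
Variable F : comNzRingType.

(** A single function f gives all the blocks, so that the ranks of blocks on
    different subsets can be compared without choosing bases. *)
Definition blk (E E' : finType) (f : E -> E' -> F) (X : {set E})
    (Y : {set E'}) : 'M[F]_(#|X|, #|Y|) :=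
  \matrix_(i, j) f (enum_val i) (enum_val j).

Definition kron (E : finType) (x y : E) : F := (x == y)%:R.

Lemma blk_eq (E E' : finType) (f g : E -> E' -> F)
    (X : {set E}) (Y : {set E'}) :
  {in X & Y, forall x y, f x y = g x y} -> blk f X Y = blk g X Y.
Proof. by move=> fg; apply/matrixP=> i j; rewrite !mxE fg ?enum_valP. Qed.

Lemma blk_mul (E E' E'' : finType) (f : E -> E' -> F) (g : E' -> E'' -> F)
    (X : {set E}) (Y : {set E'}) (Z : {set E''}) :
  blk f X Y *m blk g Y Z = blk (fun x z => \sum_(y in Y) f x y * g y z) X Z.
Proof.
apply/matrixP => i j; rewrite !mxE [RHS]big_enum_val /=.
by apply: eq_bigr => l _; rewrite !mxE.
Qed.

Lemma sum_pick (E : finType) (Y : {set E}) (y0 : E) (g : E -> F) :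
  y0 \in Y -> \sum_(y in Y) (y0 == y)%:R * g y = g y0.
Proof.
move=> yY; rewrite (bigD1 y0) //= eqxx mul1r big1 ?addr0 // => y /andP[_ ne].
by rewrite eq_sym (negPf ne) mul0r.
Qed.

End Blocks.

Section BlockRank.
Local Open Scope ring_scope.
Variable F : fieldType.

(** The smaller block is the larger one multiplied by selection matrices on
    both sides. *)
Lemma rank_blk_le (E1 E1' E2 E2' : finType) (f : E1 -> E1' -> F)
    (g : E2 -> E2' -> F) (p : E1 -> E2) (p' : E1' -> E2')
    (X : {set E1}) (X' : {set E1'}) (Y : {set E2}) (Y' : {set E2'}) :
  {in X, forall x, p x \in Y} -> {in X', forall x, p' x \in Y'} ->
  {in X & X', forall x x', f x x' = g (p x) (p' x')} ->
  (\rank (blk f X X') <= \rank (blk g Y Y'))%N.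
Proof.
move=> pX pX' fg.
have -> : blk f X X' = blk (fun x y => (p x == y)%:R) X Y *m blk g Y Y' *m
    blk (fun y x => (p' x == y)%:R) Y' X'.
  rewrite !blk_mul; apply: blk_eq => x x' xX x'X; rewrite fg //.
  under eq_bigr do rewrite sum_pick ?pX // mulrC.
  by rewrite (@sum_pick _ _ Y' (p' x') (g (p x))) // pX'.
exact: leq_trans (mxrankM_maxl _ _) (mxrankM_maxr _ _).
Qed.

(** The columns [p x] form an invertible diagonal matrix. *)
Lemma rank_blk_diag (E E' : finType) (f : E -> E' -> F) (p : E -> E')
    (X : {set E}) (Y : {set E'}) :
  {in X, forall x, p x \in Y} -> {in X, forall x, f x (p x) != 0} ->
  {in X &, forall x x', x != x' -> f x (p x') = 0} ->
  (#|X| <= \rank (blk f X Y))%N.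
Proof.
move=> pX f1 f0; set M := blk f X Y.
pose N := blk (fun y x => (p x == y)%:R * (f x (p x))^-1) Y X.
suff MN : M *m N = 1%:M.
  by rewrite -[X in (X <= _)%N](mxrank1 F #|X|) -MN mxrankM_maxl.
rewrite blk_mul; apply/matrixP => i j; rewrite !mxE.
under eq_bigr do rewrite mulrCA.
rewrite sum_pick ?pX ?enum_valP //.
have [->|ij] := eqVneq i j; first by rewrite divff // f1 ?enum_valP.
by rewrite f0 ?mul0r ?enum_valP // (inj_eq enum_val_inj).
Qed.

Lemma rank_blk_le0 (E E' : finType) (f : E -> E' -> F)
    (X : {set E}) (Y : {set E'}) :
  {in X & Y, forall x y, f x y = 0} -> \rank (blk f X Y) = 0%N.
Proof.
move=> f0; apply/eqP; rewrite mxrank_eq0; apply/eqP/matrixP => i j.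
by rewrite !mxE f0 ?enum_valP.
Qed.

Section Split.
Variables (E0 E1 E2 : finType) (f : E0 -> E1 -> F) (g : E1 -> E2 -> F).
Variables (A0 B0 X0 : {set E0}) (A1 B1 X1 : {set E1}) (B2 : {set E2}).
Hypotheses (X0E : X0 = A0 :|: B0) (X1E : X1 = A1 :|: B1).
Hypothesis dis1 : [disjoint A1 & B1].
Hypothesis f0 : {in B0 & A1, forall x y, f x y = 0}.
Hypothesis fg0 : {in X0 & B2, forall x z, \sum_(y in X1) f x y * g y z = 0}.

Let M := blk f X0 X1.
Let PA := blk (@kron F E1) X1 A1.
Let PB := blk (@kron F E1) X1 B1.

Let sA1 : {in A1, forall y, y \in X1}.
Proof. by move=> y yA; rewrite X1E inE yA. Qed.
Let sB1 : {in B1, forall y, y \in X1}.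
Proof. by move=> y yA; rewrite X1E inE yA orbT. Qed.

Let MP (C : {set E1}) (sC : {in C, forall y, y \in X1}) :
  M *m blk (@kron F E1) X1 C = blk f X0 C.
Proof.
rewrite blk_mul; apply: blk_eq => x y xX yC.
under eq_bigr do rewrite /kron eq_sym mulrC.
by rewrite sum_pick ?sC.
Qed.

Let rank_MPA : \rank (M *m PA) = \rank (blk f A0 A1).
Proof.
rewrite (MP sA1); apply/eqP; rewrite eqn_leq; apply/andP; split; last first.
  by apply: (rank_blk_le (p := id) (p' := id)) => // x; rewrite X0E inE => ->.
suff -> : blk f X0 A1 = blk (@kron F E0) X0 A0 *m blk f A0 A1.
  exact: mxrankM_maxr.
rewrite blk_mul; apply: blk_eq => x y; rewrite X0E inE => /orP[xA|xB] yA.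
  by rewrite sum_pick.
rewrite f0 //; have [xA|xA] := boolP (x \in A0).
  by rewrite sum_pick // f0.
rewrite big1 // => x' x'A; rewrite /kron; case: eqP => [xx'|_]; last exact: mul0r.
by rewrite xx' x'A in xA.
Qed.

(** With f block triangular, the projection of its row space to [A1] is that of
    the A-block, and the kernel of this projection contains the rows indexed by
    [B0]. *)
Lemma rank_split_ge :
  (\rank (blk f A0 A1) + \rank (blk f B0 B1) <= \rank (blk f X0 X1))%N.
Proof.
rewrite -rank_MPA -(mxrank_mul_ker M PA) leq_add2l.
pose N := blk f B0 X1.
have NE : N = blk (@kron F E0) B0 X0 *m M.
  by rewrite blk_mul; apply: blk_eq => x y xB yX; rewrite sum_pick // X0E inE xB orbT.
have NM : (N <= M :&: kermx PA)%MS.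
  rewrite sub_capmx NE submxMl /=; apply/sub_kermxP.
  rewrite -mulmxA (MP sA1) blk_mul; apply/matrixP => i j; rewrite !mxE.
  by rewrite sum_pick ?f0 ?enum_valP // X0E inE enum_valP orbT.
apply: leq_trans (mxrankS NM).
by apply: (rank_blk_le (p := id) (p' := id)).
Qed.

(** The row space of f meets the kernel of the projection to [A1] in vectors
    supported on [B1] that g kills; there are at most [#|B1|] minus the rank of
    g independent ones. *)
Lemma rank_split_le :
  (\rank (blk f X0 X1) + \rank (blk g B1 B2)
     <= \rank (blk f A0 A1) + #|B1|)%N.
Proof.
rewrite -rank_MPA -[\rank (blk f X0 X1)](mxrank_mul_ker M PA) -addnA leq_add2l.
set W := (M :&: kermx PA)%MS.
have WPA : W *m PA = 0 by apply/sub_kermxP; exact: capmxSr.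
have PP (C : {set E1}) : (blk (@kron F E1) X1 C) *m (blk (@kron F E1) C X1) =
    blk (fun x y => ((x == y) && (x \in C))%:R) X1 X1.
  rewrite blk_mul; apply: blk_eq => x y xX yX.
  have [xC|xC] := boolP (x \in C); first by rewrite sum_pick // andbT.
  rewrite andbF big1 // => z zC; rewrite /kron; case: eqP => [xz|_].
    by rewrite xz zC in xC.
  by rewrite mul0r.
have PAB : PA *m blk (@kron F E1) A1 X1 + PB *m blk (@kron F E1) B1 X1 = 1%:M.
  rewrite !PP; apply/matrixP => i j; rewrite !mxE (inj_eq enum_val_inj).
  case: eqP => _ /=; last by rewrite addr0.
  have : enum_val i \in A1 :|: B1 by rewrite -X1E enum_valP.
  rewrite inE; case: (boolP (_ \in A1)) => [xA|_] /= xB; last first.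
    by rewrite xB add0r.
  by rewrite (disjointFr dis1) // addr0.
have WPB : W = W *m PB *m blk (@kron F E1) B1 X1.
  by rewrite -[LHS]mulmx1 -PAB mulmxDr mulmxA WPA mul0mx add0r mulmxA.
have WPBg : W *m PB *m blk g B1 B2 = 0.
  have -> : blk g B1 B2 = blk (@kron F E1) B1 X1 *m blk g X1 B2.
    by rewrite blk_mul; apply: blk_eq => x y xB yB; rewrite sum_pick ?sB1.
  rewrite mulmxA -WPB; have /submxP[Y ->] : (W <= M)%MS by exact: capmxSl.
  rewrite -mulmxA blk_mul.
  suff -> : blk (fun x z => \sum_(y in X1) f x y * g y z) X0 B2 = 0.
    by rewrite mulmx0.
  by apply/matrixP => i j; rewrite !mxE fg0 ?enum_valP.
have rW : (\rank W <= \rank (W *m PB))%N by rewrite {1}WPB mxrankM_maxl.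
have /mxrankS : (W *m PB <= kermx (blk g B1 B2))%MS by apply/sub_kermxP.
rewrite mxrank_ker => le.
rewrite addnC -leq_subRL ?rank_leq_row //; exact: leq_trans le.
Qed.
End Split.
End BlockRank.

(** * Cohomology of families of sets *)

Section Cochains.
Local Open Scope ring_scope.
Variables (F : fieldType) (U : finType).
Implicit Types (t u v I : {set U}) (s : U -> {set U} -> F) (D A B : {set {set U}}) (q : nat).

(** The anticommutation rule makes the coboundary square to zero. The signs are
    not tied to an order of the vertices, since those of Hochster's formula
    depend on the full subcomplex. *)
Definition sign_system s : Prop :=
  (forall i t, i \notin t -> s i t != 0) /\
  (forall i j t, i != j -> i \notin t -> j \notin t ->
     s i t * s j (i |: t) + s j t * s i (j |: t) = 0).

(** The sum has at most one term. *)
Definition coboundary s (t u : {set U}) : F :=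
  \sum_(i | (i \notin t) && (u == i |: t)) s i t.

Lemma coboundary_add s i t : i \notin t -> coboundary s t (i |: t) = s i t.
Proof.
move=> it; rewrite /coboundary (bigD1 i) ?it ?eqxx //= big1 ?addr0 // => j.
case/andP=> /andP[jt /eqP e] ji; have : j \in i |: t by rewrite e !inE eqxx.
by rewrite !inE (negPf ji) (negPf jt).
Qed.

Lemma coboundary_neq0 s t u :
  coboundary s t u != 0 -> exists2 i, i \notin t & u = i |: t.
Proof.
move=> nz; case: (pickP (fun i => (i \notin t) && (u == i |: t))).
  by move=> i /andP[it /eqP]; exists i.
by move=> no; rewrite /coboundary big_pred0 ?eqxx // in nz.
Qed.

(** These are the differences of two simplicial complexes, whose coboundary is
    that of a relative cochain complex. *)
Definition interval_closed D :=
  forall t u v, t \in D -> v \in D -> t \subset u -> u \subset v -> u \in D.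

Definition level D q := [set t in D | #|t| == q].
(** This is [level D q.-1] for positive q and empty for [q = 0], where the
    coboundary starts from zero. *)
Definition prev_level D q := [set t in D | #|t|.+1 == q].

Definition coboundary_rank s D q := \rank (blk (coboundary s) (prev_level D q) (level D q)).

Lemma prev_levelS D q : prev_level D q.+1 = level D q.
Proof. by apply/setP => t; rewrite !inE. Qed.

Lemma coboundary_rankS s D q :
  coboundary_rank s D q.+1 = \rank (blk (coboundary s) (level D q) (level D q.+1)).
Proof. by rewrite /coboundary_rank prev_levelS. Qed.

(** For a simplicial complex this is the dimension of the reduced cohomology in
    degree [q - 1]: the empty face is at level 0. *)
Definition coh s D q := (#|level D q| - coboundary_rank s D q - coboundary_rank s D q.+1)%N.

(** If t and v differ by i and j, the two intermediate sets belong to D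
    together and their contributions cancel. *)
Lemma coboundary_sq s D q t v : sign_system s -> interval_closed D ->
  t \in prev_level D q -> v \in D ->
  \sum_(u in level D q) coboundary s t u * coboundary s u v = 0.
Proof.
move=> [_ sA] iD; rewrite inE => /andP[tD tq] vD.
case: (pickP [pred u in level D q | coboundary s t u * coboundary s u v != 0]);
  last first.
  move=> no; apply: big1 => u uD; apply/eqP; have := no u; rewrite /= uD /=.
  by move/negbFE.
move=> u /= /andP[uD]; rewrite mulf_eq0 negb_or => /andP[/coboundary_neq0].
case=> i it ui /coboundary_neq0[j ju vj]; subst u v.
move: ju; rewrite !inE negb_or => /andP[ji jt].
have swap : j |: (i |: t) = i |: (j |: t) by rewrite setUCA.
have jtD : j |: t \in level D q.
  rewrite inE cardsU1 jt add1n tq andbT (iD t _ (j |: (i |: t))) ?subsetUr //.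
  by rewrite setUS ?subsetUr.
have neq : j |: t != i |: t.
  by apply/eqP => /setP/(_ i); rewrite !inE eqxx eq_sym (negPf ji) (negPf it).
rewrite (bigD1 (i |: t)) //= (bigD1 (j |: t)) ?jtD //= big1 => [|u].
  rewrite addr0 {2}swap !coboundary_add ?sA 1?eq_sym //.
    by rewrite !inE negb_or eq_sym ji.
  by rewrite !inE negb_or ji.
case/andP=> /andP[uD' ui] uj; apply/eqP; apply/negPn/negP => nz.
move: nz; rewrite mulf_eq0 negb_or => /andP[/coboundary_neq0[l lt ul]].
case/coboundary_neq0=> l' _ e; have : l \in j |: (i |: t).
  by rewrite e ul !inE eqxx orbT.
rewrite !inE (negPf lt) orbF => /orP[] /eqP ll; move: ui uj.
  by rewrite ul ll eqxx.
by rewrite ul ll eqxx.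
Qed.

(** The truncated subtractions in [coh] are exact because consecutive
    coboundaries compose to zero. *)
Lemma cohE s D q : sign_system s -> interval_closed D ->
  (coh s D q + coboundary_rank s D q + coboundary_rank s D q.+1 = #|level D q|)%N.
Proof.
move=> hs iD; suff : (coboundary_rank s D q + coboundary_rank s D q.+1 <= #|level D q|)%N.
  by rewrite /coh; lia.
rewrite coboundary_rankS; apply: mulmx0_rank_max.
rewrite blk_mul; apply/matrixP => i j; rewrite !mxE.
apply: (coboundary_sq hs iD); first exact: enum_valP.
by have := enum_valP j; rewrite inE => /andP[].
Qed.

Definition up_closed B D :=
  forall t u, t \in B -> u \in D -> t \subset u -> u \in B.

Lemma interval_closed_up B D :
  interval_closed D -> B \subset D -> up_closed B D -> interval_closed B.
Proof.
move=> iD sB uB t u v tB vB tu uv; apply: (uB t) => //.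
by apply: (iD t u v); rewrite ?(subsetP sB).
Qed.

Lemma interval_closed_down B D :
  interval_closed D -> up_closed B D -> interval_closed (D :\: B).
Proof.
move=> iD uB t u v; rewrite !inE => /andP[tB tD] /andP[vB vD] tu uv.
rewrite (iD t u v) // andbT; apply: contra vB => uB'; exact: uB vD uv.
Qed.

(** The long exact sequence of a subcomplex of cochains B and its quotient;
    [rho q] is the rank of the connecting map into the cohomology of B at level
    q. *)
Lemma coh_split s D B : sign_system s -> interval_closed D ->
    B \subset D -> up_closed B D ->
  exists2 rho, forall q, (rho q <= coh s B q)%N &
    forall q, (coh s D q + rho q + rho q.+1 = coh s (D :\: B) q + coh s B q)%N.
Proof.
move=> hs iD sB uB; set A := D :\: B.
have iA : interval_closed A by apply: interval_closed_down.
have iB : interval_closed B by apply: interval_closed_up sB uB.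
have DE : D = A :|: B by rewrite -{1}(setID D B) (setIidPr sB) setUC.
have levU q : level D q = level A q :|: level B q.
  by apply/setP => t; rewrite {1}DE !inE andb_orl.
have prevU q : prev_level D q = prev_level A q :|: prev_level B q.
  by apply/setP => t; rewrite {1}DE !inE andb_orl.
have dis q : [disjoint level A q & level B q].
  by apply/pred0P => t /=; rewrite !inE; case: (t \in B); rewrite ?andbF.
have f0 q : {in prev_level B q & level A q, forall t u, coboundary s t u = 0}.
  move=> t u; rewrite !inE => /andP[tB _] /andP[/andP[uB' uD] _].
  apply/eqP; apply: contraNT uB' => /coboundary_neq0[i _ e].
  by apply: (uB t) => //; rewrite e subsetUr.
have fg0 q : {in prev_level D q & level B q.+1, forall t v,
    \sum_(u in level D q) coboundary s t u * coboundary s u v = 0}.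
  move=> t v tD vB; apply: coboundary_sq => //.
  by move: vB; rewrite inE => /andP[/(subsetP sB)].
have up q : (coboundary_rank s D q + coboundary_rank s B q.+1 <=
    coboundary_rank s A q + #|level B q|)%N.
  rewrite coboundary_rankS.
  exact: (rank_split_le (prevU q) (levU q) (dis q) (@f0 q) (@fg0 q)).
have lo q : (coboundary_rank s A q + coboundary_rank s B q <= coboundary_rank s D q)%N.
  exact: (rank_split_ge (prevU q) (levU q) (@f0 q)).
have cardU q : (#|level D q| = #|level A q| + #|level B q|)%N.
  by rewrite levU cardsU disjoint_setI0 // cards0 subn0.
exists (fun q => coboundary_rank s D q - coboundary_rank s A q - coboundary_rank s B q)%N => q.
  by have := up q; have := cohE q hs iB; lia.
have := cohE q hs iA; have := cohE q hs iB; have := cohE q hs iD.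
by have := lo q; have := lo q.+1; have := cardU q; lia.
Qed.

Definition toggle_closed (v : U) B :=
  forall t, t \in B -> v |: t \in B /\ t :\ v \in B.

(** The coboundary of a set t without v contains [v |: t] and no other [v |:
    u], so its rank is at least the number of these t, which leaves no
    cohomology. *)
Lemma coh_toggle s B (v : U) q : sign_system s -> interval_closed B ->
  toggle_closed v B -> coh s B q = 0%N.
Proof.
move=> hs iB tB; have diag p :
    (#|[set t in prev_level B p | v \notin t]| <= coboundary_rank s B p)%N.
  apply: leq_trans (rank_blk_diag (f := coboundary s) (p := fun t => v |: t)
    (Y := level B p) _ _ _) _.
  - move=> t; rewrite !inE => /andP[/andP[tB' tp] vt].
    by rewrite (tB _ tB').1 cardsU1 vt add1n.
  - move=> t; rewrite !inE => /andP[_ vt].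
    rewrite /= coboundary_add //; exact: hs.1.
  - move=> t u; rewrite !inE => /andP[_ vt] /andP[_ vu] tu.
    apply/eqP; apply: contraNT tu => /coboundary_neq0[i it e].
    have : v \in i |: t by rewrite -e !inE eqxx.
    rewrite !inE (negPf vt) orbF => /eqP vi; subst i.
    by rewrite -[t](setU1K it) -e setU1K.
  apply: (rank_blk_le (p := id) (p' := id)) => // t.
  by rewrite inE => /andP[].
have := diag q; have := diag q.+1; have := cohE q hs iB.
have -> : #|level B q| = (#|[set t in prev_level B q.+1 | v \notin t]| +
    #|[set t in level B q | v \in t]|)%N.
  rewrite -(cardsID [set t : {set U} | v \notin t] (level B q)).
  congr (_ + _)%N; apply: eq_card => t; rewrite !inE ?negbK //.
  by rewrite andbC.
have : (#|[set t in level B q | v \in t]| <=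
        #|[set t in prev_level B q | v \notin t]|)%N.
  rewrite -(@card_in_imset _ _ (fun t => t :\ v)) => [|t u].
    apply/subset_leq_card/subsetP => _ /imsetP[t + ->].
    rewrite !inE eqxx /= => /andP[/andP[tB' /eqP <-] vt].
    by rewrite (tB _ tB').2 [X in _ == X](cardsD1 v) vt add1n eqxx.
  by rewrite !inE => /andP[_ vt] /andP[_ vu] e; rewrite -(setD1K vt) e setD1K.
lia.
Qed.

Lemma coh_single s (I : {set U}) q : sign_system s ->
  coh s [set I] q = (q == #|I|).
Proof.
move=> hs; have i1 : interval_closed [set I].
  move=> t u v /set1P-> /set1P-> tu ut.
  by rewrite inE eqEsubset ut.
have r0 p : coboundary_rank s [set I] p = 0%N.
  apply: rank_blk_le0 => t u; rewrite !inE => /andP[/eqP-> _] /andP[/eqP-> _].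
  apply/eqP; apply/negPn/negP => /coboundary_neq0[i iI e].
  by move: iI; rewrite {1}e !inE eqxx.
have := cohE q hs i1; rewrite !r0 !addn0 => ->; rewrite eq_sym.
case: eqP => [e|ne] /=.
  by rewrite -(cards1 I); apply: eq_card => t; rewrite !inE;
    case: eqP => //= ->; rewrite e eqxx.
apply/eqP; rewrite cards_eq0; apply/eqP/setP => t; rewrite !inE.
by case: eqP => //= ->; apply/eqP.
Qed.

(** An elementary collapse. *)
Lemma coh_remove_toggled s D B (v : U) q : sign_system s -> interval_closed D ->
  B \subset D -> up_closed B D -> toggle_closed v B ->
  coh s D q = coh s (D :\: B) q.
Proof.
move=> hs iD sB uB tB; have iB := interval_closed_up iD sB uB.
have [rho rho_le rhoE] := coh_split hs iD sB uB.
have := rhoE q; have := rho_le q; have := rho_le q.+1.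
by rewrite !(coh_toggle _ hs iB tB); lia.
Qed.

(** The cohomology of [[set I]] is one-dimensional. Removing I either kills a
    class at its level ([rho = 0]) or creates one at the level below ([rho =
    1]). *)
Lemma coh_remove_max s D I : sign_system s -> interval_closed D -> I \in D ->
    (forall t, t \in D -> I \subset t -> t = I) ->
  exists2 rho : nat, (rho <= 1)%N &
    forall q, (coh s D q + (q == #|I|) * rho + (q.+1 == #|I|) * rho =
               coh s (D :\ I) q + (q == #|I|))%N.
Proof.
move=> hs iD ID Imax.
have sI : [set I] \subset D by rewrite sub1set.
have uI : up_closed [set I] D.
  by move=> t u /set1P-> uD /(Imax _ uD)->; rewrite inE.
have [rho rho_le rhoE] := coh_split hs iD sI uI.
exists (rho #|I|) => [|q].
  by have := rho_le #|I|; rewrite coh_single // eqxx.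
have := rhoE q; have := rho_le q; have := rho_le q.+1.
rewrite !coh_single //.
have [->|/= _] := eqVneq q #|I|; last first.
  have [->|/= _] := eqVneq q.+1 #|I|; lia.
have [|/= _] := eqVneq #|I|.+1 #|I|; lia.
Qed.

End Cochains.

(** * Coning off faces *)

Section Cones.
Variables (F : fieldType) (U : finType).
Implicit Types (t u v I J T : {set U}) (K L : {set {set U}}) (q : nat) (w : U).
Variables (s : U -> {set U} -> F).
Hypothesis hs : sign_system s.

Definition down_closed K := forall t u, t \subset u -> u \in K -> t \in K.

Lemma down_interval_closed K : down_closed K -> interval_closed K.
Proof. by move=> dK t u v _ vK _ uv; apply: dK uv vK. Qed.

(** The full subcomplex on J. *)
Definition restr K J := [set t in K | t \subset J].

Lemma restr_down_closed K J : down_closed K -> down_closed (restr K J).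
Proof.
move=> dK t u tu; rewrite !inE => /andP[uK uJ].
by rewrite (dK _ _ tu uK) (subset_trans tu).
Qed.

Definition cone w T := [set t : {set U} | (w \in t) && (t :\ w \subset T)].
(** The faces that a stellar subdivision of the face T with new vertex w
    adds. *)
Definition open_cone w T := [set t : {set U} | (w \in t) && (t :\ w \proper T)].

Lemma subD1 w t u : t \subset u -> t :\ w \subset u :\ w.
Proof. by move=> tu; rewrite setSD. Qed.

(** The new faces are paired by a vertex of T. *)
Lemma coh_cone_add L w T q : down_closed L -> {in L, forall t : {set U}, w \notin t} ->
  T != set0 -> T \in L -> coh s (L :|: cone w T) q = coh s L q.
Proof.
move=> dL wL /set0Pn[v vT] TL.
have wT := wL _ TL.
have vw : v != w by apply: contraNneq wT => <-.
have dD : down_closed (L :|: cone w T).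
  move=> t u tu; rewrite !inE => /orP[uL|/andP[wu uT]].
    by rewrite (dL _ _ tu uL).
  have [wt|wt] := boolP (w \in t).
    by rewrite (subset_trans (subD1 w tu) uT) orbT.
  rewrite (dL t T) //; apply: subset_trans uT.
  by rewrite subsetD1 tu.
rewrite (coh_remove_toggled (B := cone w T) (v := v)) //.
- congr (coh s _ q); apply/setP => t; rewrite !inE.
  case: (boolP (t \in L)) => [tL|_] /=; first by rewrite (negPf (wL _ tL)).
  by rewrite andNb.
- exact: down_interval_closed.
- exact: subsetUr.
- move=> t u; rewrite !inE => /andP[wt tT] uD tu.
  by have wu := subsetP tu w wt; case/orP: uD => // /wL; rewrite wu.
- move=> t; rewrite !inE => /andP[wt tT]; rewrite wt orbT /= eq_sym vw /=.
  split; last by apply: subset_trans tT; rewrite setSD ?subD1set.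
  apply/subsetP => x; rewrite !inE => /andP[xw /orP[/eqP->//|xt]].
  by apply: (subsetP tT); rewrite !inE xw.
Qed.

(** The stellar subdivision of I is the cone over all of I without the faces I
    and [w |: I], which are paired by w. *)
Lemma coh_cone_swap L w I q : down_closed L -> {in L, forall t : {set U}, w \notin t} ->
  I != set0 -> I \in L -> {in L, forall t : {set U}, I \subset t -> t = I} ->
  coh s ((L :\ I) :|: open_cone w I) q = coh s L q.
Proof.
move=> dL wL I0 IL Imax; rewrite -(coh_cone_add q dL wL I0 IL).
have wI := wL _ IL.
have wwI : (w |: I) :\ w = I by rewrite setU1K.
rewrite [RHS](coh_remove_toggled (B := [set I; w |: I]) (v := w)) //.
- congr (coh s _ q); apply/setP => t; rewrite !inE properEneq.
  have [->|tI] := eqVneq t I; first by rewrite (negPf wI).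
  have [->|twI] /= := eqVneq t (w |: I).
    rewrite wwI eqxx andbF orbF; apply/negbTE/negP => /wL.
    by rewrite !inE eqxx.
  case: (boolP (w \in t)) => wt //=; congr (_ || _).
  case: eqP => // e; move: twI; rewrite -e setD1K // ?eqxx //.
- apply: down_interval_closed => t u tu; rewrite !inE => /orP[uL|/andP[wu uT]].
    by rewrite (dL _ _ tu uL).
  have [wt|wt] := boolP (w \in t).
    by rewrite (subset_trans (subD1 w tu) uT) orbT.
  by rewrite (dL t I) //; apply: subset_trans uT; rewrite subsetD1 tu.
- by apply/subsetP => t; rewrite !inE => /orP[] /eqP->;
    rewrite ?IL // wwI subxx !inE eqxx orbT.
- move=> t u; rewrite !inE => tI uD tu.
  have Iu : I \subset u.
    by case/orP: tI tu => /eqP-> //; rewrite subUset => /andP[].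
  case/orP: uD => [uL|/andP[wu uI]]; first by rewrite (Imax _ uL Iu) eqxx.
  apply/orP; right; rewrite -(setD1K wu); apply/eqP; congr (_ |: _).
  by apply/eqP; rewrite eqEsubset uI subsetD1 Iu.
- move=> t; rewrite !inE => /orP[] /eqP->.
    rewrite eqxx orbT; split=> //; apply/orP; left; apply/eqP/setP => x.
    by rewrite !inE; case: eqP => // ->; rewrite (negPf wI).
  by rewrite setUA setUid eqxx orbT wwI eqxx.
Qed.

Lemma restr_full (V : {set U}) K : {in K, forall t : {set U}, t \subset V} -> restr K V = K.
Proof.
by move=> KV; apply/setP => t; rewrite inE andb_idr // => /KV.
Qed.

(** The coboundary of the empty face does not vanish on a vertex. *)
Lemma coh0_nonempty (v : U) K : down_closed K ->
  [set v] \in K -> coh s K 0 = 0.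
Proof.
move=> dK vK; have K0 : set0 \in K by apply: dK vK; rewrite sub0set.
have := cohE 0 hs (down_interval_closed dK).
have -> : #|level K 0| = 1.
  rewrite -(cards1 (@set0 U)); apply: eq_card => t; rewrite !inE cards_eq0.
  by rewrite andb_idl // => /eqP->.
suff : 1 <= coboundary_rank s K 1 by lia.
rewrite coboundary_rankS -[X in X <= _](cards1 (@set0 U)).
apply: leq_trans (rank_blk_diag (f := coboundary s) (p := fun=> [set v])
  (Y := level K 1) _ _ _) _.
- by move=> t _; rewrite inE vK cards1.
- move=> t /set1P->; rewrite -[[set v]]setU0 coboundary_add ?inE //.
  by apply: hs.1; rewrite inE.
- by move=> t u /set1P-> /set1P->; rewrite eqxx.
apply: (rank_blk_le (p := id) (p' := id)) => // t /set1P->.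
by rewrite inE K0 cards0.
Qed.

Lemma proper_missing (A B : {set U}) (v : U) :
  v \in B -> B :\ v \subset A -> A \proper B -> v \notin A.
Proof.
move=> vB sA; rewrite properE => /andP[_]; apply: contra => vA.
by rewrite -(setD1K vB) subUset sub1set vA.
Qed.

End Cones.

(** * Stellar subdivisions of spheres *)

Section Truncation.
Variables (U : finType) (r : nat) (n : 'I_r -> nat).
Hypothesis n_gt0 : forall i, 0 < n i.
Implicit Types (t u I J T V : {set U}) (K L : {set {set U}}) (q : nat) (w : U).

Let d := \sum_i n i.

(** The join of the boundaries of the simplices with vertex sets [b i]: the
    complex of a product of simplices. *)
Definition block_join V K : Prop := exists b : 'I_r -> {set U},
  [/\ forall i, #|b i| = (n i).+1,
      forall i j, i != j -> [disjoint b i & b j],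
      V = \bigcup_i b i
    & K = [set t : {set U} | (t \subset V) && [forall i, ~~ (b i \subset t)]]].

(** The effect of a vertex cut on the complex of a simple polytope: I is the
    set of facets through the vertex and w the new facet. *)
Definition stellar_at V0 K0 V K : Prop := exists I w,
  [/\ I \in K0, #|I| = d, w \notin V0, V = w |: V0
    & K = (K0 :\ I) :|: open_cone w I].

Fixpoint truncation k V K : Prop :=
  if k is k'.+1 then
    exists V0 K0, truncation k' V0 K0 /\ stellar_at V0 K0 V K
  else block_join V K.

Variable F : fieldType.
Implicit Types (s : U -> {set U} -> F).

(** The part of being a sphere of dimension [d - 1] that survives the induction
    on cuts: the top cohomology is one-dimensional, vanishes on proper full
    subcomplexes, and is destroyed by removing any facet. It is required for
    all sign systems, since the signs vary with the full subcomplex. *)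
Record sphere_inv c V K : Prop := SphereInv {
  inv_card : #|V| = d + c;
  inv_sub : {in K, forall t : {set U}, t \subset V};
  inv_down : down_closed K;
  inv_vertex : {in V, forall v, [set v] \in K};
  inv_empty : set0 \in K;
  inv_dim : {in K, forall t : {set U}, #|t| <= d};
  inv_proper : forall s J, sign_system s -> J \proper V ->
    coh s (restr K J) d = 0;
  inv_full : forall s, sign_system s -> coh s K d = 1;
  inv_minus : forall s I, sign_system s -> I \in K -> #|I| = d ->
    coh s (K :\ I) d = 0 }.

Section Step.
Variables (c : nat) (V0 : {set U}) (K0 : {set {set U}}) (I : {set U}) (w : U).
Hypothesis inv0 : sphere_inv c V0 K0.
Hypotheses (IK : I \in K0) (Id : #|I| = d) (wV : w \notin V0) (d2 : 1 < d).
Let V := w |: V0.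
Let K := (K0 :\ I) :|: open_cone w I.

Let wK0 : {in K0, forall t : {set U}, w \notin t}.
Proof. by move=> t /(inv_sub inv0)/subsetP tV; apply: contra wV; apply: tV. Qed.

Let I0 : I != set0. Proof. by rewrite -cards_eq0 Id; lia. Qed.
Let wI : w \notin I. Proof. exact: wK0. Qed.

Let Imax : {in K0, forall t : {set U}, I \subset t -> t = I}.
Proof.
move=> t tK It; apply/eqP; rewrite eq_sym eqEcard It Id.
exact: inv_dim inv0 _ tK.
Qed.

Let K_down : down_closed K.
Proof.
move=> t u tu; rewrite !inE => /orP[/andP[uI uK]|/andP[wu uI]].
  have tK := inv_down inv0 tu uK; rewrite tK andbT; apply/orP; left.
  by apply: contraNneq uI => tI; rewrite (Imax uK) // -tI.
have [wt|wt] := boolP (w \in t).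
  by rewrite (sub_proper_trans (subD1 w tu) uI) orbT.
have tI : t \proper I by apply: sub_proper_trans uI; rewrite subsetD1 tu.
rewrite (inv_down inv0 (proper_sub tI) IK) andbT; apply/orP; left.
by move: tI; rewrite properEneq => /andP[].
Qed.

Let restr_old J : J \subset V0 -> restr K J = restr K0 J :\ I.
Proof.
move=> JV; apply/setP => t; rewrite !inE; case: (boolP (t \subset J)) => tJ.
  have wt : w \notin t by apply: contra wV => /(subsetP tJ)/(subsetP JV).
  by rewrite (negPf wt) /= orbF !andbT.
by rewrite !andbF.
Qed.

Let restr_interval L J : down_closed L -> interval_closed (restr L J).
Proof. by move=> dL; apply/down_interval_closed/restr_down_closed. Qed.

(** Only the facet I can be missing. On a proper full subcomplex there is no
    top cohomology to lose, so removing I creates a class one level below; on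
    [V0] it destroys the fundamental class. *)
Lemma coh_step_old s J q : sign_system s -> J \subset V0 ->
  coh s (restr K J) q =
  if q == d then 0 else
  coh s (restr K0 J) q + [&& q.+1 == d, I \subset J & J != V0].
Proof.
move=> hs JV; rewrite restr_old //.
have d0 := inv_down inv0.
have [IJ|IJ] := boolP (I \subset J); last first.
  have JV0 : J \proper V0.
    rewrite properEneq JV andbT; apply: contraNneq IJ => ->.
    exact: inv_sub inv0 _ IK.
  have -> : restr K0 J :\ I = restr K0 J.
    apply/setP => t; rewrite !inE; case: eqP => // ->.
    by rewrite (negPf IJ) andbF.
  rewrite andbF addn0; case: eqP => // ->.
  exact: inv_proper inv0 _ _ _ JV0.
have Imax' t : t \in restr K0 J -> I \subset t -> t = I.
  by rewrite inE => /andP[/Imax].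
have IJ' : I \in restr K0 J by rewrite inE IK.
have [rho rho1 rhoE] := coh_remove_max hs (@restr_interval _ J d0) IJ' Imax'.
have := rhoE d; have := rhoE q; rewrite Id eqxx /=.
have d1 : (d.+1 == d) = false by lia.
have [->|JV0] := eqVneq J V0; last first.
  have := inv_proper inv0 hs (J := J); rewrite properEneq JV0 JV => /(_ isT) c0.
  by case: (eqVneq q d) => [->|_]; rewrite d1 c0 /=; case: (q.+1 == d) => /=; lia.
rewrite !(restr_full (inv_sub inv0)).
have := inv_full inv0 hs; have := inv_minus inv0 hs IK Id.
by case: (eqVneq q d) => [->|_]; rewrite d1 /= ?andbF; lia.
Qed.

Let w_restr L J : {in L, forall t : {set U}, w \notin t} ->
  {in restr L J, forall t : {set U}, w \notin t}.
Proof. by move=> wL t; rewrite inE => /andP[/wL]. Qed.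

(** If I is a subset of J, this is a stellar subdivision of the old full
    subcomplex; if J meets I without containing it, a cone over the face [J :&:
    I] has been attached. If J misses I, the vertex w is isolated, which
    creates a component unless J is empty. *)
Lemma coh_step_new s J q : sign_system s -> J \subset V0 -> 0 < q ->
  coh s (restr K (w |: J)) q =
  coh s (restr K0 J) q + [&& q == 1, J != set0 & [disjoint J & I]].
Proof.
move=> hs JV q0; have d0 := inv_down inv0.
have dJ := restr_down_closed (J := J) d0.
have wJ : w \notin J by apply: contra wV => /(subsetP JV).
have subw t : w \in t -> (t \subset w |: J) = (t :\ w \subset J).
  by move=> wt; rewrite subDset.
have subNw t : w \notin t -> (t \subset w |: J) = (t \subset J).
  move=> wt; apply/idP/idP => [|tJ]; last by rewrite (subset_trans tJ) ?subsetUr.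
  by rewrite -subDset => /(subset_trans _)->//; rewrite subsetD1 subxx.
have mem t : (t \in restr K (w |: J)) = if w \in t then
    (t :\ w \proper I) && (t :\ w \subset J)
    else [&& t != I, t \in K0 & t \subset J].
  rewrite !inE; case: ifP => wt; last by rewrite subNw ?wt // orbF andbA.
  rewrite subw //; case: (boolP (t \in K0)) => [/wK0|_]; first by rewrite wt.
  by rewrite andbF.
have [JI|] := boolP [disjoint J & I]; last first.
  rewrite !andbF addn0 -setI_eq0 => JI0.
  have [IJ|IJ] := boolP (I \subset J).
    rewrite -(@coh_cone_swap _ _ s hs (restr K0 J) w I q dJ (w_restr wK0)) //.
    - congr (coh s _ q); apply/setP => t; rewrite mem !inE.
      case: ifP => wt; last by rewrite orbF.
      rewrite andb_idr => [|tI]; last by apply: subset_trans IJ; apply: proper_sub.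
      case: (boolP (t \in K0)) => [/wK0|_]; first by rewrite wt.
      by rewrite andbF.
    - by rewrite inE IK.
    - by move=> t; rewrite inE => /andP[/Imax].
  rewrite -(@coh_cone_add _ _ s hs (restr K0 J) w (J :&: I) q dJ (w_restr wK0)) //.
    congr (coh s _ q); apply/setP => t; rewrite mem !inE.
    case: ifP => wt.
      rewrite subsetI andbC; case: (boolP (t \in K0)) => [/wK0|_].
        by rewrite wt.
      case: (boolP (t :\ w \subset J)) => //= tJ.
      by rewrite properE andb_idr // => _; apply: contra IJ => /subset_trans; apply.
    rewrite orbF; case: eqP => // ->; by rewrite (negPf IJ) andbF.
  by rewrite inE subsetIl andbT; apply: d0 IK; apply: subsetIr.
have JI' t : t \subset J -> t \proper I -> t = set0.
  move=> tJ /proper_sub tI; apply/eqP; rewrite -subset0.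
  by rewrite -(disjoint_setI0 JI) subsetI tJ.
rewrite andbT; have [J0|J0] := eqVneq J set0.
  rewrite andbF addn0; have -> : restr K0 J = [set set0].
    apply/setP => t; rewrite !inE J0 subset0; case: eqP => [->|_].
      by rewrite (inv_empty inv0).
    by rewrite andbF.
  rewrite coh_single // cards0 (gtn_eqF q0).
  have -> : restr K (w |: J) = [set t : {set U} | t \subset [set w]].
    apply/setP => t; rewrite mem inE J0.
    case: ifP => wt; first rewrite !subset0 -subset0 subDset setU0 andb_idl //.
      by rewrite -{1}[[set w]]setU0 -subDset subset0 => /eqP->; rewrite proper0.
    rewrite subset0; apply/and3P/idP => [[_ _ /eqP->]|tw]; first exact: sub0set.
    have /eqP-> : t == set0.
      by rewrite -subset0 -(setDv [set w]) subsetD1 tw wt.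
    by rewrite eq_sym I0 (inv_empty inv0).
  apply: (@coh_toggle _ _ s _ w) => // [|t].
    by apply: down_interval_closed => t u tu; rewrite !inE; apply: subset_trans.
  rewrite !inE => tw; rewrite subUset subxx tw; split=> //.
  exact: subset_trans (subD1set _ _) tw.
rewrite andbT; have /set0Pn[v vJ] := J0.
have wmax t : t \in restr K (w |: J) -> [set w] \subset t -> t = [set w].
  rewrite mem sub1set => + wt; rewrite wt => /andP[tI tJ].
  by rewrite -(setD1K wt) (JI' _ tJ tI) setU0.
have wD : [set w] \in restr K (w |: J).
  by rewrite mem inE eqxx setDv sub0set proper0 I0.
have [rho rho1 rhoE] := coh_remove_max hs (@restr_interval _ _ K_down) wD wmax.
move: rhoE; have -> : restr K (w |: J) :\ [set w] = restr K0 J.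
  apply/setP => t; rewrite in_setD1 mem in_set; case: ifP => wt.
    case: (boolP (t \in K0)) => [/wK0|_]; first by rewrite wt.
    apply/negbTE/negP => /and3P[tw tI tJ]; case/eqP: tw.
    by rewrite -(setD1K wt) (JI' _ tJ tI) setU0.
  have -> : t != [set w] by apply: contraFneq wt => ->; rewrite inE.
  case: (boolP (t \subset J)) => tJ; last by rewrite !andbF.
  suff -> : t != I by [].
  apply: contraNneq I0 => tI; rewrite -subset0.
  by rewrite -(disjoint_setI0 JI) subsetI -tI tJ subxx.
rewrite cards1 => rhoE; have := rhoE q; have := rhoE 0.
rewrite (coh0_nonempty (K := restr K0 J) (v := v) hs dJ).
  have -> : (q.+1 == 1) = false by lia.
  by case: (q == 1) => /=; lia.
by rewrite inE (inv_vertex inv0) ?sub1set ?(subsetP JV).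
Qed.

(** Only [inv_minus] takes work. If the removed facet [I'] does not contain w,
    the subdivision is that of the old complex without [I']. Otherwise [I'] is
    [w |: (I :\ v)] for some v in I; the other faces containing w are paired by
    v, and the old complex without I remains. *)
Lemma sphere_inv_step : sphere_inv c.+1 V K.
Proof.
have d0 := inv_down inv0.
have KV : {in K, forall t : {set U}, t \subset V}.
  move=> t; rewrite !inE => /orP[/andP[_ /(inv_sub inv0) tV]|/andP[wt tI]].
    by rewrite (subset_trans tV) ?subsetUr.
  rewrite /V -subDset (subset_trans (proper_sub tI)) //; exact: inv_sub inv0 _ IK.
split=> //.
- by rewrite cardsU1 wV (inv_card inv0); lia.
- move=> v; rewrite !inE => /orP[/eqP->|vV0].
    by rewrite eqxx setDv /= proper0 I0 orbT.
  rewrite (inv_vertex inv0) // andbT; apply/orP; left.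
  by apply/eqP => e; move: Id; rewrite -e cards1; lia.
- by rewrite !inE eq_sym I0 (inv_empty inv0).
- move=> t; rewrite !inE => /orP[/andP[_ /(inv_dim inv0)]//|/andP[wt tI]].
  by rewrite (cardsD1 w) wt -Id; have := proper_card tI; lia.
- move=> s J hs /properP[JV [x xV xJ]].
  have [wJ|wJ] := boolP (w \in J); last first.
    rewrite coh_step_old ?eqxx //; move: JV; rewrite /V -subDset => /(subset_trans _)->//.
    by rewrite subsetD1 subxx.
  have JE : J = w |: (J :\ w) by rewrite setD1K.
  have J0 : J :\ w \proper V0.
    apply/properP; split; first by rewrite subDset.
    exists x; last by rewrite !inE (negPf xJ) andbF.
    by move: xV; rewrite !inE => /orP[/eqP xw|//]; rewrite xw wJ in xJ.
  rewrite JE coh_step_new ?(proper_sub J0) //; last by lia.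
  rewrite (inv_proper inv0) // add0n; have -> // : (d == 1) = false by lia.
- move=> s hs; rewrite -(restr_full KV) /V coh_step_new //; last by lia.
  rewrite (restr_full (inv_sub inv0)) (inv_full inv0) //.
  by have -> : (d == 1) = false by lia.
- move=> s I' hs I'K I'd.
  have I'max t : t \in K0 -> I' \subset t -> t = I'.
    move=> tK It; apply/eqP; rewrite eq_sym eqEcard It I'd.
    exact: inv_dim inv0 _ tK.
  have [wI'|wI'] := boolP (w \in I'); last first.
    move: I'K; rewrite !inE (negPf wI') orbF => /andP[I'I I'K].
    have dL : down_closed (K0 :\ I').
      move=> t u tu; rewrite !inE => /andP[uI uK]; rewrite (d0 _ _ tu uK) andbT.
      by apply: contraNneq uI => tI; apply/eqP/I'max; rewrite -?tI.
    have wL : {in K0 :\ I', forall t : {set U}, w \notin t}.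
      by move=> t; rewrite inE => /andP[_ /wK0].
    rewrite -[RHS](inv_minus inv0 hs I'K I'd).
    rewrite -[RHS](coh_cone_swap hs d dL wL I0) //.
    + congr (coh s _ d); apply/setP => t; rewrite !inE.
      case: (eqVneq t I') => [->|//] /=; rewrite ?(negPf wI') ?andbF //.
    + by rewrite !inE eq_sym I'I.
    + by move=> t; rewrite inE => /andP[_ /Imax].
  have I'I : I' :\ w \proper I.
    move: I'K; rewrite !inE wI' => /orP[/andP[_ /wK0]|//]; by rewrite wI'.
  have /properP[_ [v vI vI']] := I'I.
  have I'E : I' :\ w = I :\ v.
    apply/eqP; rewrite eqEcard subsetD1 (proper_sub I'I) vI'.
    have := cardsD1 w I'; have := cardsD1 v I; rewrite wI' vI Id I'd; lia.
  have vw : v != w by apply: contraNneq wI => <-.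
  have vnI' : v \notin I' by move: vI'; rewrite !inE vw.
  rewrite -[RHS](inv_minus inv0 hs IK Id).
  have iD : interval_closed (K :\ I').
    apply: down_interval_closed => t u tu; rewrite in_setD1 => /andP[uI' uK].
    rewrite in_setD1 (K_down tu uK) andbT; apply: contraNneq uI' => tI.
    move: uK; rewrite !inE (subsetP tu) ?tI // => /orP[/andP[_ /wK0]|uI].
      by rewrite (subsetP tu) ?tI.
    rewrite eq_sym eqEsubset -{1}tI tu /= -(setD1K wI') I'E.
    have wu : w \in u by rewrite (subsetP tu) ?tI.
    rewrite -(setD1K wu) setUS // subsetD1 (proper_sub uI) /=.
    have uE : I :\ v \subset u :\ w by rewrite -I'E -tI subD1.
    exact: proper_missing vI uE uI.
  rewrite (coh_remove_toggled (v := v) (B := open_cone w I :\ I')) //.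
  + congr (coh s _ d); apply/setP => t; rewrite !inE.
    case: (eqVneq t I') => [->|_] /=.
      case: (boolP (I' \in K0)) => [/wK0|_]; rewrite ?andbF //; first by rewrite wI'.
    case: (boolP (t \in K0)) => [/wK0/negPf->|_]; first by rewrite /= !orbF andbT.
    by rewrite andbF /= andNb.
  + by rewrite setSD ?subsetUr.
  + move=> t u; rewrite !inE => /andP[_ /andP[wt tI]] /andP[-> uK] tu /=.
    by have wu := subsetP tu w wt; case/orP: uK => // /andP[_ /wK0]; rewrite wu.
  + move=> t; rewrite !inE => /andP[tI' /andP[wt tI]].
    have tvI : t :\ w :\ v \proper I :\ v.
      rewrite properE; apply/andP; split; first by rewrite setSD ?proper_sub.
      apply: contra tI' => le.
      rewrite -(setD1K wt) -(setD1K wI'); apply/eqP; congr (_ |: _).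
      rewrite I'E; apply/eqP; rewrite eqEsubset (subset_trans le) ?subD1set // andbT.
      rewrite subsetD1 (proper_sub tI) (proper_missing vI _ tI) //.
      by rewrite (subset_trans le) ?subD1set.
    have e1 : (v |: t) :\ w :\ v = t :\ w :\ v.
      by apply/setP => x; rewrite !inE; case: eqP.
    have e2 : t :\ v :\ w = t :\ w :\ v.
      by apply/setP => x; rewrite !inE andbCA.
    rewrite wt orbT [w == v]eq_sym vw /=; split; apply/andP; split.
    * by apply: contraNneq vnI' => <-; rewrite !inE eqxx.
    * have vt : v \in (v |: t) :\ w by rewrite !inE eqxx vw.
      rewrite -(setD1K vt) e1 -(setD1K vI); case/properP: tvI => le [x xI xt].
      apply/properP; split; first by rewrite setUS.
      exists x; first by rewrite !inE in xI *; case: eqP xI.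
      by rewrite !inE in xI xt *; case: eqP xI xt.
    * apply/eqP => e; move: tvI; rewrite -e2 e I'E properE.
      by rewrite subxx.
    * by rewrite e2; apply: proper_sub_trans tvI (subD1set I v).
Qed.

End Step.
End Truncation.

(** * Joins of boundaries of simplices *)

Section Base.
Variables (U : finType) (r : nat) (n : 'I_r -> nat) (F : fieldType).
Hypothesis n_gt0 : forall i, 0 < n i.
Implicit Types (t u J V : {set U}) (K : {set {set U}}) (q : nat) (w : U).
Let d := \sum_i n i.

Variables (b : 'I_r -> {set U}).
Hypothesis card_b : forall i, #|b i| = (n i).+1.
Hypothesis dis_b : forall i j, i != j -> [disjoint b i & b j].
Let V := \bigcup_i b i.
Let K := [set t : {set U} | (t \subset V) && [forall i, ~~ (b i \subset t)]].
Implicit Types (s : U -> {set U} -> F) (S T : {set 'I_r}) (x : 'I_r -> U).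

Let b_uniq i j v : v \in b i -> v \in b j -> i = j.
Proof.
move=> vi vj; apply/eqP; apply: contraTT vj => /dis_b/disjointFr dis.
by rewrite dis.
Qed.

Let memK t : (t \in K) = (t \subset V) && [forall i, ~~ (b i \subset t)].
Proof. by rewrite inE. Qed.

Let bV i : b i \subset V. Proof. exact: bigcup_sup. Qed.

Let K_down : down_closed K.
Proof.
move=> t u tu; rewrite !memK => /andP[uV /forallP ub].
rewrite (subset_trans tu uV); apply/forallP => i.
by apply: contra (ub i) => /subset_trans; apply.
Qed.

Let KN t i : t \in K -> ~~ (b i \subset t).
Proof. by rewrite memK => /andP[_ /forallP]. Qed.

Let sub_block t i v : t \in K -> v \in b i -> b i :\ v \subset t -> t :&: b i = b i :\ v.
Proof.
move=> tK vb le; apply/eqP; rewrite eqEsubset subsetD1 subsetIr subsetI le subD1set.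
rewrite !inE vb !andbT /=; apply: contra (KN i tK) => vt.
by rewrite -(setD1K vb) subUset sub1set vt.
Qed.

(** For [T = setT] these are the facets of the join: one vertex [x i] is left
    out of each block. *)
Definition punctured x T : {set U} := \bigcup_(i in T) (b i :\ x i).

(** When J is the union of the blocks in S, these are the faces other than
    [punctured x S] (see [unmatched_full]); the induction on S needs the
    general form. *)
Definition unmatched J x S :=
  [set t in restr K J | [exists i in S, t :&: b i != b i :\ x i]].

Let unmP J x S t : reflect
    [/\ t \in K, t \subset J & exists2 i, i \in S & t :&: b i <> b i :\ x i]
  (t \in unmatched J x S).
Proof.
rewrite [t \in unmatched _ _ _]in_set [t \in restr _ _]in_set.
apply: (iffP andP) => [[/andP[tK tJ] /exists_inP[i iS /eqP ne]]|].
  by split=> //; exists i.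
move=> [tK tJ [i iS /eqP ne]]; split; first by rewrite tK.
by apply/exists_inP; exists i.
Qed.

Let matched_up x i t u : x i \in b i -> t \subset u -> u \in K ->
  t :&: b i = b i :\ x i -> u :&: b i = b i :\ x i.
Proof.
move=> xb tu uK e; apply: sub_block => //; rewrite -e.
by apply: subset_trans tu; apply: subsetIl.
Qed.

Let unm_down J x S : (forall i, x i \in b i) -> down_closed (unmatched J x S).
Proof.
move=> xb t u tu /unmP[uK uJ [i iS ne]]; apply/unmP; split.
- exact: K_down tu uK.
- exact: subset_trans uJ.
- by exists i => // e; apply: ne; apply: matched_up e.
Qed.

Let toggle_other (i j : 'I_r) v t : v \in b i -> i != j ->
  (v |: t) :&: b j = t :&: b j /\ (t :\ v) :&: b j = t :&: b j.
Proof.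
move=> vb ij; have vj : v \in b j = false by apply: disjointFr (dis_b ij) vb.
by split; apply/setP => y; rewrite !inE; case: eqP => // ->; rewrite vj !andbF.
Qed.

(** For i in S, the faces that match x on [S :\ i] but not at i are paired by
    [x i]: adding [x i] would fill the block i only in a face that matches x at
    i. Collapsing them reduces S to [S :\ i]. *)
Lemma coh_unmatched s J x S q : sign_system s ->
  (forall i, x i \in b i) -> {in S, forall i, b i \subset J} ->
  coh s (unmatched J x S) q = 0.
Proof.
move=> hs xb; have [m] := ubnP #|S|; elim: m S => // m IH S.
rewrite ltnS => Sm SJ; have [S0|[i iS]] := set_0Vmem S.
  have -> : unmatched J x S = set0.
    by apply/setP => t; rewrite [RHS]inE; apply/unmP => -[_ _ []]; rewrite S0 => i; rewrite inE.
  rewrite /coh (_ : #|_| = 0) ?sub0n //; apply/eqP; rewrite cards_eq0.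
  by apply/eqP/setP => t; rewrite !inE.
pose B := unmatched J x S :\: unmatched J x (S :\ i).
have BP t : reflect [/\ t \in K, t \subset J, t :&: b i <> b i :\ x i &
    forall j, j \in S -> j != i -> t :&: b j = b j :\ x j] (t \in B).
  rewrite in_setD; apply: (iffP andP) => [[/negP tN /unmP[tK tJ [j jS ne]]]|].
    have all j' : j' \in S -> j' != i -> t :&: b j' = b j' :\ x j'.
      move=> j'S j'i; apply/eqP/negPn/negP => /eqP ne'; apply: tN; apply/unmP.
      by split=> //; exists j' => //; rewrite !inE j'i.
    split=> //; case: (eqVneq j i) ne => [->//|ji] []; exact: all.
  move=> [tK tJ ne all]; split; last by apply/unmP; split=> //; exists i.
  by apply/negP => /unmP[_ _ [j /setD1P[ji jS] []]]; apply: all.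
rewrite (coh_remove_toggled (B := B) (v := x i)) //.
- have -> : unmatched J x S :\: B = unmatched J x (S :\ i).
    rewrite setDDr setDv set0U; apply/setIidPr/subsetP => t.
    case/unmP=> tK tJ [j /setD1P[_ jS] ne].
    by apply/unmP; split=> //; exists j.
  apply: IH; first by have := cardsD1 i S; rewrite iS; lia.
  by move=> j; rewrite !inE => /andP[_ /SJ].
- exact/down_interval_closed/unm_down.
- exact: subsetDl.
- move=> t u /BP[tK tJ ne all] /unmP[uK uJ [j jS ne']] tu.
  have allu j' : j' \in S -> j' != i -> u :&: b j' = b j' :\ x j'.
    by move=> j'S j'i; apply: matched_up tu uK _ => //; apply: all.
  apply/BP; split=> //; case: (eqVneq j i) ne' => [->//|ji] []; exact: allu.
move=> t /BP[tK tJ ne all].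
have oth j := toggle_other t (xb i) (j := j).
have neD : (t :\ x i) :&: b i <> b i :\ x i.
  move=> e; apply: ne; apply: matched_up (e) => //; exact: subD1set.
have tiK : x i |: t \in K.
  move: (tK); rewrite !memK => /andP[tV /forallP tb]; apply/andP; split.
    by rewrite subUset sub1set tV (subsetP (bV i)).
  apply/forallP => j; have [->|ij] := eqVneq j i; last first.
    apply: contra (tb j) => /setIidPr; rewrite (oth j _).1 1?eq_sym // => <-.
    exact: subsetIl.
  apply/negP => le; apply: ne; apply: sub_block => //.
  by rewrite subDset.
split; apply/BP; split=> //.
- by rewrite subUset sub1set tJ (subsetP (SJ i iS)).
- by move=> /setP/(_ (x i)); rewrite !inE eqxx xb.
- by move=> j jS ji; rewrite (oth j _).1 1?eq_sym ?all.
- by apply: K_down tK; apply: subD1set.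
- by apply: subset_trans tJ; apply: subD1set.
- by move=> j jS ji; rewrite (oth j _).2 1?eq_sym ?all.
Qed.

Definition block_union T : {set U} := \bigcup_(i in T) b i.

Lemma block_sub i T : (b i \subset block_union T) = (i \in T).
Proof.
apply/idP/idP => [le|iT]; last exact: bigcup_sup.
have /card_gt0P[v vb] : 0 < #|b i| by rewrite card_b.
have /bigcupP[j jT vj] := subsetP le v vb.
by rewrite (b_uniq vb vj).
Qed.

Lemma block_union_inj : injective block_union.
Proof. by move=> S T e; apply/setP => i; rewrite -!block_sub e. Qed.

Lemma card_block_union (c : 'I_r -> {set U}) T :
  (forall i, c i \subset b i) -> #|\bigcup_(i in T) c i| = \sum_(i in T) #|c i|.
Proof.
move=> cb; have [m] := ubnP #|T|; elim: m T => // m IH T.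
rewrite ltnS => Tm; have [->|[i iT]] := set_0Vmem T.
  by rewrite !big_set0 cards0.
rewrite (big_setD1 i) //= [in RHS](big_setD1 i) //= -IH; last first.
  by have := cardsD1 i T; rewrite iT; lia.
rewrite cardsU; suff -> : c i :&: \bigcup_(j in T :\ i) c j = set0.
  by rewrite cards0 subn0.
apply/setP => v; rewrite !inE; apply/andP => -[vi /bigcupP[j]].
rewrite !inE => /andP[ji _] vj; case/negP: ji; apply/eqP.
exact: b_uniq (subsetP (cb _) _ vj) (subsetP (cb _) _ vi).
Qed.

Let choice_b : exists x : 'I_r -> U, forall i, x i \in b i.
Proof.
have h i : exists v, v \in b i by apply/card_gt0P; rewrite card_b.
by exists (fun i => xchoose (h i)) => i; apply: xchooseP.
Qed.

Let punct_block x T i : (forall i, x i \in b i) -> i \in T ->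
  punctured x T :&: b i = b i :\ x i.
Proof.
move=> xb iT; apply/eqP; rewrite eqEsubset subsetI subD1set andbT.
apply/andP; split; last by apply: (bigcup_sup i).
apply/subsetP => v; rewrite inE => /andP[/bigcupP[j jT vj] vi].
have vj' : v \in b j by move: vj; rewrite inE => /andP[].
by rewrite -(b_uniq vj' vi).
Qed.

Let punct_sub x T : punctured x T \subset block_union T.
Proof.
apply/bigcupsP => i iT; apply: subset_trans (subD1set _ _) _.
exact: (bigcup_sup i).
Qed.

Let punctK x T : (forall i, x i \in b i) -> punctured x T \in K.
Proof.
move=> xb; rewrite memK; apply/andP; split.
  apply: subset_trans (punct_sub _ _) _; apply/bigcupsP => i _; exact: bV.
apply/forallP => i; apply/negP => le.
have /bigcupP[j jT] := subsetP le _ (xb i).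
rewrite !inE => /andP[ne vj]; case/eqP: ne.
by rewrite (b_uniq vj (xb i)).
Qed.

Let card_punct x T : (forall i, x i \in b i) -> #|punctured x T| = \sum_(i in T) n i.
Proof.
move=> xb; rewrite card_block_union => [|i]; last exact: subD1set.
by apply: eq_bigr => i _; have := cardsD1 (x i) (b i); rewrite card_b xb; lia.
Qed.

Let unmatched_full x T :
  (forall i, x i \in b i) ->
  unmatched (block_union T) x T = restr K (block_union T) :\ punctured x T.
Proof.
move=> xb; apply/setP => t; rewrite in_setD1 [t \in restr _ _]inE.
apply/unmP/and3P => [[tK tJ [i iT ne]]|[tI tK tJ]].
  split=> //; apply/eqP => e; apply: ne; rewrite e; exact: punct_block.
split=> //; case: (boolP [exists i in T, t :&: b i != b i :\ x i]).
  by case/exists_inP=> i iT /eqP ne; exists i.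
rewrite negb_exists_in => /forall_inP all; case/eqP: tI; apply/setP => v.
have all' i : i \in T -> t :&: b i = b i :\ x i.
  by move=> /all/negPn/eqP.
apply/idP/idP => [vt|/bigcupP[i iT]]; last first.
  by rewrite -all' // inE => /andP[].
have /bigcupP[i iT vi] := subsetP tJ v vt.
by apply/bigcupP; exists i => //; rewrite -all' // inE vt.
Qed.

Lemma coh_remove_punctured s x T q : sign_system s -> (forall i, x i \in b i) ->
  coh s (restr K (block_union T) :\ punctured x T) q = 0.
Proof.
by move=> hs xb; rewrite -unmatched_full // coh_unmatched // => i; rewrite block_sub.
Qed.

(** The join over T is a sphere: it is acyclic without its facet [punctured x
    T]. *)
Lemma coh_block_union s T q : sign_system s ->
  coh s (restr K (block_union T)) q = (q == \sum_(i in T) n i).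
Proof.
move=> hs; have [x xb] := choice_b.
have pI : punctured x T \in restr K (block_union T) by rewrite inE punctK ?punct_sub.
have pmax t : t \in restr K (block_union T) -> punctured x T \subset t ->
    t = punctured x T.
  rewrite inE => /andP[tK tJ] le; apply/eqP; rewrite eqEsubset le andbT.
  apply/subsetP => v vt; have /bigcupP[i iT vi] := subsetP tJ v vt.
  have e : t :&: b i = b i :\ x i.
    apply: sub_block => //; rewrite -(punct_block xb iT).
    exact: subset_trans (subsetIl _ _) le.
  have : v \in t :&: b i by rewrite inE vt.
  by rewrite e -(punct_block xb iT) => /setIP[].
(* For T empty the join is the empty face alone. Otherwise the count one level
   below the facet excludes [rho = 1]. *)
have [T0|[i iT]] := set_0Vmem T.
  rewrite T0 big_set0; have -> : restr K (block_union set0) = [set set0].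
    apply/setP => t; rewrite [t \in restr _ _]in_set in_set1 /block_union big_set0.
    rewrite subset0 andbC; case: eqP => [->|//]; rewrite memK sub0set.
    by apply/forallP => i; rewrite subset0 -cards_eq0 card_b.
  by rewrite coh_single // cards0.
have [rho rho1] := coh_remove_max hs
  (down_interval_closed (restr_down_closed (J := block_union T) K_down)) pI pmax.
rewrite card_punct // => rhoE.
have Tpos : 0 < \sum_(i in T) n i by rewrite (bigD1 i) //=; have := n_gt0 i; lia.
have := rhoE q; have := rhoE (\sum_(i in T) n i).-1; rewrite !coh_remove_punctured //.
rewrite prednK // eqxx => e1 e2.
have rho0 : rho = 0 by move: e1; case: (_ == _) => /=; lia.
by move: e2; rewrite rho0 !muln0 !addn0 add0n.
Qed.

(** If J contains v but not the whole block of v, then no face of the full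
    subcomplex can fill that block, and this subcomplex is a cone with apex
    v. *)
Lemma coh_not_union s J q : sign_system s -> J \subset V ->
  (forall T, J != block_union T) -> coh s (restr K J) q = 0.
Proof.
move=> hs JV noT; pose T := [set i | b i \subset J].
have : ~~ (J \subset block_union T).
  apply: contra (noT T) => le; rewrite eqEsubset le; apply/bigcupsP => i.
  by rewrite inE.
case/subsetPn=> v vJ vT; have /bigcupP[i _ vi] := subsetP JV v vJ.
have : ~~ (b i \subset J).
  by apply: contra vT => biJ; apply/bigcupP; exists i; rewrite ?inE.
case/subsetPn=> u ui uJ.
apply: (@coh_toggle _ _ s _ v) => //.
  exact/down_interval_closed/restr_down_closed.
move=> t; rewrite !in_set => /andP[tK' tJ].
have tK : t \in K by rewrite inE.
split; last first.
  rewrite -[X in X && _]memK (K_down (subD1set t v) tK).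
  exact: subset_trans (subD1set _ _) tJ.
rewrite -[X in X && _]memK subUset sub1set vJ tJ /= andbT memK.
rewrite subUset sub1set (subsetP JV) //=; case/andP: tK' => -> /forallP tb /=.
apply/forallP => j; have [->|ij] := eqVneq j i.
  apply: contra uJ => /subsetP/(_ u ui); rewrite !inE => /orP[/eqP->//|].
  exact: subsetP.
apply: contra (tb j) => /setIidPr; rewrite (toggle_other t vi _).1 1?eq_sym // => <-.
exact: subsetIl.
Qed.

Lemma coh_block_join s J q : sign_system s -> J \subset V ->
  coh s (restr K J) q =
  \sum_(T : {set 'I_r} | \sum_(i in T) n i == q) (J == block_union T).
Proof.
move=> hs JV; case: (pickP (fun T => J == block_union T)) => [T /eqP->|no].
  rewrite coh_block_union //; case: eqP => [->|ne].
    rewrite (bigD1 T) //= eqxx big1 // => S /andP[_ ST].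
    by rewrite eq_sym (inj_eq block_union_inj) (negPf ST).
  rewrite big1 // => S /eqP e; case: eqP => // /block_union_inj e'.
  by case: ne; rewrite e' e.
rewrite coh_not_union ?big1 // => [T _|T]; by rewrite no.
Qed.

Lemma block_union_full : block_union setT = V.
Proof. by rewrite /block_union /V; apply: eq_bigl => i; rewrite inE. Qed.

Lemma sphere_inv_base : sphere_inv n F r V K.
Proof.
have KV : {in K, forall t : {set U}, t \subset V}.
  by move=> t; rewrite memK => /andP[].
have sumT : \sum_(i in [set: 'I_r]) n i = d by apply: eq_bigl => i; rewrite inE.
have dimK : {in K, forall t : {set U}, #|t| <= d}.
  move=> t tK; have -> : t = \bigcup_(i in [set: 'I_r]) (t :&: b i).
    rewrite -big_distrr /= (eq_bigl predT) => [|i]; last by rewrite inE.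
    by apply/esym/setIidPl/KV.
  rewrite card_block_union => [|i]; last exact: subsetIr.
  rewrite -sumT; apply: leq_sum => i _; rewrite -ltnS -card_b.
  apply: proper_card; rewrite properE subsetIr subsetI subxx andbT.
  exact: KN.
split=> //.
- rewrite -block_union_full card_block_union // (eq_bigr (fun i => n i + 1)).
    by rewrite big_split /= sumT sum1_card cardsT card_ord.
  by move=> i _; rewrite card_b addn1.
- move=> v vV; rewrite memK sub1set vV /=; apply/forallP => i.
  apply/negP => /subset_leq_card; rewrite card_b cards1.
  by have := n_gt0 i; lia.
- by rewrite memK sub0set; apply/forallP => i; rewrite subset0 -cards_eq0 card_b.
- move=> s J hs JV; rewrite coh_block_join ?proper_sub //.
  apply: big1 => T /eqP Td; case: eqP => // JT.
  suff TT : T = setT by rewrite JT TT block_union_full properxx in JV.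
  apply/setP => i; rewrite inE; apply: contraTT isT => iT.
  suff : \sum_(j in T) n j < d by rewrite Td ltnn.
  rewrite /d [X in _ < X](bigID (mem T)) /= -[X in X < _]addn0 ltn_add2l.
  by rewrite (bigD1 i) //=; have := n_gt0 i; lia.
- by move=> s hs; rewrite -(restr_full KV) -block_union_full coh_block_union // sumT eqxx.
move=> s I hs IK Id.
(* The facet I is punctured: it omits a vertex of each block, and has too many
   elements to omit more. *)
have h i : exists v, (v \in b i) && (v \notin I).
  by have /subsetPn[v vb vI] := KN i IK; exists v; rewrite vb.
pose x i := xchoose (h i).
have xb i : x i \in b i by have /andP[] := xchooseP (h i).
have xI i : x i \notin I by have /andP[] := xchooseP (h i).
have -> : I = punctured x setT.
  apply/eqP; rewrite eqEcard card_punct // sumT Id leqnn andbT.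
  apply/subsetP => v vI; have /bigcupP[i _ vi] := subsetP (KV _ IK) v vI.
  apply/bigcupP; exists i; rewrite ?inE // vi andbT.
  by apply: contraNneq (xI i) => <-.
by rewrite -(restr_full KV) -block_union_full coh_remove_punctured.
Qed.

End Base.

(** * Total cohomology of the full subcomplexes *)

Section Counting.
Variable U : finType.
Implicit Types (I J V : {set U}).

Lemma sum_subsets_add V w j (f : {set U} -> nat) : w \notin V ->
  \sum_(J : {set U} | (J \subset w |: V) && (#|J| == j)) f J =
  \sum_(J : {set U} | (J \subset V) && (#|J| == j)) f J +
  \sum_(J : {set U} | (J \subset V) && (#|J|.+1 == j)) f (w |: J).
Proof.
move=> wV; rewrite (bigID (fun J : {set U} => w \in J)) /= addnC; congr (_ + _).
  apply: eq_bigl => J; rewrite andbAC; congr (_ && _).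
  have [wJ|wJ] /= := boolP (w \in J).
    by rewrite andbF; apply/esym/negbTE; apply: contra wV => /subsetP; apply.
  rewrite andbT -subDset; apply/idP/idP => [|JV]; first last.
    exact: subset_trans (subsetDl _ _) JV.
  by apply: subset_trans; rewrite subsetD1 subxx.
rewrite (reindex_onto (fun J : {set U} => w |: J) (fun J : {set U} => J :\ w)).
  apply: eq_bigl => J; have [wJ|wJ] := boolP (w \in J).
    have -> : ((w |: J) :\ w == J) = false.
      by apply/eqP => e; move: wJ; rewrite -e !inE eqxx.
    by rewrite andbF; apply/esym/negbTE/negP => /andP[/subsetP/(_ w wJ)]; rewrite (negPf wV).
  rewrite setU1K // eqxx setU11 !andbT cardsU1 wJ; congr (_ && _).
  by rewrite -subDset setU1K.
by move=> J /andP[_ wJ]; rewrite setD1K.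
Qed.

Lemma card_disjoint_subsets V I i : I \subset V ->
  \sum_(J : {set U} | (J \subset V) && (#|J| == i))
     [&& J != set0 & [disjoint J & I]] =
  if i is _.+1 then 'C(#|V| - #|I|, i) else 0.
Proof.
move=> IV; case: i => [|i].
  by apply: big1 => J /andP[_ /eqP/cards0_eq->]; rewrite eqxx.
have -> : #|V| - #|I| = #|V :\: I| by rewrite cardsD (setIidPr IV).
rewrite -cards_draws -sum1dep_card big_mkcond [RHS]big_mkcond /=.
apply: eq_bigr => J _; rewrite subsetD; have [->/=|_] := eqVneq J set0.
  by rewrite cards0 !andbF.
by case: (J \subset V); case: (#|J| == i.+1) => //=; case: [disjoint _ & _].
Qed.

(** The sets J are counted by [J :\: I], which has one element less than i; the
    bound on [i'] accounts for [J != V]. *)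
Lemma card_proper_supersets V I i : I \subset V ->
  \sum_(J : {set U} | (J \subset V) && (#|J|.+1 == i + #|I|))
     ((I \subset J) && (J != V)) =
  if i is i'.+1 then if i' < #|V| - #|I| then 'C(#|V| - #|I|, i') else 0 else 0.
Proof.
move=> IV; have IVc : #|V :\: I| = #|V| - #|I| by rewrite cardsD (setIidPr IV).
case: i => [|i].
  apply: big1 => J /andP[_ /eqP Ji]; have [IJ|//] := boolP (I \subset J).
  by have := subset_leq_card IJ; rewrite add0n in Ji; lia.
rewrite (eq_bigl (fun J : {set U} => (J \subset V) && (#|J| == i + #|I|))); last first.
  by move=> J; rewrite addSn eqSS.
case: ltnP => iV; last first.
  apply: big1 => J /andP[JV /eqP Ji]; have [->|JneV] := eqVneq J V.
    by rewrite andbF.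
  have := proper_card (A := J) (B := V); rewrite properEneq JneV JV => /(_ isT).
  by have := subset_leq_card IV; lia.
rewrite -IVc -cards_draws -sum1dep_card.
rewrite [LHS]big_mkcond (bigID (fun J : {set U} => I \subset J)) /=.
rewrite [X in _ + X]big1 ?addn0; last by move=> J /negPf->; rewrite if_same.
rewrite (reindex_onto (fun J => J :|: I) (fun J => J :\: I)); last first.
  by move=> J IJ; rewrite setUC -{1}(setIidPr IJ) setID.
rewrite big_mkcond [RHS]big_mkcond; apply: eq_bigr => J _.
have -> : ((J :|: I) :\: I == J) = [disjoint J & I].
  by rewrite setDUl setDv setU0; apply: (sameP eqP setDidPl).
rewrite subsetUr /= subUset IV andbT subsetD.
case: (boolP [disjoint J & I]) => dis; last by rewrite !andbF.
rewrite !andbT cardsU disjoint_setI0 // cards0 subn0 eqn_add2r.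
case: (J \subset V) => //=; case: eqP => //= Ji.
suff -> : J :|: I != V by [].
apply: contraTneq iV => <-; rewrite cardsU disjoint_setI0 // cards0 Ji; lia.
Qed.

End Counting.

Section Totals.
Variables (U : finType) (r : nat) (n : 'I_r -> nat) (F : fieldType).
Hypothesis n_gt0 : forall i, 0 < n i.
Implicit Types (I J V : {set U}) (K : {set {set U}}) (T : {set 'I_r}).
Implicit Types (s : {set U} -> U -> {set U} -> F).
Let d := \sum_i n i.

(** The right-hand side of Hochster's formula. *)
Definition total_coh s V K q j :=
  \sum_(J : {set U} | (J \subset V) && (#|J| == j)) coh (s J) (restr K J) q.

(** The spheres on the blocks of T persist when any of the k new vertices are
    added to J, which leaves a choice of [i - #|T|] vertices among k. *)
Definition block_term k i q :=
  \sum_(T : {set 'I_r} | \sum_(t in T) n t == q)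
    if #|T| <= i then 'C(k, i - #|T|) else 0.

(** The number of classes that the isolated vertices of [coh_step_new] create
    in k cuts; for each later cut, J may or may not contain its new vertex. *)
Fixpoint point_term k i :=
  if k is k'.+1 then point_term k' i +
    (if i is i'.+1 then point_term k' i' + 'C(k' + r, i) else 0)
  else 0.

(** The same count for the facets that are missing in [coh_step_old]. *)
Fixpoint hole_term k i :=
  if k is k'.+1 then hole_term k' i +
    (if i is i'.+1 then hole_term k' i' +
       (if i' < k' + r then 'C(k' + r, i') else 0) else 0)
  else 0.

Lemma truncation_inv k V K : k = 0 \/ 1 < d -> truncation n k V K ->
  sphere_inv n F (k + r) V K.
Proof.
move=> hd; elim: k hd V K => [|k IH] hd V K.
  by case=> b [cb db -> ->]; apply: sphere_inv_base.
have d2 : 1 < d by case: hd.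
case=> V0 [K0 [tr [I [w [IK Id wV -> ->]]]]].
exact: sphere_inv_step (IH (or_intror d2) _ _ tr) IK Id wV d2.
Qed.

Lemma coh_small (s1 : U -> {set U} -> F) K q :
  (forall t, t \in K -> #|t| != q) -> coh s1 K q = 0.
Proof.
move=> Kq; rewrite /coh (_ : #|_| = 0) ?sub0n //; apply/eqP; rewrite cards_eq0.
by apply/eqP/setP => t; rewrite !inE; apply/negbTE/negP => /andP[/Kq/negP].
Qed.

(** Pascal's rule, applied to each T. *)
Lemma block_termS k i q : 0 < q ->
  block_term k.+1 i q = block_term k i q + (if i is i'.+1 then block_term k i' q else 0).
Proof.
move=> q0; case: i => [|i].
  rewrite addn0; apply: eq_bigr => T /eqP Tq.
  have [T0|T0] := posnP #|T|; last by rewrite leqNgt T0.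
  by move: q0; rewrite -Tq (cards0_eq T0) big_set0.
rewrite -big_split; apply: eq_bigr => T _ /=.
have [Ti|iT] := leqP #|T| i; first by rewrite (leqW Ti) subSn // binS addnC.
rewrite addn0; have [Ti|//] := leqP #|T| i.+1.
have -> : i.+1 - #|T| = 0 by lia.
by rewrite !bin0.
Qed.

(** The sum over J splits according to whether J contains the vertex of the
    last cut. *)
Lemma total_formula k V K s q i : k = 0 \/ 1 < d -> truncation n k V K ->
  (forall J, sign_system (s J)) -> 0 < q < d ->
  total_coh s V K q (i + q) =
  block_term k i q + (q == 1) * point_term k i + (q.+1 == d) * hole_term k i.
Proof.
move=> hd tr hs /andP[q0 qd]; elim: k hd V K s i tr hs => [|k IH] hd V K s i tr hs.
  case: tr => b [cb db VE KE]; rewrite !muln0 !addn0 /total_coh.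
  rewrite (eq_bigr (fun J => \sum_(T : {set 'I_r} | \sum_(t in T) n t == q)
      (J == block_union b T : nat))); last first.
    by move=> J /andP[JV _]; rewrite KE VE (coh_block_join n_gt0 cb db) // -VE.
  rewrite exchange_big /=; apply: eq_bigr => T /eqP Tq.
  rewrite big_mkcond (bigD1 (block_union b T)) //= big1 ?addn0; last first.
    by move=> J /negPf->; rewrite if_same.
  have -> : block_union b T \subset V.
    by rewrite VE; apply/bigcupsP => t _; apply: bigcup_sup.
  have -> : #|block_union b T| = #|T| + q.
    rewrite (card_block_union n db) // (eq_bigr (fun t => 1 + n t)) => [|t _].
      by rewrite big_split /= sum1_card Tq.
    by rewrite cb.
  rewrite eqn_add2r eqxx bin0n; case: ltngtP => //= Ti; last by rewrite Ti subnn.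
  by rewrite (_ : _ == 0 = false) //; lia.
have d2 : 1 < d by case: hd.
case: tr => V0 [K0 [tr [I [w [IK Id wV VE KE]]]]].
have inv0 := truncation_inv (or_intror d2) tr.
have IV : I \subset V0 by apply: inv_sub inv0 _ IK.
have cV : #|V0| - #|I| = k + r by rewrite (inv_card inv0) Id -/d; lia.
rewrite /total_coh VE sum_subsets_add //.
rewrite (eq_bigr (fun J => coh (s J) (restr K0 J) q +
   (q.+1 == d) * ((I \subset J) && (J != V0)))); last first.
  move=> J /andP[JV _]; rewrite KE (coh_step_old inv0 IK Id wV d2) //.
  by rewrite (ltn_eqF qd) mulnb.
rewrite [X in _ + X = _](eq_bigr (fun J => coh (s (w |: J)) (restr K0 J) q +
   (q == 1) * [&& J != set0 & [disjoint J & I]])); last first.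
  move=> J /andP[JV _]; rewrite KE (coh_step_new inv0 IK Id wV d2) //.
  by rewrite mulnb.
rewrite !big_split /= -!big_distrr /=.
have eA : \sum_(J : {set U} | (J \subset V0) && (#|J| == i + q))
    coh (s J) (restr K0 J) q = _ := IH (or_intror d2) _ _ s i tr hs.
have eB : (q.+1 == d) * \sum_(J : {set U} | (J \subset V0) && (#|J| == i + q))
      ((I \subset J) && (J != V0)) =
    (q.+1 == d) * if i is i'.+1 then if i' < k + r then 'C(k + r, i') else 0 else 0.
  case: eqP => // qd1; rewrite !mul1n -cV -card_proper_supersets //.
  by apply: eq_bigl => J; rewrite Id -/d -qd1 addnS eqSS.
have eB' : (q == 1) * \sum_(J : {set U} | (J \subset V0) && (#|J|.+1 == i + q))
      [&& J != set0 & [disjoint J & I]] =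
    (q == 1) * if i is _.+1 then 'C(k + r, i) else 0.
  case: eqP => // ->; rewrite !mul1n -cV -card_disjoint_subsets //.
  by apply: eq_bigl => J; rewrite addn1 eqSS.
have eA' : \sum_(J : {set U} | (J \subset V0) && (#|J|.+1 == i + q))
    coh (s (w |: J)) (restr K0 J) q = if i is i'.+1 then
      block_term k i' q + (q == 1) * point_term k i' + (q.+1 == d) * hole_term k i'
    else 0.
  case: (i) => [|i']; last first.
    exact: (IH (or_intror d2) _ _ (fun J => s (w |: J)) i' tr).
  apply: big1 => J /andP[_ /eqP Jq]; apply: coh_small => t.
  rewrite inE => /andP[_ /subset_leq_card]; lia.
rewrite eA eB eA' eB' block_termS //=.
case: (i) => [|i']; rewrite ?muln0 ?addn0 //; lia.
Qed.

Lemma total0 k V K s j : k = 0 \/ 1 < d -> truncation n k V K ->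
  (forall J, sign_system (s J)) -> total_coh s V K 0 j = (j == 0).
Proof.
move=> hd tr hs; have inv := truncation_inv hd tr.
rewrite /total_coh (eq_bigr (fun J => (J == set0 : nat))) => [|J /andP[JV _]].
  rewrite big_mkcond (bigD1 set0) //= big1 ?addn0 => [|J /negPf->]; last first.
    by rewrite if_same.
  by rewrite sub0set cards0 eqxx eq_sym; case: (j == 0).
have [->|/set0Pn[v vJ]] := eqVneq J set0.
  have -> : restr K set0 = [set set0].
    apply/setP => t; rewrite !inE subset0 andbC; case: eqP => //= ->.
    exact: inv_empty inv.
  by rewrite coh_single // cards0.
apply: (coh0_nonempty (v := v) (hs J)) => //.
  exact: restr_down_closed (inv_down inv).
by rewrite inE sub1set vJ (inv_vertex inv) // (subsetP JV).
Qed.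

Lemma total_top k V K s j : k = 0 \/ 1 < d -> truncation n k V K ->
  (forall J, sign_system (s J)) -> total_coh s V K d j = (j == d + (k + r)).
Proof.
move=> hd tr hs; have inv := truncation_inv hd tr.
rewrite /total_coh (eq_bigr (fun J => (J == V : nat))) => [|J /andP[JV _]].
  rewrite big_mkcond (bigD1 V) //= big1 ?addn0 => [|J /negPf->]; last first.
    by rewrite if_same.
  by rewrite subxx eqxx /= (inv_card inv) eq_sym; case: (j == _).
have [->|JneV] := eqVneq J V.
  by rewrite (restr_full (inv_sub inv)) (inv_full inv).
by rewrite (inv_proper inv) // properEneq JneV.
Qed.

Lemma total_large k V K s q j : k = 0 \/ 1 < d -> truncation n k V K ->
  d < q -> total_coh s V K q j = 0.
Proof.
move=> hd tr dq; have inv := truncation_inv hd tr.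
apply: big1 => J _; apply: coh_small => t; rewrite inE => /andP[tK _].
by have := inv_dim inv tK; rewrite -/d; lia.
Qed.

End Totals.

Section ClosedForms.
Variable r : nat.
Hypothesis r_gt0 : 0 < r.

Lemma point_termE k i : point_term r k i + 'C(k, i.+1) = k * 'C(k + r - 1, i).
Proof.
elim: k i => [|k IH] i; first by rewrite bin0n mul0n.
case: i => [|i] /=.
  have := IH 0; rewrite addn0 !bin0 !bin1; lia.
have IH0 := IH i; have IH1 := IH i.+1.
have e : 'C(k + r, i.+1) = 'C(k + r - 1, i.+1) + 'C(k + r - 1, i).
  by rewrite -binS; congr 'C(_, _); lia.
have -> : k.+1 + r - 1 = k + r by lia.
rewrite binS mulSn [in k * _]e mulnDr -IH0 -IH1 e; lia.
Qed.

Lemma point_term_out k i : k + r <= i -> point_term r k i = 0.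
Proof.
move=> ki; have := point_termE k i; rewrite !(@bin_small _ _); lia.
Qed.

Lemma point_term0 k : point_term r k 0 = 0.
Proof. by elim: k => //= k ->. Qed.

Lemma hole_term0 k : hole_term r k 0 = 0.
Proof. by elim: k => //= k ->. Qed.

(** Alexander duality in the sphere exchanges the isolated points with the
    missing facets. *)
Lemma hole_termE k i :
  hole_term r k i = if i <= k + r then point_term r k (k + r - i) else 0.
Proof.
elim: k i => [|k IH] i; first by rewrite if_same.
case: i => [|i]; first by rewrite hole_term0 subn0 point_term_out.
rewrite [hole_term _ _ _]/= !IH.
have -> : k.+1 + r - i.+1 = k + r - i by lia.
rewrite addSn ltnS; case: ltngtP => ik.
- have e : k + r - i = (k + r - i.+1).+1 by lia.
  rewrite -[in LHS](bin_sub (ltnW ik)) e /=; lia.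
- by rewrite addn0.
- by rewrite ik subnn addn0 point_term0 point_term0.
Qed.

Lemma hole_term_out k i : k + r <= i -> hole_term r k i = 0.
Proof.
rewrite hole_termE => ki; case: ifP => // ik.
have -> : k + r - i = 0 by lia.
exact: point_term0.
Qed.

End ClosedForms.

Section Formulas.
Variables (r : nat) (n : 'I_r -> nat).
Hypothesis n_gt0 : forall i, 0 < n i.
Let d := \sum_i n i.

Lemma sum_compl (T : {set 'I_r}) : \sum_(t in T) n t + \sum_(t in ~: T) n t = d.
Proof.
rewrite /d [RHS](bigID (mem T)) /=; congr (_ + _).
by apply: eq_bigl => t; rewrite inE.
Qed.

Lemma sum_eq0 (T : {set 'I_r}) : \sum_(t in T) n t = 0 -> T = set0.
Proof.
have [//|[t tT]] := set_0Vmem T; rewrite (bigD1 t) //=; have := n_gt0 t; lia.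
Qed.

(** Alexander duality exchanges T with its complement. *)
Lemma block_term_dual k i q : i <= k + r -> q <= d ->
  block_term n k (k + r - i) (d - q) = block_term n k i q.
Proof.
move=> ik qd; rewrite /block_term (reindex_inj (@setC_inj 'I_r)) /=.
apply: eq_big => [T|T _].
  have := sum_compl T; set a := \sum_(t in T) n t; set c := \sum_(t in ~: T) n t.
  by move: a c qd; rewrite -/d => a c qd e; apply/eqP/eqP; lia.
have -> : #|~: T| = r - #|T| by rewrite [in LHS]cardsCs setCK card_ord.
have Tr : #|T| <= r by rewrite -[r in _ <= r]card_ord max_card.
move: #|T| Tr => m mr; have [mi|im] := leqP m i; last first.
  by case: ifP => // le; apply: bin_small; lia.
case: ifP => [le|/negbT le]; last by rewrite bin_small //; lia.
rewrite -[in RHS]bin_sub; last by lia.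
congr 'C(_, _); lia.
Qed.

Lemma block_term_out k i q : 0 < q < d -> (i == 0) || (k + r <= i) ->
  block_term n k i q = 0.
Proof.
move=> /andP[q0 qd] hi; apply: big1 => T /eqP Tq.
have T0 : 0 < #|T|.
  by rewrite card_gt0; apply/eqP => T0; move: q0; rewrite -Tq T0 big_set0.
case: ifP => // Ti; apply: bin_small.
have : #|T| < r.
  have : #|T| <= r by rewrite -[r in _ <= r]card_ord max_card.
  rewrite leq_eqVlt => /orP[/eqP Tr|//].
  have TT : T = setT.
    by apply/eqP; rewrite eqEcard subsetT cardsT card_ord Tr leqnn.
  by move: qd; rewrite -Tq TT /d (eq_bigl predT) ?ltnn // => i'; rewrite inE.
move: #|T| T0 Ti => m; case/orP: hi => [/eqP->|]; lia.
Qed.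

(** As all [n t] are positive, only singletons T contribute. *)
Lemma block_term1 k i : block_term n k i.+1 1 = #|[set t | n t == 1]| * 'C(k, i).
Proof.
have sum1P (T : {set 'I_r}) : (\sum_(t in T) n t == 1) =
    (T \in set1 @: [set t | n t == 1]).
  apply/idP/imsetP => [/eqP T1|[t]]; last first.
    by rewrite inE => nt ->; rewrite big_set1.
  have [T0|[t tT]] := set_0Vmem T; first by rewrite T0 big_set0 in T1.
  move: T1; rewrite (big_setD1 t) //=; have := n_gt0 t.
  case nt: (n t) => [|[|m]] // _.
    rewrite add1n => -[/sum_eq0 T0].
    exists t; first by rewrite inE nt.
    by rewrite -(setD1K tT) T0 setU0.
rewrite -(card_imset _ set1_inj) -sum_nat_const /block_term.
apply: eq_big => [T|T]; first exact: sum1P.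
by rewrite sum1P => /imsetP[t _ ->]; rewrite cards1 ltnS leq0n subSS subn0.
Qed.

End Formulas.

(** * Independence of the resolution *)

Local Open Scope ring_scope.

(** Chain maps are built degree by degree, between modules that depend on the
    degree. *)
Lemma dependent_choice (T : nat -> Type) (Inv : forall p, T p -> Prop)
    (Rel : forall p, T p -> T p.+1 -> Prop) (x0 : T 0%N) :
  Inv 0%N x0 ->
  (forall p x, Inv p x -> exists2 y, Inv p.+1 y & Rel p x y) ->
  exists f : forall p, T p, [/\ f 0%N = x0, forall p, Inv p (f p) &
    forall p, Rel p (f p) (f p.+1)].
Proof.
move=> i0 step.
have next p (x : {x | Inv p x}) : {y : {y | Inv p.+1 y} | Rel p (sval x) (sval y)}.
  have /cid2[y iy ry] := step p _ (svalP x).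
  by exists (exist _ y iy).
pose F := fix F p : {x | Inv p x} :=
  if p is p'.+1 then sval (next p' (F p')) else exist _ x0 i0.
exists (fun p => sval (F p)); split=> // p; first exact: svalP.
exact: svalP (next p (F p)).
Qed.

Section Comparison.
Variables (k : idomainType) (m : nat).
Local Notation S := {mpoly k[m]}.
Implicit Types (G H : graded_resolution k m).

(** Multiplication by q shifts degrees by e; the case distinction avoids a
    truncated subtraction. *)
Lemma pihomogMr D e (y q : S) : q \is e.-homog ->
  pihomog mdeg D (y * q) =
  if (e <= D)%N then pihomog mdeg (D - e) y * q else 0.
Proof.
move=> qe; rewrite {1}(@pihomog_partitionE _ _ mdeg (msize y) y) // mulr_suml raddf_sum /=.
have hom i : pihomog mdeg i y * q \is (i + e).-homog.
  by apply: dhomogM => //; apply: pihomogP.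
case: leqP => eD; last first.
  by apply: big1 => i _; rewrite (pihomog_ne0 _ (hom i)) // gtn_eqF // ltn_addl.
have [lt|ge] := ltnP (D - e) (msize y).
  rewrite (bigD1 (Ordinal lt)) //= big1 => [|i ni].
    by rewrite addr0 pihomog_dE //; have := hom (D - e)%N; rewrite subnK.
  rewrite (pihomog_ne0 _ (hom i)) //; apply: contra ni => /eqP e1.
  by apply/eqP/val_inj; rewrite /= -e1 addnK.
rewrite big1 => [|i _].
  suff -> : pihomog mdeg (D - e) y = 0 by rewrite mul0r.
  rewrite pihomogE big_seq_cond big1 // => u /andP[/msize_mdeg_lt lt /eqP e1].
  by move: lt; rewrite e1 ltnNge ge.
rewrite (pihomog_ne0 _ (hom i)) //; apply: contraTneq (ltn_ord i) => e1.
by rewrite -leqNgt (leq_trans ge) // -e1 addnK.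
Qed.

Lemma shifted_homog0 a j : shifted_homog a j (0 : S).
Proof. by rewrite /shifted_homog; case: ifP => _; rewrite ?dhomog0. Qed.

Lemma shifted_homogD a j (p q : S) :
  shifted_homog a j p -> shifted_homog a j q -> shifted_homog a j (p + q).
Proof.
rewrite /shifted_homog; case: ifP => _; first exact: dhomogD.
by move=> /eqP-> /eqP->; rewrite addr0.
Qed.

Lemma shifted_homogM a b c (p q : S) :
  shifted_homog b a p -> shifted_homog c b q -> shifted_homog c a (p * q).
Proof.
rewrite /shifted_homog; case: leqP => ba; last first.
  by move=> /eqP-> _; rewrite mul0r; apply: shifted_homog0.
case: leqP => cb pb qc; last first.
  by rewrite (eqP qc) mulr0; apply: shifted_homog0.
rewrite (leq_trans cb ba); have -> : (a - c = (a - b) + (b - c))%N.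
  by rewrite addnBA // subnK.
exact: dhomogM.
Qed.

(** The projection onto the polynomials that satisfy [shifted_homog a j]. *)
Definition homog_part a j (p : S) : S :=
  if (a <= j)%N then pihomog mdeg (j - a) p else 0.

Lemma homog_partP a j p : shifted_homog a j (homog_part a j p).
Proof.
rewrite /shifted_homog /homog_part; case: (a <= j)%N => /=; last exact: eqxx.
by apply: pihomogP.
Qed.

Lemma homog_part_id a j p : shifted_homog a j p -> homog_part a j p = p.
Proof.
rewrite /shifted_homog /homog_part; case: ifP => _; first exact: pihomog_dE.
by move/eqP.
Qed.

Lemma homog_part_sum a j I (r : seq I) P (F : I -> S) :
  homog_part a j (\sum_(i <- r | P i) F i) =
  \sum_(i <- r | P i) homog_part a j (F i).
Proof.
by rewrite /homog_part; case: ifP => _; rewrite ?raddf_sum // big1.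
Qed.

Lemma homog_partM b c j (y q : S) : shifted_homog b c q ->
  homog_part b j (y * q) = homog_part c j y * q.
Proof.
rewrite /shifted_homog /homog_part; case: leqP => bc qh; last first.
  by rewrite (eqP qh) !mulr0 raddf0 if_same.
case: leqP => bj; last by rewrite leqNgt (leq_trans bj bc) mul0r.
rewrite (pihomogMr _ _ qh) leq_subLR subnKC //; case: leqP => cj; last by rewrite mul0r.
by rewrite subnBA // subnK.
Qed.

Definition homog_mx a b (da : 'I_a -> nat) (db : 'I_b -> nat) (M : 'M[S]_(a, b)) :=
  forall i j, shifted_homog (db j) (da i) (M i j).

Lemma homog_mxM a b c (da : 'I_a -> nat) (db : 'I_b -> nat) (dc : 'I_c -> nat) M N :
  homog_mx da db M -> homog_mx db dc N -> homog_mx da dc (M *m N).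
Proof.
move=> hM hN i j; rewrite mxE.
apply: (big_ind (fun p => shifted_homog (dc j) (da i) p)) => [|p q|l _].
- exact: shifted_homog0.
- exact: shifted_homogD.
- exact: shifted_homogM (hM i l) (hN l j).
Qed.

(** As N is homogeneous, every solution may be replaced by its homogeneous part
    of the right degree. *)
Lemma homog_mx_lift a b c (da : 'I_a -> nat) (db : 'I_b -> nat) (dc : 'I_c -> nat)
    (X : 'M_(a, b)) (N : 'M_(c, b)) :
  homog_mx da db X -> homog_mx dc db N ->
  (forall i, exists y : 'rV_c, row i X = y *m N) ->
  exists2 Y : 'M_(a, c), homog_mx da dc Y & X = Y *m N.
Proof.
move=> hX hN /choice[y yE].
exists (\matrix_(i, l) homog_part (dc l) (da i) (y i 0 l)).
  by move=> i l; rewrite mxE; apply: homog_partP.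
apply/matrixP => i j; rewrite mxE -(homog_part_id (hX i j)).
have /matrixP/(_ 0 j) := yE i; rewrite !mxE => ->.
rewrite homog_part_sum; apply: eq_bigr => l _.
by rewrite mxE (homog_partM _ _ (hN l j)).
Qed.

(** In degree 0 the augmentation takes the place of the differential. *)
Definition res_cycle G p : 'rV[S]_(res_rank G p) -> Prop :=
  match p with
  | 0 => fun x => map_mx (mcoeff 0%MM) x *m res_aug G = 0
  | p'.+1 => fun x => x *m res_diff G p' = 0
  end.
Arguments res_cycle G p x : clear implicits.

Lemma res_exact G p (x : 'rV_(res_rank G p)) :
  res_cycle G p x <-> exists y, x = y *m res_diff G p.
Proof. by case: p x => [|p] x; [apply: res_exact0|apply: res_exactS]. Qed.

Lemma res_cycle_row G p i : res_cycle G p (row i (res_diff G p)).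
Proof. by apply/res_exact; exists (delta_mx 0 i); rewrite rowE. Qed.

Lemma res_diff_sq G p : res_diff G p.+1 *m res_diff G p = 0.
Proof.
apply/row_matrixP => i; rewrite row_mul row0.
exact: (res_cycle_row (p := p.+1) i).
Qed.

Definition chain_map G H (f : forall p, 'M[S]_(res_rank G p, res_rank H p)) :=
  forall p : nat, f p.+1 *m res_diff H p = res_diff G p *m f p.

(** The comparison theorem. In degree 0 the map is the augmentation of G
    followed by a section of that of H; this section may be supported on the
    generators of degree 0, as the augmentation kills the others. In higher
    degrees a lift exists by exactness and may be taken homogeneous. *)
Lemma chain_map_exists G H :
  exists f : forall p, 'M[S]_(res_rank G p, res_rank H p),
  [/\ forall p, homog_mx (@res_deg _ _ G p) (@res_deg _ _ H p) (f p), chain_map f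
    & forall x : 'rV_(res_rank G 0), map_mx (mcoeff 0%MM) (x *m f 0%N) *m res_aug H =
                map_mx (mcoeff 0%MM) x *m res_aug G].
Proof.
have [x xH] := res_aug_surj H.
pose x' : 'rV[k]__ := \row_l (if @res_deg _ _ H 0 l == 0%N then x 0 l else 0).
have x'H : x' *m res_aug H = 1%:M.
  rewrite -xH; apply/matrixP => i j; rewrite !mxE; apply: eq_bigr => l _.
  rewrite mxE !ord1; case: eqP => // /(res_aug_homog (g := H)) ->.
  by rewrite !mulr0.
pose f0 : 'M[S]__ := map_mx (@mpolyC m k) (res_aug G *m x').
have f0aug y : map_mx (mcoeff 0%MM) (y *m f0) *m res_aug H =
               map_mx (mcoeff 0%MM) y *m res_aug G.
  have e0 : map_mx (mcoeff 0%MM) f0 = res_aug G *m x'.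
    by apply/matrixP => i l; rewrite 2!mxE mpolyCK.
  by rewrite map_mxM e0 -!mulmxA x'H mulmx1.
pose Inv p (f : 'M[S]_(res_rank G p, res_rank H p)) :=
  homog_mx (@res_deg _ _ G p) (@res_deg _ _ H p) f /\
  forall y, res_cycle G p y -> res_cycle H p (y *m f).
have [||f [f0E fI fR]] := @dependent_choice _ Inv
  (fun p f f' => f' *m res_diff H p = res_diff G p *m f) f0.
- split=> [i j|y]; last by rewrite /= f0aug.
  rewrite !mxE; rewrite big_ord1 mxE; case: eqP => [e0|_]; last first.
    by rewrite mulr0 mpolyC0; apply: shifted_homog0.
  have [e1|/eqP ne] := eqVneq (res_deg i) 0%N; last first.
    by rewrite (res_aug_homog ne) mul0r mpolyC0; apply: shifted_homog0.
  rewrite /shifted_homog e0 e1 /=.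
  by rewrite -[_%:MP]mulr1 mul_mpolyC; apply/dhomogZ/dhomog1.
- move=> p f [hf cf].
  have hd := @res_diff_homog _ _ H p.
  have [i|f' hf' e] := homog_mx_lift (homog_mxM (@res_diff_homog _ _ G p) hf) hd.
    by rewrite row_mul; apply/res_exact/cf/res_cycle_row.
  exists f'; last by rewrite e.
  split=> // y; rewrite /= => yd.
  by rewrite -mulmxA -e mulmxA yd mul0mx.
exists f; split=> [p||y]; [exact: (fI p).1|exact: fR|by rewrite f0E].
Qed.

(** Applied to the difference of a composite of comparison maps and the
    identity, this shows that they are inverse to each other up to homotopy. *)
Lemma homotopy_exists G (e : forall p, 'M[S]_(res_rank G p)) :
  chain_map e -> (forall x, res_cycle G 0 (x *m e 0%N)) ->
  exists h : forall p, 'M[S]_(res_rank G p, res_rank G p.+1),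
    e 0%N = h 0%N *m res_diff G 0 /\
    forall p, e p.+1 = res_diff G p *m h p + h p.+1 *m res_diff G p.+1.
Proof.
move=> ce e0.
have lift p (X : 'M_(res_rank G p)) : (forall i, res_cycle G p (row i X)) ->
    exists Y, X = Y *m res_diff G p.
  move=> cX; have /choice[y yE] : forall i, exists y, row i X = y *m res_diff G p.
    by move=> i; apply/res_exact/cX.
  exists (\matrix_i y i); apply/row_matrixP => i.
  by rewrite row_mul rowK yE.
have [h0 h0E] : exists h0, e 0%N = h0 *m res_diff G 0.
  by apply: lift => i; rewrite rowE; apply: e0.
pose Inv p (h : 'M[S]_(res_rank G p, res_rank G p.+1)) :=
  res_diff G p *m (e p - h *m res_diff G p) = 0.
have [||h [h00 _ hR]] := @dependent_choice _ Inv
  (fun p h h' => e p.+1 = res_diff G p *m h + h' *m res_diff G p.+1) h0.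
- by rewrite /Inv -h0E subrr mulmx0.
- move=> p h; rewrite /Inv => hI.
  have [i|h' h'E] := lift p.+1 (e p.+1 - res_diff G p *m h).
    rewrite /= -row_mul mulmxBl (ce p) -mulmxA -mulmxBr hI; exact: row0.
  exists h'; last by rewrite -h'E addrC subrK.
  by rewrite -h'E opprB addrC subrK mulmxA res_diff_sq mul0mx.
by exists h; split=> //; rewrite h00.
Qed.

Section Transfer.
Variable K : simplicial_complex m.
Local Notation A := (face_ring k K).
Local Notation phi := (@to_face_ring k m K).

Lemma to_face_ring_is_additive : additive phi.
Proof. by move=> x y; rewrite /to_face_ring rmorphB. Qed.

Lemma to_face_ring_is_multiplicative : multiplicative phi.
Proof. by split=> [x y|]; rewrite /to_face_ring ?rmorphM ?rmorph1. Qed.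

HB.instance Definition _ := GRing.isAdditive.Build S A phi to_face_ring_is_additive.
HB.instance Definition _ := GRing.isMultiplicative.Build S A phi
  to_face_ring_is_multiplicative.

(** A combination w of cycles whose image under the comparison map f is a
    boundary is a boundary itself: it differs by a boundary from the image of
    this image under the comparison map g in the other direction. *)
Lemma tor_independent_transfer G H i j s :
  tor_independent K G i j s -> tor_independent K H i j s.
Proof.
case=> z zP zI; have [f [hf cf af]] := chain_map_exists G H.
have [g [hg cg ag]] := chain_map_exists H G.
(* The composite of the comparison maps is homotopic to the identity. *)
pose e p := f p *m g p - 1%:M.
have ce : chain_map e.
  move=> p; rewrite /e mulmxBl mulmxBr mul1mx mulmx1 -mulmxA cg mulmxA cf.
  by rewrite mulmxA.
have [|h [h0 hS]] := homotopy_exists ce.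
  move=> x; rewrite /res_cycle /e mulmxBr mulmx1 raddfB mulmxBl mulmxA.
  by rewrite ag af subrr.
exists (fun t => z t *m map_mx phi (f i)) => [t|c [y yE]].
  have [zc [y yh yE]] := zP t; split; last first.
    exists (y *m f i); last by rewrite yE map_mxM.
    move=> q; apply: (@homog_mxM 1 _ _ (fun=> j) _ _ y _ _ (hf i) 0 q).
    by move=> i0 l; rewrite ord1.
  case: (i) (z t) zc => [|p] //= x xd.
  by rewrite -mulmxA -map_mxM cf map_mxM mulmxA xd mul0mx.
apply: zI; set w := \sum_t _.
have wE : w *m map_mx phi (f i) = y *m map_mx phi (res_diff H i).
  by rewrite -yE mulmx_suml; apply: eq_bigr => t _; rewrite scalemxAl.
have wc : tor_cycle w.
  rewrite /w; case: (i) (z) zP => [|p] //= z' z'P.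
  rewrite mulmx_suml big1 // => t _.
  by rewrite -scalemxAl (z'P t).1 scaler0.
have we : w *m map_mx phi (e i) =
    (y *m map_mx phi (g i.+1)) *m map_mx phi (res_diff G i) - w.
  rewrite /e raddfB /= map_mx1 mulmxBr mulmx1 map_mxM mulmxA wE.
  by rewrite -!mulmxA -!map_mxM cg.
have [y' y'E] : exists y', w *m map_mx phi (e i) = y' *m map_mx phi (res_diff G i).
  case: (i) (w) wc => [|p] x /= xc.
    by exists (x *m map_mx phi (h 0%N)); rewrite h0 map_mxM mulmxA.
  exists (x *m map_mx phi (h p.+1)).
  by rewrite hS raddfD /= !map_mxM mulmxDr !mulmxA xc mul0mx add0r.
exists (y *m map_mx phi (g i.+1) - y').
by rewrite mulmxBl -y'E we opprB addrC subrK.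
Qed.

End Transfer.

Lemma betti_eq K (G : graded_resolution k m) i j B :
  (forall s, tor_independent K G i j s <-> (s <= B)%N) -> betti k K i j = B.
Proof.
move=> hB; have rk H : tor_rank K H i j = B.
  have hB' s : tor_independent K H i j s <-> (s <= B)%N.
    by rewrite -hB; split; apply: tor_independent_transfer.
  rewrite /tor_rank; case: xgetP => [s _ [/hB' sB smax]|/(_ B)[]].
    by apply/eqP; rewrite eqn_leq sB smax //; apply/hB'.
  by split=> [|s' /hB'//]; apply/hB'.
rewrite /betti; case: xgetP => [b _ [H ->]|/(_ B)[]]; first exact: rk.
by exists G; rewrite rk.
Qed.

End Comparison.

(** * The Koszul complex *)

Section KoszulSign.
Variables (m : nat) (R : comNzRingType).
Implicit Types (i j : 'I_m) (I J : {set 'I_m}).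

Definition koszul_sign i I : R := (-1) ^+ #|[set j in I | (j < i)%N]|.

Lemma koszul_sign_sq i I : koszul_sign i I * koszul_sign i I = 1.
Proof. by rewrite -expr2 sqrr_sign. Qed.

Lemma koszul_sign_add i j I : i \notin I ->
  koszul_sign j (i |: I) = (-1) ^+ (i < j)%N * koszul_sign j I.
Proof.
move=> iI; rewrite /koszul_sign -exprD; congr (_ ^+ _).
have [ij|ij] := boolP (i < j)%N.
  have -> : [set l in i |: I | (l < j)%N] = i |: [set l in I | (l < j)%N].
    by apply/setP => l; rewrite !inE; case: eqP => // ->.
  by rewrite cardsU1 inE (negPf iI).
rewrite add0n; apply: eq_card => l; rewrite !inE.
by case: eqP => // ->; rewrite (negPf ij) !andbF.
Qed.

Lemma koszul_sign_anti i j I : i != j -> i \notin I -> j \notin I ->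
  koszul_sign i I * koszul_sign j (i |: I) +
  koszul_sign j I * koszul_sign i (j |: I) = 0.
Proof.
move=> ij iI jI; rewrite !koszul_sign_add //.
rewrite mulrCA [koszul_sign j I * _]mulrCA [koszul_sign j I * _]mulrC -mulrDl.
case: ltngtP ij => [_ _|_ _|/val_inj->]; last by rewrite eqxx.
  by rewrite expr1 expr0 addNr mul0r.
by rewrite expr1 expr0 subrr mul0r.
Qed.

Lemma koszul_sign_swap i j I : i != j -> i \notin I -> j \notin I ->
  koszul_sign j (i |: I) * koszul_sign i (j |: I) =
  - (koszul_sign j I * koszul_sign i I).
Proof.
move=> ij iI jI; have /eqP := koszul_sign_anti ij iI jI.
rewrite addr_eq0 => /eqP e.
rewrite -[LHS]mul1r -(koszul_sign_sq i I) mulrACA e.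
by rewrite mulNr mulrACA koszul_sign_sq mulr1.
Qed.

End KoszulSign.
Arguments koszul_sign {m R} i I.

(** The terms are cancelled in pairs with [i < j], without dividing by 2. *)
Lemma antisymmetric_sum (R : zmodType) m (f : 'I_m -> 'I_m -> R) :
  (forall i, f i i = 0) -> (forall i j, f i j + f j i = 0) ->
  \sum_i \sum_j f i j = 0.
Proof.
move=> f0 fA.
have -> : \sum_i \sum_j f i j =
    \sum_(i < m) \sum_(j < m | (i < j)%N) f i j +
    \sum_(i < m) \sum_(j < m | (j < i)%N) f i j.
  rewrite -big_split; apply: eq_bigr => i _ /=.
  rewrite (bigID (fun j : 'I_m => (i < j)%N)) /=; congr (_ + _).
  rewrite (bigD1 i) ?ltnn //= f0 add0r; apply: eq_bigl => j.
  by rewrite -leqNgt ltn_neqAle andbC.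
rewrite [X in _ + X](exchange_big_dep predT) //= -big_split big1 // => i _ /=.
by rewrite -big_split big1 // => j _ /=.
Qed.

Section Koszul.
Variables (k : idomainType) (m : nat).
Local Notation S := {mpoly k[m]}.
Implicit Types (i j : 'I_m) (I J : {set 'I_m}) (x y : {set 'I_m} -> S).

(** The Koszul differential in coordinates: [x I] is the coefficient of the
    exterior generator of I. *)
Definition koszul_diff x J : S :=
  \sum_(i | i \notin J) koszul_sign i J *: ('X_i * x (i |: J)).

Lemma mcoeffXM i (p : S) (u : 'X_{1..m}) :
  ('X_i * p)@_u = if (0 < u i)%N then p@_(u - U_(i)) else 0.
Proof.
case: ifP => ui.
  rewrite -{1}(@submK _ U_(i) u); last by rewrite lep1mP -lt0n.
  by rewrite addmC mulrC mcoeffMX.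
rewrite {1}(mpolyE p) mulr_sumr raddf_sum big1 //= => v _.
rewrite -scalerAr mcoeffZ -mpolyXD mcoeffX; case: eqP => [e|_]; last by rewrite mulr0.
by move: ui; rewrite -e mnmDE mnm1E eqxx.
Qed.

Lemma mcoeff_koszul_diff x J u : (koszul_diff x J)@_u =
  \sum_(i | i \notin J) koszul_sign i J *
    (if (0 < u i)%N then (x (i |: J))@_(u - U_(i)) else 0).
Proof. by rewrite raddf_sum; apply: eq_bigr => i _; rewrite /= mcoeffZ mcoeffXM. Qed.

Lemma koszul_diff_sq x J : koszul_diff (koszul_diff x) J = 0.
Proof.
pose f i j := if (i \notin J) && (j \notin i |: J) then
  (koszul_sign i J * koszul_sign j (i |: J)) *:
    ('X_i * 'X_j * x (i |: (j |: J))) else 0.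
rewrite -[RHS](@antisymmetric_sum S m f) /f => [|i|i j].
- rewrite /koszul_diff big_mkcond; apply: eq_bigr => i _.
  case: (boolP (i \notin J)) => iJ /=; last by rewrite big1.
  rewrite mulr_sumr scaler_sumr -big_mkcond; apply: eq_bigr => j _.
  by rewrite -scalerAr scalerA mulrA setUCA.
- by rewrite setU11 andbF.
rewrite !inE !negb_or [j == i]eq_sym; case: eqVneq => [_|ij] /=.
  by rewrite !andbF addr0.
rewrite andbC; case: ifP => [/andP[jJ iJ]|_]; last by rewrite addr0.
rewrite setUCA ['X_j * _]mulrC -scalerDl koszul_sign_anti ?scale0r //.
Qed.

Definition msupport (u : 'X_{1..m}) : {set 'I_m} := [set i | u i != 0%N].
Definition indicator I : 'X_{1..m} := [multinom nat_of_bool (i \in I) | i < m].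

Lemma indicatorE I i : indicator I i = (i \in I).
Proof. by rewrite mnmE. Qed.

(** The multidegree of a monomial u at the generator of I is [u + indicator I],
    and [koszul_diff] preserves it. Suppose that [pivot] chooses in a
    multidegree a variable one factor of which can be removed from u without
    leaving the good monomials. Then exchanging this factor for the exterior
    generator is a contraction of the complex of good monomials in the
    multidegrees with a pivot, the only ones in which x lives. With all
    monomials good, this is the exactness of the Koszul complex; with the
    monomials supported on the faces of K and a pivot of exponent at least 2,
    it shows that only the square-free multidegrees contribute to Tor. *)
Lemma koszul_toggle (good : {set 'I_m} -> bool) (pivot : 'X_{1..m} -> option 'I_m) x :
  (forall I u i, pivot (u + indicator I)%MM = Some i -> i \notin I ->
     (0 < u i)%N /\ good (msupport (u - U_(i))%MM) = good (msupport u)) ->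
  (forall I u, pivot (u + indicator I)%MM = None -> good (msupport u) -> (x I)@_u = 0) ->
  (forall J u, good (msupport u) -> (koszul_diff x J)@_u = 0) ->
  exists2 y, forall I, (forall i, i \in I -> x (I :\ i) = 0) -> y I = 0 &
    forall I u, good (msupport u) -> (x I)@_u = (koszul_diff y I)@_u.
Proof.
move=> toggle x0 xc.
(* The contraction, coefficient by coefficient; it vanishes in large degrees,
   so that it defines polynomials. *)
pose c I u : k := if pivot (u + indicator I)%MM is Some i then
  if i \in I then koszul_sign i (I :\ i) * (x (I :\ i))@_(u + U_(i)) else 0 else 0.
pose N := \max_I msize (x I).
pose y I : S := \sum_(u : 'X_{1..m < N}) c I u *: 'X_[u].
have yE I u : (y I)@_u = c I u.
  have [lt|ge] := ltnP (mdeg u) N; first exact: mcoeff_mpoly.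
  rewrite raddf_sum big1 => [|v _] /=.
    rewrite /c; case: (pivot _) => // i; case: ifP => // _.
    rewrite memN_msupp_eq0 ?mulr0 //; apply: msize_mdeg_ge.
    apply: leq_trans (leq_trans ge _); first exact: (leq_bigmax (I :\ i)).
    by rewrite mdegD leq_addr.
  rewrite mcoeffZ mcoeffX; case: eqP => [e|_]; last by rewrite mulr0.
  by have := bmdeg v; rewrite e ltnNge ge.
exists y => [I xI|I u gu].
  apply/mpolyP => u; rewrite yE mcoeff0 /c; case: (pivot _) => // i.
  by case: ifP => // iI; rewrite xI // mcoeff0 mulr0.
rewrite mcoeff_koszul_diff.
have alpha j : j \notin I -> (0 < u j)%N ->
    ((u - U_(j)) + indicator (j |: I) = u + indicator I)%MM.
  move=> jI uj; apply/mnmP => l; rewrite !mnmDE mnmBE !indicatorE mnm1E !inE.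
  rewrite [l == j]eq_sym; case: eqP => [<-|_] /=; last by rewrite subn0.
  by rewrite (negPf jI) addn0 subnK.
rewrite (eq_bigr (fun j => koszul_sign j I *
    (if (0 < u j)%N then c (j |: I) (u - U_(j))%MM else 0))); last first.
  by move=> j _; rewrite yE.
case e: (pivot (u + indicator I)%MM) => [i|]; last first.
  rewrite x0 // big1 // => j jI; case: ifP => uj; last by rewrite mulr0.
  by rewrite /c alpha // e mulr0.
have [iI|iI] := boolP (i \in I); last first.
  have [ui _] := toggle _ _ _ e iI.
  rewrite (bigD1 i) //= big1 ?addr0 => [|j /andP[jI ji]]; last first.
    case: ifP => uj; last by rewrite mulr0.
    by rewrite /c alpha // e !inE eq_sym (negPf ji) (negPf iI) mulr0.
  rewrite ui /c alpha // e setU11 setU1K // submK ?lep1mP -?lt0n //.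
  by rewrite mulrA koszul_sign_sq mul1r.
pose J := I :\ i; have iJ : i \notin J by rewrite !inE eqxx.
have IE : i |: J = I by rewrite setD1K.
have eJ : ((u + U_(i)) + indicator J = u + indicator I)%MM.
  apply/mnmP => l; rewrite !mnmDE !indicatorE mnm1E !inE [i == l]eq_sym.
  by case: eqP => [->|_] /=; rewrite ?iI ?addn0.
have [_ gE] : (0 < (u + U_(i))%MM i)%N /\ _ := toggle J _ i (etrans (congr1 _ eJ) e) iJ.
have /(xc J) : good (msupport (u + U_(i))%MM) by rewrite -gE addmK.
rewrite mcoeff_koszul_diff (bigD1 i) //= mnmDE mnm1E eqxx addn1 /= addmK IE.
move/(congr1 (fun z => koszul_sign i J * z)).
rewrite mulr0 mulrDr mulrA koszul_sign_sq mul1r => /eqP.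
rewrite addr_eq0 => /eqP->; rewrite mulr_sumr -sumrN.
apply: eq_big => [j|j /andP[jJ ji]].
  by rewrite !inE; case: eqP => [->|_]; rewrite ?iI ?andbT.
rewrite mnmDE mnm1E eq_sym (negPf ji) addn0; case: ifP => uj; last by rewrite !mulr0 oppr0.
have jI : j \notin I by rewrite !inE ji in jJ.
have jE : (j |: I) :\ i = j |: J.
  by apply/setP => l; rewrite !inE; case: eqP => // ->; rewrite eq_sym (negPf ji).
rewrite /c alpha // e !inE iI orbT jE -IE !mulrA koszul_sign_swap 1?eq_sym //.
rewrite [koszul_sign i J * _]mulrC -mulNr; congr (- _ * _@_ _).
apply/mnmP => l; rewrite !(mnmDE, mnmBE, mnm1E).
case: (j =P l) => [<-|_]; last by rewrite !subn0.
by rewrite eq_sym (negPf ji) !addn0.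
Qed.
End Koszul.

(** * The Koszul resolution *)

Section Rows.
Variables (m : nat).
Implicit Types (I J : {set 'I_m}) (p : nat).

Definition koszul_index p := {I : {set 'I_m} | #|I| == p}.
Definition koszul_rank p := #|{: koszul_index p}|.
Definition gen p (q : 'I_(koszul_rank p)) : {set 'I_m} := val (enum_val q).

Lemma card_gen p (q : 'I_(koszul_rank p)) : #|gen q| = p.
Proof. exact/eqP/(valP (enum_val q)). Qed.

(** Row vectors are extended by zero to functions on all sets, so that no casts
    between the index types in different degrees arise. *)
Definition coeffs (R : nmodType) p (x : 'rV[R]_(koszul_rank p)) I : R :=
  if insub I is Some t then x 0 (enum_rank (t : koszul_index p)) else 0.

Definition row_of (R : nmodType) p (x : {set 'I_m} -> R) : 'rV[R]_(koszul_rank p) :=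
  \row_q x (gen q).

Lemma coeffs_gen (R : nmodType) p (x : 'rV[R]_(koszul_rank p)) q :
  coeffs x (gen q) = x 0 q.
Proof. by rewrite /coeffs /gen valK enum_valK. Qed.

Lemma coeffs_out (R : nmodType) p (x : 'rV[R]_(koszul_rank p)) I :
  #|I| != p -> coeffs x I = 0.
Proof. by move=> Ip; rewrite /coeffs insubN. Qed.

Lemma gen_exists p I : #|I| = p -> exists q : 'I_(koszul_rank p), gen q = I.
Proof.
move=> /eqP Ip; exists (enum_rank (exist _ I Ip : koszul_index p)).
by rewrite /gen enum_rankK.
Qed.

Lemma coeffs_row_of (R : nmodType) p (x : {set 'I_m} -> R) I :
  coeffs (row_of p x) I = if #|I| == p then x I else 0.
Proof.
case: ifP => [/eqP/gen_exists[q <-]|/negbT]; last exact: coeffs_out.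
by rewrite coeffs_gen mxE.
Qed.

Lemma coeffs_inj (R : nmodType) p (x y : 'rV[R]_(koszul_rank p)) :
  coeffs x =1 coeffs y -> x = y.
Proof. by move=> e; apply/rowP => q; rewrite -!coeffs_gen e. Qed.

Lemma sum_coeffs (R : pzSemiRingType) p (x : 'rV[R]_(koszul_rank p)) (c : {set 'I_m} -> R) :
  \sum_q x 0 q * c (gen q) = \sum_I coeffs x I * c I.
Proof.
rewrite [RHS](bigID (fun I : {set 'I_m} => #|I| == p)) /=.
rewrite [X in _ + X]big1 ?addr0 => [|I Ip]; last by rewrite coeffs_out ?mul0r.
rewrite (reindex_omap (@gen p) (fun I => omap enum_rank (insub I : option (koszul_index p)))).
  apply: eq_big => [q|q _]; last by rewrite coeffs_gen.
  by rewrite card_gen eqxx /gen valK /= enum_valK eqxx.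
by move=> I Ip; rewrite insubT /= /gen enum_rankK.
Qed.

End Rows.

Section Resolution.
Variables (k : idomainType) (m : nat).
Local Notation S := {mpoly k[m]}.
Implicit Types (I J : {set 'I_m}) (p : nat).

Definition koszul_map p : 'M[S]_(koszul_rank m p.+1, koszul_rank m p) :=
  \matrix_(q, l) \sum_(i | (i \notin gen l) && (i |: gen l == gen q))
     koszul_sign i (gen l) * 'X_i.

Lemma coeffs_koszul_map p (x : 'rV[S]_(koszul_rank m p.+1)) :
  coeffs (x *m koszul_map p) =1 koszul_diff (coeffs x).
Proof.
move=> J; have [/gen_exists[l <-]|Jp] := eqVneq #|J| p; last first.
  rewrite coeffs_out // /koszul_diff big1 // => i iJ.
  by rewrite coeffs_out ?mulr0 ?scaler0 // cardsU1 iJ add1n eqSS.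
rewrite coeffs_gen mxE.
under eq_bigr do rewrite mxE.
rewrite (sum_coeffs x (fun I => \sum_(i | (i \notin gen l) && (i |: gen l == I)) _)).
under eq_bigr do rewrite mulr_sumr.
rewrite (exchange_big_dep (fun i => i \notin gen l)) /=; last by move=> I i _ /andP[].
apply: eq_bigr => i il; rewrite (bigD1 (i |: gen l)) /= ?il ?eqxx // big1 ?addr0.
  rewrite mulrCA -[RHS]mul_mpolyC [coeffs _ _ * _]mulrC; congr (_ * _).
  by rewrite /koszul_sign rmorphXn rmorphN rmorph1.
by move=> I /andP[/andP[_ /eqP->]]; rewrite eqxx.
Qed.

Lemma koszul_map_homog p (q : 'I_(koszul_rank m p.+1)) (l : 'I_(koszul_rank m p)) :
  shifted_homog p p.+1 (koszul_map p q l).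
Proof.
rewrite /shifted_homog leqnSn subSnn mxE rpred_sum // => i _.
by rewrite rpredMsign dhomogX /= mdeg1.
Qed.

Definition koszul_aug : 'cV[k]_(koszul_rank m 0) := const_mx 1.

Lemma koszul_augE (x : 'rV[k]_(koszul_rank m 0)) :
  x *m koszul_aug = (coeffs x set0)%:M.
Proof.
apply/matrixP => i j; rewrite !ord1 !mxE /= mulr1n.
under eq_bigr do rewrite mxE.
rewrite (sum_coeffs x (fun=> 1)) (bigD1 set0) //= big1 ?addr0 ?mulr1 // => I I0.
by rewrite coeffs_out ?mul0r // cards_eq0.
Qed.

(** Any variable of positive exponent serves as pivot; there is none in
    multidegree 0 only, where the constant coefficient vanishes by
    hypothesis. *)
Lemma koszul_exact p (x : 'rV[S]_(koszul_rank m p)) :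
  (coeffs x set0)@_0%MM = 0 -> (forall J, koszul_diff (coeffs x) J = 0) ->
  exists y, x = y *m koszul_map p.
Proof.
move=> x0 xc.
pose pivot (u : 'X_{1..m}) := [pick i | 0 < u i]%N.
have [||J u _|y y0 yE] :=
  @koszul_toggle k m xpredT pivot (coeffs x); rewrite ?xc ?mcoeff0 //.
- move=> I u i; rewrite /pivot; case: pickP => // j uj [<-] jI; split=> //.
  by move: uj; rewrite mnmDE indicatorE (negPf jI) addn0.
- move=> I u; rewrite /pivot; case: pickP => // no _ _.
  have u0 i : u i = 0%N /\ i \notin I.
    by have := no i; rewrite mnmDE indicatorE; case: (u i); case: (i \in I).
  have -> : u = 0%MM by apply/mnmP => i; rewrite mnm0E (u0 i).1.
  suff -> : I = set0 by [].
  by apply/setP => i; rewrite inE; apply/negbTE; exact: (u0 i).2.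
exists (row_of p.+1 y); apply: coeffs_inj => I.
rewrite coeffs_koszul_map; apply/mpolyP => u; rewrite (yE I u isT).
congr (_@__); apply: eq_bigr => i _; rewrite coeffs_row_of; case: eqP => // ne.
rewrite y0 // => j jI; rewrite coeffs_out //; apply: contraPneq ne => <-.
by move=> []; rewrite [LHS](cardsD1 j) jI.
Qed.

Lemma koszul_exact0 (x : 'rV[S]_(koszul_rank m 0)) :
  map_mx (mcoeff 0%MM) x *m koszul_aug = 0 <-> exists y, x = y *m koszul_map 0.
Proof.
have -> : map_mx (mcoeff 0%MM) x *m koszul_aug = ((coeffs x set0)@_0%MM)%:M.
  rewrite koszul_augE; congr (_%:M); have [q <-] := @gen_exists m 0 set0 (cards0 _).
  by rewrite !coeffs_gen mxE.
split=> [/matrixP/(_ 0 0)|[y ->]].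
  rewrite !mxE /= mulr1n => x0; apply: koszul_exact => // J.
  rewrite /koszul_diff big1 // => i iJ.
  by rewrite coeffs_out ?mulr0 ?scaler0 // cardsU1 iJ.
rewrite coeffs_koszul_map mcoeff_koszul_diff big1 ?scalemx0 // => [|i _].
  by apply/matrixP => i j; rewrite !mxE mul0rn.
by rewrite mnm0E mulr0.
Qed.

Lemma koszul_exactS p (x : 'rV[S]_(koszul_rank m p.+1)) :
  x *m koszul_map p = 0 <-> exists y, x = y *m koszul_map p.+1.
Proof.
have c0 J : coeffs (0 : 'rV[S]_(koszul_rank m p)) J = 0.
  by rewrite /coeffs; case: insubP => // *; rewrite mxE.
split=> [x0|[y ->]].
  apply: koszul_exact => [|J]; first by rewrite coeffs_out ?mcoeff0 // cards0.
  by rewrite -coeffs_koszul_map x0 c0.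
apply: coeffs_inj => J; rewrite c0 coeffs_koszul_map -[RHS](koszul_diff_sq (coeffs y) J).
by apply: eq_bigr => i _; rewrite coeffs_koszul_map.
Qed.

Lemma koszul_aug_surj : exists x, x *m koszul_aug = 1%:M.
Proof. by exists (row_of 0 (fun=> 1)); rewrite koszul_augE coeffs_row_of cards0. Qed.

Definition koszul_resolution : graded_resolution k m :=
  @GradedResolution k m (koszul_rank m) (fun p _ => p) koszul_map koszul_aug
    koszul_map_homog (fun q ne => False_ind _ (ne erefl)) koszul_aug_surj
    koszul_exact0 koszul_exactS.

End Resolution.

(** * Tor of the face ring in square-free multidegrees *)

Section FaceRingMembership.
Variables (k : idomainType) (m : nat) (K : simplicial_complex m).
Local Notation S := {mpoly k[m]}.
Local Notation phi := (@to_face_ring k m K).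
Implicit Types (I J : {set 'I_m}).

Lemma prod_indicator I : \prod_(i in I) 'X_i = 'X_[indicator I] :> S.
Proof.
rewrite mprodXE; congr 'X_[_]; apply/mnmP => j.
rewrite indicatorE mnm_sumE; have [jI|jI] := boolP (j \in I).
  rewrite (bigD1 j) //= mnm1E eqxx big1 ?addn0 // => i /andP[_ ij].
  by rewrite mnm1E (negPf ij).
by rewrite big1 // => i iI; rewrite mnm1E; case: eqP => // ij; rewrite ij (negPf jI) in iI.
Qed.

Lemma indicator_le I (u : 'X_{1..m}) : (indicator I <= u)%MM = (I \subset msupport u).
Proof.
apply/mnm_lepP/fintype.subsetP => [le i iI|le i].
  by rewrite inE; have := le i; rewrite indicatorE iI lt0n.
by rewrite indicatorE; case: (boolP (i \in I)) => // /le; rewrite inE lt0n.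
Qed.

(** The Stanley--Reisner ideal is spanned by the monomials whose support is not
    a face. *)
Lemma to_face_ring_eq0 (p : S) :
  phi p = 0 <-> forall u, msupport u \in simplices K -> p@_u = 0.
Proof.
have -> : (phi p = 0) <-> (p \in sr_ideal K).
  have e : phi 0 = 0 by rewrite raddf0.
  rewrite -e /to_face_ring -{2}[p]subr0 Quotient.idealrBE.
  by split=> /eqP.
split=> [/asboolP[q ->] u uK|p0].
  rewrite raddf_sum big1 // => I IK /=; rewrite prod_indicator.
  have nIu : ~~ (indicator I <= u)%MM.
    by rewrite indicator_le; apply: contra IK => /simplices_closed; apply.
  rewrite (mpolyE (q I)) mulr_suml raddf_sum big1 //= => v _.
  rewrite -scalerAl mcoeffZ -mpolyXD mcoeffX; case: eqP => [e|]; last by rewrite mulr0.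
  by rewrite -e lem_addl in nIu.
apply/asboolP; exists (fun I =>
  \sum_(u <- msupp p | msupport u == I) p@_u *: 'X_[u - indicator I]).
rewrite (eq_bigr (fun I => \sum_(u <- msupp p | msupport u == I) p@_u *: 'X_[u])).
rewrite (exchange_big_dep predT) //= {1}(mpolyE p) big_seq [RHS]big_seq.
apply: eq_bigr => u up.
have uK : msupport u \notin simplices K.
  by apply: contraTN up => /p0 e; rewrite mcoeff_msupp e eqxx.
rewrite (bigD1 (msupport u)) /= ?uK ?eqxx // big1 ?addr0 // => I /andP[/andP[_ /eqP->]].
  by rewrite eqxx.
move=> I _; rewrite mulr_suml; apply: eq_bigr => u /eqP uI.
by rewrite -scalerAl prod_indicator -mpolyXD submK // indicator_le uI.
Qed.

Lemma to_face_ring_surj (a : face_ring k K) : exists p, a = phi p.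
Proof. by exists (repr a); rewrite /to_face_ring reprK. Qed.

Lemma map_to_face_ring_eq0 p (y : 'rV[S]_(koszul_rank m p)) :
  map_mx phi y = 0 <->
  forall I u, msupport u \in simplices K -> (coeffs y I)@_u = 0.
Proof.
split=> [/matrixP e I u uK|e].
  have [/gen_exists[q <-]|ne] := eqVneq #|I| p; last by rewrite coeffs_out ?mcoeff0.
  rewrite coeffs_gen; have := e 0 q; rewrite !mxE => /to_face_ring_eq0; exact.
apply/matrixP => i q; rewrite !mxE ord1; apply/to_face_ring_eq0 => u uK.
by rewrite -coeffs_gen e.
Qed.

Lemma map_to_face_ring_surj p (x : 'rV[face_ring k K]_p) :
  exists y : 'rV[S]_p, x = map_mx phi y.
Proof.
have /choice[y yE] : forall q, exists y, x 0 q = phi y.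
  by move=> q; apply: to_face_ring_surj.
by exists (\row_q y q); apply/rowP => q; rewrite !mxE.
Qed.

End FaceRingMembership.

Section Squarefree.
Variables (k : idomainType) (m : nat) (K : simplicial_complex m) (j : nat).
Local Notation S := {mpoly k[m]}.
Local Notation phi := (@to_face_ring k m K).
Local Notation G := (koszul_resolution k m).
Implicit Types (I J : {set 'I_m}) (P Q : {set 'I_m} * {set 'I_m}).

(** The pair (J, I) stands for the monomial of [J :\: I] at the exterior
    generator of I, a generator of square-free multidegree J of the Koszul
    complex of the face ring. *)
Definition sq_basis p : {set {set 'I_m} * {set 'I_m}} :=
  [set P : {set 'I_m} * {set 'I_m} | [&& #|P.1| == j, P.2 \subset P.1, #|P.2| == p &
               P.1 :\: P.2 \in simplices K]].
(** This is [sq_basis p.-1] for positive p and empty for [p = 0], where the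
    Koszul differential ends. *)
Definition sq_prev_basis p : {set {set 'I_m} * {set 'I_m}} :=
  [set P : {set 'I_m} * {set 'I_m} | [&& #|P.1| == j, P.2 \subset P.1, #|P.2|.+1 == p &
               P.1 :\: P.2 \in simplices K]].

Definition sq_diff (R : comNzRingType) P Q : R :=
  if P.1 == Q.1 then
    \sum_(i | (i \notin Q.2) && (i |: Q.2 == P.2)) koszul_sign i Q.2
  else 0.

Lemma sq_prev_basisS p : sq_prev_basis p.+1 = sq_basis p.
Proof. by apply/setP => P; rewrite !inE. Qed.

Definition sq_coeff (x : {set 'I_m} -> S) P : k :=
  (x P.2)@_(indicator (P.1 :\: P.2)).

(** The square-free part of a Koszul chain; [sq_lift] is a section. *)
Definition sq_row p (y : 'rV[S]_(koszul_rank m p)) : 'rV[k]_#|sq_basis p| :=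
  \row_a sq_coeff (coeffs y) (enum_val a).

Definition sq_lift p (v : 'rV[k]_#|sq_basis p|) : 'rV[S]_(koszul_rank m p) :=
  row_of p (fun I => \sum_(a | (enum_val a).2 == I)
    v 0 a *: 'X_[indicator ((enum_val a).1 :\: I)]).

Lemma indicator_subU I i : i \in I -> (indicator I - U_(i))%MM = indicator (I :\ i).
Proof.
move=> iI; apply/mnmP => l; rewrite mnmBE !indicatorE mnm1E !inE [i == l]eq_sym.
by case: eqP => [->|_]; rewrite ?iI ?subn0.
Qed.

Lemma indicator_inj : injective (@indicator m).
Proof.
move=> I J /mnmP e; apply/setP => i; have := e i; rewrite !indicatorE.
by case: (i \in I); case: (i \in J).
Qed.

Lemma sq_row_diff p (y : 'rV[S]_(koszul_rank m p.+1)) :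
  sq_row (y *m koszul_map k m p) =
  sq_row y *m blk (@sq_diff k) (sq_basis p.+1) (sq_basis p).
Proof.
apply/rowP => a; rewrite !mxE /sq_coeff coeffs_koszul_map mcoeff_koszul_diff.
under [RHS]eq_bigr do rewrite !mxE.
rewrite -(big_enum_val (fun P => (coeffs y P.2)@_(indicator (P.1 :\: P.2)) *
  sq_diff k P (enum_val a))) /=.
have := enum_valP a; move: (enum_val a) => [J I]; rewrite inE /=.
case/and4P=> Jj IJ Ip JK.
rewrite (bigID (fun P => P.1 == J)) /= [X in _ + X]big1 ?addr0; last first.
  by move=> P /andP[_ /negPf e]; rewrite /sq_diff e mulr0.
under [RHS]eq_bigr => P /andP[_ /eqP e].
  rewrite /sq_diff e eqxx mulr_sumr.
  over.
rewrite (exchange_big_dep (fun i => i \notin I)) /=; last by move=> P i _ /andP[].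
apply: eq_bigr => i iI.
rewrite (eq_bigl (fun P => (P == (J, i |: I)) && (i \in J))); last first.
  move=> [J' I'] /=; rewrite inE iI /= -pair_eqE /=.
  case: (eqVneq J' J) => [->|]; last by rewrite !andbF.
  rewrite andbT [i |: I == I']eq_sym; case: (eqVneq I' (i |: I)) => [->|]; last by rewrite !andbF.
  rewrite andbT Jj cardsU1 iI add1n eqSS Ip subUset sub1set IJ andbT /=.
  rewrite andb_idr // => iJ; apply: simplices_closed JK.
  by rewrite setDS // subsetUr.
rewrite indicatorE inE iI /=; case: (boolP (i \in J)) => iJ /=; last first.
  by rewrite mulr0 big_pred0 // => P; rewrite andbF.
rewrite (eq_bigl (pred1 (J, i |: I))) => [|P]; last by rewrite andbT.
rewrite big_pred1_eq /= mulrC indicator_subU ?inE ?iI //.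
by rewrite setDDl setUC.
Qed.

Lemma sq_row_eq0 p (y : 'rV[S]_(koszul_rank m p)) : map_mx phi y = 0 -> sq_row y = 0.
Proof.
move/map_to_face_ring_eq0 => e; apply/rowP => a; rewrite !mxE /sq_coeff e //.
have -> : msupport (indicator ((enum_val a).1 :\: (enum_val a).2)) =
    (enum_val a).1 :\: (enum_val a).2.
  by apply/setP => i; rewrite inE indicatorE eqb0 negbK.
by have := enum_valP a; rewrite inE => /and4P[].
Qed.

Lemma enum_basisP p (a : 'I_#|sq_basis p|) :
  [/\ #|(enum_val a).1| = j, (enum_val a).2 \subset (enum_val a).1,
      #|(enum_val a).2| = p & (enum_val a).1 :\: (enum_val a).2 \in simplices K].
Proof. by have := enum_valP a; rewrite inE => /and4P[/eqP ? ? /eqP ? ?]. Qed.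

Lemma coeff_sq_lift p (v : 'rV[k]_#|sq_basis p|) I u :
  (coeffs (sq_lift v) I)@_u =
  \sum_(a | ((enum_val a).2 == I) && (indicator ((enum_val a).1 :\: I) == u)) v 0 a.
Proof.
rewrite coeffs_row_of big_mkcondr /=; case: eqP => [_|ne].
  rewrite raddf_sum; apply: eq_bigr => a _ /=; rewrite mcoeffZ mcoeffX.
  by case: eqP; rewrite ?mulr1 ?mulr0.
rewrite mcoeff0 big1 // => a /eqP aI; case: ne; rewrite -aI.
by case: (enum_basisP a).
Qed.

Lemma sq_rowK p (v : 'rV[k]_#|sq_basis p|) : sq_row (sq_lift v) = v.
Proof.
apply/rowP => a; rewrite !mxE /sq_coeff coeff_sq_lift.
rewrite (big_pred1 a) // => b; apply/andP/eqP => [[/eqP e2 /eqP e]|->]; last first.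
  by rewrite !eqxx.
apply: enum_val_inj; move: e; rewrite -e2 => /indicator_inj e.
have [_ sa _ _] := enum_basisP a; have [_ sb _ _] := enum_basisP b.
rewrite -e2 in sa; rewrite [LHS]surjective_pairing [RHS]surjective_pairing e2.
congr (_, _); rewrite -[RHS](setID _ (enum_val b).2) (setIidPr sa).
by rewrite -[LHS](setID _ (enum_val b).2) (setIidPr sb) e.
Qed.

Definition row_homog p (y : 'rV[S]_(koszul_rank m p)) :=
  forall q, shifted_homog p j (y 0 q).

Lemma row_homog_coeff p (y : 'rV[S]_(koszul_rank m p)) I u : row_homog y ->
  (coeffs y I)@_u != 0 -> #|I| = p /\ (mdeg u + p)%N = j.
Proof.
move=> hy; have [/gen_exists[q <-]|ne] := eqVneq #|I| p; last first.
  by rewrite coeffs_out // mcoeff0 eqxx.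
rewrite coeffs_gen card_gen -mcoeff_msupp => uy; split=> //.
have := hy q; rewrite /shifted_homog; case: ifP => [pj /dhomogP/(_ u uy)/= ->|_ /eqP e].
  by rewrite subnK.
by rewrite e msupp0 in uy.
Qed.

Lemma row_homog_lift p (v : 'rV[k]_#|sq_basis p|) : row_homog (sq_lift v).
Proof.
move=> q; rewrite mxE; apply: (big_ind (fun f => shifted_homog p j f)).
- exact: shifted_homog0.
- by move=> f g; apply: shifted_homogD.
move=> a; have := enum_basisP a; move: (v 0 a) (enum_val a) => c [J I] /=.
case=> Jj sI Ip _ /eqP <-; have pj : (p <= j)%N by rewrite -Jj -Ip subset_leq_card.
rewrite /shifted_homog pj; apply: dhomogZ; rewrite dhomogX /=.
rewrite -Jj -Ip -{2}(setIidPr sI) -cardsD mdegE -sum1_card [X in _ == X]big_mkcond.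
by apply/eqP; apply: eq_bigr => i _; rewrite indicatorE; case: (_ \in _).
Qed.

Definition squarefree (u : 'X_{1..m}) := [forall i, (u i <= 1)%N].

Lemma lift_squarefree p (v : 'rV[k]_#|sq_basis p|) I u :
  ~~ squarefree (u + indicator I)%MM -> (coeffs (sq_lift v) I)@_u = 0.
Proof.
rewrite coeff_sq_lift => nsq; rewrite big1 // => a /andP[/eqP aI /eqP au].
case/negP: nsq; apply/forallP => i; rewrite -au mnmDE !indicatorE inE.
by case: (i \in I); rewrite /= ?leq_b1 // addn0 leq_b1.
Qed.

Lemma diff_squarefree p (y : 'rV[S]_(koszul_rank m p.+1)) :
  (forall I u, ~~ squarefree (u + indicator I)%MM -> (coeffs y I)@_u = 0) ->
  forall I u, ~~ squarefree (u + indicator I)%MM -> (coeffs (y *m koszul_map k m p) I)@_u = 0.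
Proof.
move=> hy I u nsq; rewrite coeffs_koszul_map mcoeff_koszul_diff big1 // => i iI.
case: ifP => [ui|_]; last by rewrite mulr0.
rewrite hy ?mulr0 //; congr (~~ squarefree _): nsq; apply/mnmP => l.
rewrite !mnmDE mnmBE !indicatorE mnm1E !inE [i == l]eq_sym.
case: eqP => [->|_] /=; last by rewrite subn0.
by rewrite (negPf iI) addn0 subnK.
Qed.

(** A monomial of square-free multidegree supported on a face is one of the
    elements of [sq_basis]. *)
Lemma squarefree_vanish p (y : 'rV[S]_(koszul_rank m p)) : row_homog y ->
  sq_row y = 0 -> forall I u, msupport u \in simplices K ->
  squarefree (u + indicator I)%MM -> (coeffs y I)@_u = 0.
Proof.
move=> hy y0 I u uK /forallP sq; apply/eqP; apply: contraT => nz.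
have [Ip uj] := row_homog_coeff hy nz.
pose J := I :|: msupport u.
have dis : [disjoint I & msupport u].
  apply/pred0P => i /=; apply/negbTE/negP => /andP[iI]; rewrite inE => ui.
  by have := sq i; rewrite mnmDE indicatorE iI addn1; case: (u i) ui.
have JI : J :\: I = msupport u.
  by rewrite setDUl setDv set0U; apply/setDidPl; rewrite disjoint_sym.
have uE : u = indicator (msupport u).
  apply/mnmP => i; rewrite indicatorE inE; have := sq i; rewrite mnmDE.
  by case: (u i) => [|[|t]] //; rewrite !addSn.
have uc : #|msupport u| = mdeg u.
  rewrite [in RHS]uE mdegE -sum1_card [LHS]big_mkcond.
  by apply: eq_bigr => i _; rewrite indicatorE; case: (_ \in _).
have JB : (J, I) \in sq_basis p.
  rewrite inE /= JI uK subsetUl Ip eqxx !andbT cardsU disjoint_setI0 // cards0 subn0.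
  by rewrite Ip uc addnC uj.
have /rowP/(_ (enum_rank_in JB (J, I))) := y0.
rewrite !mxE /sq_coeff enum_rankK_in //= JI -uE => e.
by rewrite e eqxx in nz.
Qed.

Lemma sq_lift_cycle p (v : 'rV[k]_#|sq_basis p.+1|) :
  v *m blk (@sq_diff k) (sq_basis p.+1) (sq_basis p) = 0 ->
  map_mx phi (sq_lift v *m koszul_map k m p) = 0.
Proof.
move=> v0; apply/map_to_face_ring_eq0 => I u uK.
have [sq|nsq] := boolP (squarefree (u + indicator I)%MM); last first.
  by apply: diff_squarefree nsq => *; apply: lift_squarefree.
apply: (squarefree_vanish _ _ uK sq); last by rewrite sq_row_diff sq_rowK.
have := @homog_mxM k m 1 _ _ (fun=> j) (fun=> p.+1) (fun=> p) (sq_lift v) (koszul_map k m p).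
move=> H q; apply: H => [i q'|q' l]; last exact: koszul_map_homog.
by rewrite ord1; apply: row_homog_lift.
Qed.

(** A cycle whose square-free part vanishes is a boundary. The pivot is a
    variable of exponent at least 2 in the multidegree; it still divides the
    monomial once a factor is removed, so the support does not change. *)
Lemma koszul_boundary p (y : 'rV[S]_(koszul_rank m p)) : row_homog y ->
  sq_row y = 0 -> (forall J u, msupport u \in simplices K ->
    (koszul_diff (coeffs y) J)@_u = 0) ->
  exists w, map_mx phi y = map_mx phi (w *m koszul_map k m p).
Proof.
move=> hy y0 yc; pose pivot (u : 'X_{1..m}) := [pick i | 1 < u i]%N.
have [||J u|w w0 wE] := @koszul_toggle k m (fun I => I \in simplices K) pivot (coeffs y).
- move=> I u i; rewrite /pivot; case: pickP => // l ul [<-] lI.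
  move: ul; rewrite mnmDE indicatorE (negPf lI) addn0 => ul; split; first exact: ltnW.
  suff -> : msupport (u - U_(l))%MM = msupport u by [].
  apply/setP => t; rewrite !inE mnmBE mnm1E.
  have [<-|_] := eqVneq l t; last by rewrite subn0.
  by rewrite -!lt0n subn_gt0 ul (ltnW ul).
- move=> I u; rewrite /pivot; case: pickP => // no _ uK.
  apply: squarefree_vanish => //; apply/forallP => i.
  by rewrite leqNgt; apply/negbT/no.
- exact: yc.
exists (row_of p.+1 w); apply/subr0_eq; rewrite -raddfB /=.
apply/map_to_face_ring_eq0 => I u uK.
have -> : coeffs (y - row_of p.+1 w *m koszul_map k m p) I =
    coeffs y I - coeffs (row_of p.+1 w *m koszul_map k m p) I.
  by rewrite /coeffs; case: insubP => [t _ _|_]; rewrite ?mxE ?subr0.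
rewrite mcoeffB (wE _ _ uK) coeffs_koszul_map; apply/eqP; rewrite subr_eq0; apply/eqP.
congr (_@__); apply: eq_bigr => i _; rewrite coeffs_row_of; case: eqP => // ne.
rewrite w0 // => l lI; rewrite coeffs_out //; apply: contraPneq ne => <-.
by move=> []; rewrite [LHS](cardsD1 l) lI.
Qed.

Lemma koszul_cycle p (y : 'rV[S]_(koszul_rank m p)) :
  @tor_cycle k m K G p (map_mx phi y) <->
  forall J u, msupport u \in simplices K -> (koszul_diff (coeffs y) J)@_u = 0.
Proof.
case: p y => [|p] y /=.
  split=> // _ J u _; rewrite /koszul_diff big1 ?mcoeff0 // => i iJ.
  by rewrite coeffs_out ?mulr0 ?scaler0 // cardsU1 iJ.
rewrite -map_mxM map_to_face_ring_eq0.
by split=> e J u uK; have := e J u uK; rewrite coeffs_koszul_map.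
Qed.

Lemma sq_row_linear p s (c : 'I_s -> k) (y : 'I_s -> 'rV[S]_(koszul_rank m p)) :
  sq_row (\sum_t (c t)%:MP *: y t) = \sum_t c t *: sq_row (y t).
Proof.
apply/rowP => a; rewrite !mxE /sq_coeff summxE.
have [q qE] := gen_exists (let: And4 _ _ e _ := enum_basisP a in e).
rewrite -qE coeffs_gen summxE raddf_sum; apply: eq_bigr => t _.
by rewrite !mxE /sq_coeff -qE coeffs_gen /= mcoeffCM.
Qed.

Lemma sq_rowB p (y z : 'rV[S]_(koszul_rank m p)) : sq_row (y - z) = sq_row y - sq_row z.
Proof.
apply/rowP => a; rewrite !mxE /sq_coeff.
have [q <-] := gen_exists (let: And4 _ _ e _ := enum_basisP a in e).
by rewrite !coeffs_gen !mxE mcoeffB.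
Qed.

Lemma row_homogD p (y z : 'rV[S]_(koszul_rank m p)) :
  row_homog y -> row_homog z -> row_homog (y + z).
Proof. by move=> hy hz q; rewrite mxE; apply: shifted_homogD. Qed.

Lemma row_homogZ p c (y : 'rV[S]_(koszul_rank m p)) :
  row_homog y -> row_homog (c%:MP *: y).
Proof.
move=> hy q; rewrite mxE; have := hy q; rewrite /shifted_homog.
by case: ifP => _; [rewrite mul_mpolyC; apply: dhomogZ|move=> /eqP->; rewrite mulr0].
Qed.

Lemma row_homog_sum p s (c : 'I_s -> k) (y : 'I_s -> 'rV[S]_(koszul_rank m p)) :
  (forall t, row_homog (y t)) -> row_homog (\sum_t (c t)%:MP *: y t).
Proof.
move=> hy; apply: (big_ind (@row_homog p)) => [q|y1 y2|t _].
- by rewrite mxE; apply: shifted_homog0.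
- exact: row_homogD.
- exact: row_homogZ.
Qed.

Lemma row_homog_diff p (y : 'rV[S]_(koszul_rank m p.+1)) :
  row_homog y -> row_homog (y *m koszul_map k m p).
Proof.
move=> hy q.
have H := @homog_mxM k m 1 _ _ (fun=> j) (fun=> p.+1) (fun=> p) y (koszul_map k m p).
by apply: H => [i q'|q' l]; [rewrite ord1; apply: hy|apply: koszul_map_homog].
Qed.

Lemma sum_mx_rows (R : comNzRingType) s n (c : 'I_s -> R) (Z : 'M[R]_(s, n)) :
  (\row_t c t) *m Z = \sum_t c t *: row t Z.
Proof. by rewrite mulmx_sum_row; apply: eq_bigr => t _; rewrite mxE. Qed.

Lemma map_face_ring_sum p s (c : 'I_s -> k) (y : 'I_s -> 'rV[S]_p) :
  \sum_t phi (c t)%:MP *: map_mx phi (y t) = map_mx phi (\sum_t (c t)%:MP *: y t).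
Proof. by rewrite raddf_sum; apply: eq_bigr => t _; rewrite /= map_mxZ. Qed.

Lemma row_homogB p (y z : 'rV[S]_(koszul_rank m p)) :
  row_homog y -> row_homog z -> row_homog (y - z).
Proof.
move=> hy hz; have -> : - z = (-1)%:MP *: z by rewrite rmorphN1 scaleN1r.
by apply: row_homogD => //; apply: row_homogZ.
Qed.

Lemma tor_cycle_sum p s (c : 'I_s -> face_ring k K) (z : 'I_s -> 'rV_(res_rank G p)) :
  (forall t, @tor_cycle k m K G p (z t)) -> @tor_cycle k m K G p (\sum_t c t *: z t).
Proof.
case: p z => [|p] z //= zP; rewrite mulmx_suml big1 // => t _.
by rewrite -scalemxAl zP scaler0.
Qed.

Lemma tor_cycle_sub_boundary p (z : 'rV[face_ring k K]_(koszul_rank m p))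
    (w : 'rV[S]_(koszul_rank m p.+1)) :
  @tor_cycle k m K G p z ->
  @tor_cycle k m K G p (z - map_mx phi (w *m koszul_map k m p)).
Proof.
case: p z w => [|p] z w //= zP; rewrite mulmxBl zP -map_mxM -mulmxA.
by rewrite (res_diff_sq G p) mulmx0 map_mx0 subrr.
Qed.

Lemma mul_sq_diff_prev p s (Z : 'M[k]_(s, #|sq_basis p.+1|)) :
  Z *m blk (@sq_diff k) (sq_basis p.+1) (sq_prev_basis p.+1) = 0 <->
  Z *m blk (@sq_diff k) (sq_basis p.+1) (sq_basis p) = 0.
Proof. by move: (sq_prev_basis _) (sq_prev_basisS p) => B ->. Qed.

(** The square-free part and its section induce inverse maps on Tor in degree
    j, by [koszul_boundary], which leaves matrices over k. *)
Lemma tor_independent_koszul p s :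
  tor_independent K G p j s <->
  exists Z : 'M[k]_(s, #|sq_basis p|),
    Z *m blk (@sq_diff k) (sq_basis p) (sq_prev_basis p) = 0 /\
    forall u : 'rV_s, (exists y, u *m Z =
      y *m blk (@sq_diff k) (sq_basis p.+1) (sq_basis p)) -> u = 0.
Proof.
split=> [[z zP zI]|[Z [Z0 ZI]]].
  have /choice[y yP] : forall t, exists y : 'rV[S]_(koszul_rank m p),
      row_homog y /\ z t = map_mx phi y.
    by move=> t; have [_ [y hy zy]] := zP t; exists y.
  have hy t := (yP t).1; have zy t := (yP t).2.
  exists (\matrix_t sq_row (y t)); split.
    apply/row_matrixP => t; rewrite row_mul rowK row0.
    have := (zP t).1; rewrite zy; case: (p) (y t) => [|p'] y' /=.
      move=> _; apply/rowP => a; have := enum_valP a.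
      by rewrite inE => /and4P[_ _].
    by rewrite -map_mxM => /sq_row_eq0; rewrite sq_row_diff => /mul_sq_diff_prev.
  move=> u [v uv]; apply/rowP => t; rewrite mxE.
  apply: (zI (fun t => u 0 t)).
  pose w := \sum_t (u 0 t)%:MP *: y t.
  have -> : \sum_t phi (u 0 t)%:MP *: z t = map_mx phi w.
    by rewrite -map_face_ring_sum; apply: eq_bigr => t' _; rewrite zy.
  have hw : row_homog w by apply: row_homog_sum.
  have wc : @tor_cycle k m K G p (map_mx phi w).
    rewrite /w -map_face_ring_sum; apply: tor_cycle_sum => t'.
    by rewrite -zy; exact: (zP t').1.
  have [|||w' w'E] := @koszul_boundary p (w - sq_lift v *m koszul_map k m p).
  - by apply: row_homogB => //; apply/row_homog_diff/row_homog_lift.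
  - rewrite sq_rowB sq_row_diff sq_rowK -uv sq_row_linear mulmx_sum_row.
    by apply/eqP; rewrite subr_eq0; apply/eqP/eq_bigr => t' _; rewrite rowK.
  - by apply/koszul_cycle; rewrite raddfB; apply: tor_cycle_sub_boundary.
  exists (map_mx phi (sq_lift v + w')); rewrite -map_mxM mulmxDl raddfD /= -w'E.
  by rewrite raddfB /= addrC subrK.
exists (fun t => map_mx phi (sq_lift (row t Z))) => [t|c [w wE]].
  split; last by exists (sq_lift (row t Z)) => //; apply: row_homog_lift.
  case: (p) Z Z0 {ZI} => [|p'] Z //= /mul_sq_diff_prev Z0.
  by rewrite -map_mxM; apply: sq_lift_cycle; rewrite -row_mul Z0 row0.
have [w' w'E] := map_to_face_ring_surj w.
move=> t; suff /rowP/(_ t) : \row_t c t = 0 by rewrite !mxE.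
apply: ZI; exists (sq_row w').
rewrite sum_mx_rows -sq_row_diff; apply/eqP; rewrite -subr_eq0; apply/eqP.
have <- : sq_row (\sum_t (c t)%:MP *: sq_lift (row t Z)) = \sum_t c t *: row t Z.
  by rewrite sq_row_linear; apply: eq_bigr => t' _; rewrite sq_rowK.
rewrite -sq_rowB; apply: sq_row_eq0.
by rewrite raddfB /= -map_face_ring_sum wE w'E -map_mxM subrr.
Qed.

End Squarefree.

(** * Ranks of homology over a domain *)

Section ClearDenominators.
Local Open Scope quotient_scope.
Variable R : idomainType.
Local Notation F := {fraction R}.
Local Notation toF := (@FracField.tofrac R).

Lemma frac_denominator (a : F) : exists d n, d != 0 /\ toF d * a = toF n.
Proof.
elim/quotW: a => x; exists \d_x, \n_x.
split; first exact: denom_ratioP.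
unlock FracField.tofrac; rewrite -[LHS]FracField.pi_mul; apply/eqmodP.
rewrite /= FracField.equivfE /FracField.mulf.
rewrite !numden_Ratio ?mulf_neq0 ?oner_eq0 ?denom_ratioP //.
by rewrite !mul1r mulr1 mulrC.
Qed.

Lemma frac_mx_denominator p q (A : 'M[F]_(p, q)) :
  exists d (B : 'M[R]_(p, q)), d != 0 /\ toF d *: A = map_mx toF B.
Proof.
have /choice[d /choice[b db]] : forall ij : 'I_p * 'I_q, exists d n,
    d != 0 /\ toF d * A ij.1 ij.2 = toF n.
  by move=> ij; apply: frac_denominator.
pose e ij := \prod_(l | l != ij) d l.
exists (\prod_ij d ij), (\matrix_(i, j) (e (i, j) * b (i, j))); split.
  by apply/prodf_neq0 => ij _; exact: (db ij).1.
apply/matrixP => i j; rewrite !mxE (bigD1 (i, j)) //= -/(e _) !rmorphM /=.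
by rewrite mulrAC (db (i, j)).2 mulrC.
Qed.

Lemma map_frac_inj p q : injective (map_mx toF : 'M_(p, q) -> 'M_(p, q)).
Proof.
move=> A B /matrixP e; apply/matrixP => i j; have := e i j; rewrite !mxE => /eqP.
by rewrite tofrac_eq => /eqP.
Qed.

(** Over the fraction field the right-hand side is the dimension of the
    homology. Clearing denominators turns independent cycles over the field
    into such cycles over R, and a nontrivial relation over the field into one
    over R. *)
Lemma homology_rank b n c s (M : 'M[R]_(b, n)) (N : 'M[R]_(n, c)) :
  M *m N = 0 ->
  (exists Z : 'M[R]_(s, n), Z *m N = 0 /\
     forall u : 'rV_s, (exists y, u *m Z = y *m M) -> u = 0) <->
  (s <= n - \rank (map_mx toF N) - \rank (map_mx toF M))%N.
Proof.
move=> MN0; set NF := map_mx toF N; set MF := map_mx toF M.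
have MNF : MF *m NF = 0 by rewrite -map_mxM MN0 map_mx0.
split=> [[Z [ZN Zind]]|].
  set ZF := map_mx toF Z.
  have ZNF : ZF *m NF = 0 by rewrite -map_mxM ZN map_mx0.
  have Zind' (u : 'rV[F]_s) : (u *m ZF <= MF)%MS -> u = 0.
    case/submxP=> y uy; have [d [B [d0 dB]]] := frac_mx_denominator (row_mx u y).
    have : toF d *: row_mx u y = map_mx toF (row_mx (lsubmx B) (rsubmx B)).
      by rewrite hsubmxK.
    rewrite scale_row_mx map_row_mx => /eq_row_mx[du dy].
    have u0 : lsubmx B = 0.
      apply: Zind; exists (rsubmx B); apply: map_frac_inj.
      by rewrite !map_mxM -du -dy -!scalemxAl uy.
    apply/eqP; have /eqP := du; rewrite u0 map_mx0 scaler_eq0.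
    by rewrite tofrac_eq0 (negPf d0).
  have Zfree : row_free ZF.
    by apply: inj_row_free => v v0; apply: Zind'; rewrite v0 sub0mx.
  have ZM : (ZF :&: MF)%MS = 0.
    apply/eqP; rewrite -submx0; apply/row_subP => i.
    have /submxP[u uE] : (row i (ZF :&: MF)%MS <= ZF)%MS.
      exact: submx_trans (row_sub _ _) (capmxSl _ _).
    have : (row i (ZF :&: MF)%MS <= MF)%MS.
      exact: submx_trans (row_sub _ _) (capmxSr _ _).
    by rewrite uE => /Zind'->; rewrite mul0mx sub0mx.
  have : (ZF + MF <= kermx NF)%MS by rewrite addsmx_sub; apply/andP; split; apply/sub_kermxP.
  move/mxrankS; rewrite mxrank_disjoint_sum // mxrank_ker (eqP Zfree) => le.
  by rewrite leq_subRL ?(leq_trans _ le) ?leq_addl // addnC.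
move=> sle; pose W := (kermx NF :\: MF)%MS.
have rW : \rank W = (n - \rank NF - \rank MF)%N.
  have := mxrank_cap_compl (kermx NF) MF; rewrite -/W mxrank_ker => <-.
  suff -> : \rank (kermx NF :&: MF)%MS = \rank MF by rewrite addKn.
  by apply: eqmx_rank; apply/eqmxP/capmx_idPr/sub_kermxP.
pose Z0 : 'M[F]_(s, n) := pid_mx s *m row_base W.
have Zfree : row_free Z0.
  by rewrite /row_free mxrankMfree ?row_base_free // rank_pid_mx // rW.
have Z0W : (Z0 <= W)%MS by rewrite (submx_trans (submxMl _ _)) ?eq_row_base.
have [d [Z [d0 dZ]]] := frac_mx_denominator Z0.
exists Z; split=> [|u [y uy]].
  apply: map_frac_inj; rewrite map_mxM -dZ -scalemxAl map_mx0.
  suff -> : Z0 *m map_mx toF N = 0 by rewrite scaler0.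
  by apply/sub_kermxP; apply: submx_trans Z0W (diffmxSl _ _).
have uZ0 : map_mx toF u *m Z0 = 0.
  apply/eqP; rewrite -submx0 -(capmx_diff (kermx NF) MF) sub_capmx.
  rewrite (submx_trans (submxMl _ _) Z0W) /=.
  have := congr1 (map_mx toF) uy; rewrite !map_mxM -dZ -scalemxAr.
  move/(congr1 (fun X => (toF d)^-1 *: X)).
  rewrite scalerA mulVf ?tofrac_eq0 // scale1r => ->.
  by rewrite scalemx_sub ?submxMl.
apply: map_frac_inj; rewrite map_mx0; apply: (row_free_inj Zfree).
by rewrite uZ0 mul0mx.
Qed.

End ClearDenominators.

(** * Hochster's formula *)

Section Slices.
Variable F : fieldType.

(** One inequality is [rank_split_ge]; for the other one the matrix is the sum
    of two matrices whose ranks are at most those on the right. *)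
Lemma rank_blk_union (E E' : finType) (f : E -> E' -> F) (A B : {set E}) (A' B' : {set E'}) :
  [disjoint A & B] -> [disjoint A' & B'] ->
  {in A & B', forall x y, f x y = 0} -> {in B & A', forall x y, f x y = 0} ->
  \rank (blk f (A :|: B) (A' :|: B')) = (\rank (blk f A A') + \rank (blk f B B'))%N.
Proof.
move=> dAB dAB' fAB fBA; apply/eqP; rewrite eqn_leq; apply/andP; split; last first.
  exact: (rank_split_ge (erefl _) (erefl _)).
pose part (C : {set E}) (C' : {set E'}) := blk (@kron F E) (A :|: B) C *m blk f C C' *m
  blk (@kron F E') C' (A' :|: B').
have partE (C : {set E}) (C' : {set E'}) :
    part C C' = blk (fun x y => if (x \in C) && (y \in C') then f x y else 0)
                  (A :|: B) (A' :|: B').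
  rewrite /part !blk_mul; apply: blk_eq => x y xX yY.
  have [yC|yC] /= := boolP (y \in C'); last first.
    rewrite andbF big1 // => z zC; rewrite /kron; case: eqP => [zy|_]; last by rewrite mulr0.
    by rewrite zy (negPf yC) in zC.
  under eq_bigr do rewrite /kron eq_sym mulrC.
  rewrite sum_pick // andbT; case: (boolP (x \in C)) => xC; first by rewrite sum_pick.
  rewrite big1 // => z zC; rewrite /kron; case: eqP => [zx|_]; last by rewrite mul0r.
  by rewrite -zx (negPf xC) in zC.
have -> : blk f (A :|: B) (A' :|: B') = part A A' + part B B'.
  rewrite !partE; apply/matrixP => i l; rewrite !mxE.
  have := enum_valP i; have := enum_valP l; move: (enum_val i) (enum_val l) => x y.
  rewrite !inE => /orP[] yy /orP[] xx; rewrite xx yy /=.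
  - by rewrite (disjointFr dAB xx) addr0.
  - by rewrite (disjointFl dAB xx) (disjointFr dAB' yy) /= addr0 fBA.
  - by rewrite (disjointFr dAB xx) (disjointFl dAB' yy) /= addr0 fAB.
  - by rewrite (disjointFl dAB xx) add0r.
apply: leq_trans (mxrank_add _ _) _; apply: leq_add.
  exact: leq_trans (mxrankM_maxl _ _) (mxrankM_maxr _ _).
exact: leq_trans (mxrankM_maxl _ _) (mxrankM_maxr _ _).
Qed.

Lemma rank_blk_slices (E E' L : finType) (f : E -> E' -> F) (a : E -> L) (a' : E' -> L)
    (X : {set E}) (Y : {set E'}) :
  {in X & Y, forall x y, a x != a' y -> f x y = 0} ->
  \rank (blk f X Y) =
  (\sum_l \rank (blk f [set x in X | a x == l] [set y in Y | a' y == l]))%N.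
Proof.
move=> f0.
suff slices (A : {set L}) : \rank (blk f [set x in X | a x \in A] [set y in Y | a' y \in A]) =
    (\sum_(l in A) \rank (blk f [set x in X | a x == l] [set y in Y | a' y == l]))%N.
  have := slices setT; rewrite (eq_bigl predT) => [|l]; last by rewrite inE.
  have -> : [set x in X | a x \in [set: L]] = X by apply/setP => x; rewrite !inE andbT.
  by have -> : [set y in Y | a' y \in [set: L]] = Y by apply/setP => x; rewrite !inE andbT.
have [n] := ubnP #|A|; elim: n A => // n IH A; rewrite ltnS => An.
have [->|[l lA]] := set_0Vmem A.
  rewrite big_set0; apply: rank_blk_le0 => x y; by rewrite !inE andbF.
rewrite (big_setD1 l) //= -IH; last by have := cardsD1 l A; rewrite lA; lia.
have split (T : finType) (Z : {set T}) (b : T -> L) : [set x in Z | b x \in A] =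
    [set x in Z | b x == l] :|: [set x in Z | b x \in A :\ l].
  apply/setP => x; rewrite !inE; case: (x \in Z) => //=.
  by case: eqP => //= ->; rewrite lA.
have dis (T : finType) (Z : {set T}) (b : T -> L) :
    [disjoint [set x in Z | b x == l] & [set x in Z | b x \in A :\ l]].
  apply/pred0P => x /=; rewrite !inE; case: (x \in Z) => //=.
  by case: eqP => //= ->; rewrite eqxx.
rewrite !split rank_blk_union ?dis // => x y; rewrite !inE.
  move=> /andP[xX /eqP xl] /andP[yY /andP[yl _]]; apply: f0 => //.
  by rewrite xl eq_sym.
by move=> /andP[xX /andP[xl _]] /andP[yY /eqP yl]; apply: f0 => //; rewrite yl.
Qed.

End Slices.

Section Hochster.
Variables (m : nat) (K : simplicial_complex m).
Implicit Types (I J t : {set 'I_m}).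

(** The generator (J, I) of [sq_basis] corresponds to the face [J :\: I]. The
    Koszul sign of l with respect to I is the product of the signs with respect
    to J and to [J :\: (l |: I)]. *)
Definition hochster_sign (F : fieldType) J (l : 'I_m) t : F :=
  koszul_sign l J * koszul_sign l t.

Lemma hochster_sign_system (F : fieldType) J : sign_system (@hochster_sign F J).
Proof.
split=> [i t _|i l t il it lt]; first by rewrite mulf_neq0 ?signr_eq0.
rewrite /hochster_sign mulrACA [X in _ + X]mulrACA.
rewrite [koszul_sign l J * _]mulrC -mulrDr koszul_sign_anti ?mulr0 //.
Qed.

Lemma koszul_sign_compl (F : fieldType) J l t : l \notin t -> t \subset J ->
  koszul_sign l (J :\: (l |: t)) = hochster_sign F J l t.
Proof.
move=> lt tJ; rewrite /hochster_sign /koszul_sign.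
pose below (A : {set 'I_m}) := [set i in A | (i < l)%N].
have -> : #|[set i in J :\: (l |: t) | (i < l)%N]| = (#|below J| - #|below t|)%N.
  rewrite -cardsDS; last first.
    by apply/subsetP => i; rewrite !inE => /andP[/(subsetP tJ)->].
  apply: eq_card => i; rewrite !inE; case: (eqVneq i l) => [->|_] /=.
    by rewrite ltnn !andbF.
  by case: (i < l)%N; rewrite ?andbF ?andbT.
have le : (#|below t| <= #|below J|)%N.
  apply/subset_leq_card/subsetP => i; rewrite !inE => /andP[/(subsetP tJ)->] //.
rewrite -/(below J) -/(below t) -{2}(subnK le) exprD -mulrA -expr2 sqrr_sign mulr1 //.
Qed.

(** Removing a generator from I adds a vertex to [J :\: I]. *)
Lemma sq_diff_coboundary (F : fieldType) J I I' : I \subset J -> I' \subset J ->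
  sq_diff F (J, I') (J, I) =
  coboundary (hochster_sign F J) (J :\: I') (J :\: I).
Proof.
move=> IJ I'J; have eqv l : (l \notin I) && (l |: I == I') =
    (l \notin J :\: I') && (J :\: I == l |: (J :\: I')).
  apply/andP/andP => [[lI /eqP I'E]|[lJI /eqP e]].
    have lJ : l \in J by rewrite (subsetP I'J) // -I'E setU11.
    rewrite -I'E !inE eqxx /=; split=> //; apply/eqP/setP => i; rewrite !inE.
    by case: (eqVneq i l) => [->|]; rewrite /= ?lJ ?lI.
  have /setDP[lJ lI] : l \in J :\: I by rewrite e setU11.
  split=> //; apply/eqP/setP => i; rewrite !inE.
  case: (eqVneq i l) => [->|il] /=; first by move: lJI; rewrite !inE lJ andbT negbK => ->.
  have [iJ|iJ] := boolP (i \in J); last first.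
    by rewrite (negPf (contra (subsetP IJ i) iJ)) (negPf (contra (subsetP I'J i) iJ)).
  by move/setP/(_ i): e; rewrite !inE iJ (negPf il) !andbT => /negb_inj.
rewrite /sq_diff /= eqxx /coboundary; apply: eq_big => [l|l]; first exact: eqv.
rewrite eqv => /andP[lJI /eqP e].
rewrite -koszul_sign_compl ?subsetDl // -e setDDr setDv set0U.
by rewrite (setIidPr IJ).
Qed.

Section Betti.
Variables (k : idomainType).
Local Notation F := {fraction k}.
Local Notation toF := (@FracField.tofrac k).
Local Notation sgn := (@hochster_sign F).

Lemma rank_slice J (X Y : {set {set 'I_m} * {set 'I_m}}) (Lx Ly : {set {set 'I_m}}) :
  (forall P, P \in X -> [/\ P.1 = J, P.2 \subset J & J :\: P.2 \in Lx]) ->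
  (forall P, P \in Y -> [/\ P.1 = J, P.2 \subset J & J :\: P.2 \in Ly]) ->
  (forall t, t \in Lx -> t \subset J /\ (J, J :\: t) \in X) ->
  (forall t, t \in Ly -> t \subset J /\ (J, J :\: t) \in Y) ->
  \rank (blk (sq_diff F) X Y) = \rank (blk (coboundary (sgn J)) Lx Ly).
Proof.
move=> hX hY hLx hLy; apply/eqP; rewrite eqn_leq; apply/andP; split.
  apply: (rank_blk_le (p := fun P => J :\: P.2) (p' := fun P => J :\: P.2)).
  - by move=> P /hX[].
  - by move=> P /hY[].
  move=> [J1 I1] [J2 I2] /hX[/= -> s1 _] /hY[/= -> s2 _].
  exact: sq_diff_coboundary.
apply: (rank_blk_le (p := fun t => (J, J :\: t)) (p' := fun t => (J, J :\: t))).
- by move=> t /hLx[].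
- by move=> t /hLy[].
move=> t u /hLx[tJ _] /hLy[uJ _]; rewrite sq_diff_coboundary ?subsetDl //.
by rewrite !setDDr !setDv !set0U (setIidPr tJ) (setIidPr uJ).
Qed.

Lemma map_blk_sq_diff (X Y : {set {set 'I_m} * {set 'I_m}}) :
  map_mx toF (blk (sq_diff k) X Y) = blk (sq_diff F) X Y.
Proof.
apply/matrixP => a b; rewrite !mxE /sq_diff; case: ifP => _; last exact: rmorph0.
rewrite rmorph_sum; apply: eq_bigr => l _.
by rewrite /koszul_sign rmorphXn rmorphN rmorph1.
Qed.

Variables (i j : nat).
Hypothesis ij : (i <= j)%N.
Let q := (j - i)%N.

(** A generator with p exterior factors corresponds to a face with [j - p]
    vertices. *)
Let slice (B : {set {set 'I_m} * {set 'I_m}}) (L : {set {set 'I_m}})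
    (a b : pred nat) J : #|J| = j ->
  (forall P, (P \in B) = [&& #|P.1| == j, P.2 \subset P.1, a #|P.2| &
     P.1 :\: P.2 \in simplices K]) ->
  (forall t, (t \in L) = (t \in restr K J) && b #|t|) ->
  (forall p, (p <= j)%N -> b (j - p)%N = a p) ->
  (forall P, P \in [set P in B | P.1 == J] ->
     [/\ P.1 = J, P.2 \subset J & J :\: P.2 \in L]) /\
  (forall t, t \in L -> t \subset J /\ (J, J :\: t) \in [set P in B | P.1 == J]).
Proof.
move=> Jj BE LE ab; split=> [[J' I]|t].
  rewrite inE BE /= => /andP[/and4P[_ IJ aI JK] /eqP e]; subst J'.
  split=> //; rewrite LE inE JK subsetDl cardsDS // Jj ab //.
  by rewrite -Jj subset_leq_card.
rewrite LE inE => /andP[/andP[tK tJ] bt]; split=> //.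
have tj : (#|t| <= j)%N by rewrite -Jj subset_leq_card.
rewrite inE BE /= Jj !eqxx subsetDl setDDr setDv set0U (setIidPr tJ) tK !andbT.
by rewrite /= cardsDS // Jj -ab ?leq_subr // subKn.
Qed.

Let slice_level J (Jj : #|J| = j) := @slice (sq_basis K j i) (level (restr K J) q)
  (pred1 i) (pred1 q) J Jj (fun P => in_set _ P) (fun t => in_set _ t)
  ltac:(by move=> p pj; rewrite /q /=; lia).

Let slice_prev J (Jj : #|J| = j) := @slice (sq_basis K j i.+1)
  (prev_level (restr K J) q) (pred1 i.+1) [pred p | p.+1 == q] J Jj
  (fun P => in_set _ P) (fun t => in_set _ t)
  ltac:(by move=> p pj; rewrite /q /=; lia).

Let slice_next J (Jj : #|J| = j) := @slice (sq_prev_basis K j i)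
  (level (restr K J) q.+1) [pred p | p.+1 == i] (pred1 q.+1) J Jj
  (fun P => in_set _ P) (fun t => in_set _ t)
  ltac:(by move=> p pj; rewrite /q /=; lia).

Lemma card_sq_basis :
  #|sq_basis K j i| = (\sum_(J : {set 'I_m} | #|J| == j) #|level (restr K J) q|)%N.
Proof.
have setDK (J A : {set 'I_m}) : A \subset J -> J :\: (J :\: A) = A.
  by move=> AJ; rewrite setDDr setDv set0U (setIidPr AJ).
rewrite -sum1_card (partition_big (fun P => P.1) (fun J : {set 'I_m} => #|J| == j)) /=.
  apply: eq_bigr => J /eqP Jj; have [hP ht] := slice_level Jj.
  rewrite sum1dep_card; apply/eqP; rewrite eqn_leq; apply/andP; split.
    rewrite -(@card_in_imset _ _ (fun P : {set 'I_m} * {set 'I_m} => J :\: P.2)) => [|P Q].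
      by apply/subset_leq_card/fintype.subsetP => _ /imsetP[P /hP[_ _ PL] ->].
    move=> /hP[P1 sP _] /hP[Q1 sQ _] e.
    by rewrite [P]surjective_pairing [Q]surjective_pairing P1 Q1 -(setDK _ _ sP) e setDK.
  rewrite -(@card_in_imset _ _ (fun t => (J, J :\: t)) (level (restr K J) q)) => [|t u].
    by apply/subset_leq_card/fintype.subsetP => _ /imsetP[t /ht[_ tX] ->].
  by move=> /ht[tJ _] /ht[uJ _] [] e; rewrite -(setDK _ _ tJ) e setDK.
by move=> P; rewrite inE => /and4P[].
Qed.

Lemma sq_diff_other (X Y : {set {set 'I_m} * {set 'I_m}}) :
  {in X & Y, forall P Q, P.1 != Q.1 -> sq_diff F P Q = 0}.
Proof. by move=> P Q _ _ /negPf e; rewrite /sq_diff e. Qed.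

Lemma rank_out (X Y : {set {set 'I_m} * {set 'I_m}}) J : #|J| != j ->
  (forall P, P \in X -> #|P.1| = j) ->
  \rank (blk (sq_diff F) [set P in X | P.1 == J] Y) = 0%N.
Proof.
move=> Jj hX; apply: rank_blk_le0 => P Q; rewrite inE => /andP[/hX Pj /eqP e].
by rewrite -e Pj eqxx in Jj.
Qed.

Lemma rank_sq_boundary :
  \rank (blk (sq_diff F) (sq_basis K j i.+1) (sq_basis K j i)) =
  (\sum_(J : {set 'I_m} | #|J| == j) coboundary_rank (sgn J) (restr K J) q)%N.
Proof.
rewrite (rank_blk_slices (@sq_diff_other _ _)) [RHS]big_mkcond.
apply: eq_bigr => J _; case: eqP => [Jj|/eqP ne]; last first.
  by apply: rank_out => // P; rewrite inE => /and4P[/eqP].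
have [hP ht] := slice_prev Jj; have [hP' ht'] := slice_level Jj.
exact: rank_slice.
Qed.

Lemma rank_sq_cycle :
  \rank (blk (sq_diff F) (sq_basis K j i) (sq_prev_basis K j i)) =
  (\sum_(J : {set 'I_m} | #|J| == j) coboundary_rank (sgn J) (restr K J) q.+1)%N.
Proof.
rewrite (rank_blk_slices (@sq_diff_other _ _)) [RHS]big_mkcond.
apply: eq_bigr => J _; case: eqP => [Jj|/eqP ne]; last first.
  by apply: rank_out => // P; rewrite inE => /and4P[/eqP].
have [hP ht] := slice_level Jj; have [hP' ht'] := slice_next Jj.
by rewrite coboundary_rankS; exact: rank_slice.
Qed.

End Betti.

Lemma sq_diff_sq (k : idomainType) j p :
  blk (@sq_diff m k) (sq_basis K j p.+1) (sq_basis K j p) *m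
  blk (@sq_diff m k) (sq_basis K j p) (sq_prev_basis K j p) = 0.
Proof.
case: p => [|p].
  apply/matrixP => a b; have := enum_valP b.
  by rewrite inE => /and4P[_ _].
apply/mul_sq_diff_prev/row_matrixP => a; rewrite row0 row_mul -[row a _]mul1mx.
rewrite -[row _ _]mul1mx.
have e (v : 'rV_#|sq_basis K j p.+2|) : v *m blk (@sq_diff m k) (sq_basis K j p.+2) (sq_basis K j p.+1) *m
    blk (@sq_diff m k) (sq_basis K j p.+1) (sq_basis K j p) = 0.
  rewrite -(sq_rowK v) -!sq_row_diff -mulmxA.
  rewrite (res_diff_sq (koszul_resolution k m) p) mulmx0.
  by rewrite -(subrr (0 : 'rV[{mpoly k[m]}]_(koszul_rank m p))) sq_rowB subrr.
by rewrite !mul1mx rowE; apply: e.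
Qed.

(** The matrices of [tor_independent_koszul] are block diagonal with respect to
    J, and the block of J is the coboundary of the full subcomplex on J. *)
Lemma betti_hochster (k : idomainType) i j :
  betti k K i j =
  if (i <= j)%N then total_coh (@hochster_sign {fraction k}) setT K (j - i) j else 0%N.
Proof.
pose M := blk (@sq_diff m k) (sq_basis K j i.+1) (sq_basis K j i).
pose N := blk (@sq_diff m k) (sq_basis K j i) (sq_prev_basis K j i).
have MN : M *m N = 0 by apply: sq_diff_sq.
have bE : betti k K i j = (#|sq_basis K j i| -
   \rank (map_mx (@FracField.tofrac k) N) - \rank (map_mx (@FracField.tofrac k) M))%N.
  apply: (betti_eq (G := koszul_resolution k m)) => s.
  by rewrite tor_independent_koszul (homology_rank s MN).
rewrite {}bE !map_blk_sq_diff; case: leqP => ij; last first.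
  suff : #|sq_basis K j i| = 0%N by lia.
  apply/eqP; rewrite cards_eq0; apply/eqP/setP => -[J I]; rewrite !inE; apply/negbTE/negP => /and4P[/= /eqP Jj].
  by move=> /subset_leq_card le /eqP Ii _; move: le; rewrite Jj Ii leqNgt ij.
have -> : total_coh (@hochster_sign {fraction k}) setT K (j - i) j =
    (\sum_(J : {set 'I_m} | #|J| == j)
      coh (@hochster_sign {fraction k} J) (restr K J) (j - i))%N.
  by apply: eq_bigl => J; rewrite subsetT.
rewrite rank_sq_boundary // rank_sq_cycle //; have := card_sq_basis ij.
have -> : (\sum_(J : {set 'I_m} | #|J| == j) #|level (restr K J) (j - i)| =
  \sum_(J : {set 'I_m} | #|J| == j)
     coh (@hochster_sign {fraction k} J) (restr K J) (j - i) +
  \sum_(J : {set 'I_m} | #|J| == j)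
     coboundary_rank (@hochster_sign {fraction k} J) (restr K J) (j - i) +
  \sum_(J : {set 'I_m} | #|J| == j)
     coboundary_rank (@hochster_sign {fraction k} J) (restr K J) (j - i).+1)%N.
  rewrite -!big_split; apply: eq_bigr => J _ /=; rewrite cohE //.
    exact: hochster_sign_system.
  apply/down_interval_closed/restr_down_closed => t u; exact: simplices_closed.
by lia.
Qed.

End Hochster.

(** * Simple polytopes presented by inequalities *)

Import Order.TTheory Num.Theory.

Section Dot.
Variables (R : realType) (d : nat).
Implicit Types (x y u : 'rV[R]_d) (c : 'cV[R]_d).

Lemma dotDl x y c : dot (x + y) c = dot x c + dot y c.
Proof. by rewrite /dot mulmxDl mxE. Qed.

Lemma dotNl x c : dot (- x) c = - dot x c.
Proof. by rewrite /dot mulNmx mxE. Qed.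

Lemma dotBl x y c : dot (x - y) c = dot x c - dot y c.
Proof. by rewrite dotDl dotNl. Qed.

Lemma dotZl a x c : dot (a *: x) c = a * dot x c.
Proof. by rewrite /dot -scalemxAl mxE. Qed.

Lemma dot0l c : dot 0 c = 0.
Proof. by rewrite /dot mul0mx mxE. Qed.

Lemma dot_suml I (r : seq I) (P : pred I) (f : I -> 'rV[R]_d) c :
  dot (\sum_(i <- r | P i) f i) c = \sum_(i <- r | P i) dot (f i) c.
Proof. by rewrite /dot mulmx_suml summxE. Qed.

Lemma dot_sumr I (r : seq I) (P : pred I) x (f : I -> 'cV[R]_d) :
  dot x (\sum_(i <- r | P i) f i) = \sum_(i <- r | P i) dot x (f i).
Proof. by rewrite /dot mulmx_sumr summxE. Qed.

Definition dotE := (dotDl, dotNl, dotZl, dot0l).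

Lemma uniform_eps (T : finType) (Q : T -> R -> Prop) :
  (forall t, exists2 e, 0 < e & forall s, 0 < s <= e -> Q t s) ->
  exists2 e, 0 < e & forall s, 0 < s <= e -> forall t, Q t s.
Proof.
move=> hQ; suff [e e0 he] : exists2 e, 0 < e &
    forall s, 0 < s <= e -> forall t, t \in enum T -> Q t s.
  by exists e => // s hs t; apply: he; rewrite ?mem_enum.
elim: (enum T) => [|t r [e e0 he]]; first by exists 1.
have [e' e0' he'] := hQ t; exists (Num.min e e'); first by rewrite lt_min e0.
move=> s /andP[s0]; rewrite le_min => /andP[se se'] t'.
rewrite inE => /orP[/eqP->|tr]; first by apply: he'; rewrite s0.
by apply: he => //; rewrite s0.
Qed.

End Dot.

Section Presentation.
Variables (R : realType) (d : nat).
Implicit Types (x y u : 'rV[R]_d) (P : set 'rV[R]_d).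

Definition active (T : finType) (c : T -> 'cV[R]_d) (b : T -> R) x : {set T} :=
  [set t | dot x (c t) == b t].

(** [pres_bounded] states that the recession cone is trivial, [pres_dual] that
    the normals active at a point are linearly independent, that is,
    simplicity, and [pres_tight] that each inequality is attained. *)
Record presentation (T : finType) P (c : T -> 'cV[R]_d) (b : T -> R) : Prop :=
  Presentation {
  pres_mem : forall x, P x <-> forall t, dot x (c t) <= b t;
  pres_bounded : forall u, u != 0 -> exists t, 0 < dot u (c t);
  pres_nonempty : exists x, P x;
  pres_dual : forall x t, P x -> t \in active c b x ->
    exists2 u, dot u (c t) = 1 &
      {in active c b x, forall t', t' != t -> dot u (c t') = 0};
  pres_tight : forall t, exists2 x, P x & t \in active c b x }.

Variables (T : finType) (P : set 'rV[R]_d) (c : T -> 'cV[R]_d) (b : T -> R).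
Hypothesis presP : presentation P c b.
Local Notation act := (active c b).

Lemma activeP x t : reflect (dot x (c t) = b t) (t \in act x).
Proof. by rewrite inE; apply: eqP. Qed.

Lemma pres_le x t : P x -> dot x (c t) <= b t.
Proof. by move/(pres_mem presP). Qed.

Lemma small_step x u : P x -> {in act x, forall t, dot u (c t) <= 0} ->
  exists2 e, 0 < e & forall s, 0 < s <= e ->
    P (x + s *: u) /\ act (x + s *: u) = [set t in act x | dot u (c t) == 0].
Proof.
move=> Px hu; pose Q t s := dot (x + s *: u) (c t) <= b t /\
  (t \in act (x + s *: u)) = (t \in act x) && (dot u (c t) == 0).
have [|e e0 he] := @uniform_eps R T Q; last first.
  exists e => // s /he hs; split; first by apply/(pres_mem presP) => t; case: (hs t).
  by apply/setP => t; rewrite [RHS]inE; case: (hs t).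
move=> t; rewrite /Q; have [tx|tx] := boolP (t \in act x).
  exists 1 => // s /andP[s0 _]; have := hu t tx; move/activeP: tx => tx.
  rewrite inE dotDl dotZl tx -subr_eq0 [_ + _ - _]addrC addKr mulf_eq0 (gt_eqF s0).
  by split=> //; rewrite gerDl; nra.
have slack : 0 < b t - dot x (c t).
  by rewrite subr_gt0 lt_neqAle pres_le // andbT; apply: contra tx; rewrite inE.
have pos : 0 < `|dot u (c t)| + 1 by have := normr_ge0 (dot u (c t)); lra.
exists ((b t - dot x (c t)) / (`|dot u (c t)| + 1)); first by rewrite divr_gt0.
move=> s /andP[s0]; rewrite ler_pdivlMr // => hs.
have lt : dot (x + s *: u) (c t) < b t.
  rewrite dotDl dotZl; have := ler_norm (dot u (c t)); nra.
by split; rewrite ?ltW // inE (lt_eqF lt).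
Qed.

Lemma dual_family x : P x -> exists w : T -> 'rV[R]_d, forall t, t \in act x ->
  dot (w t) (c t) = 1 /\ {in act x, forall t', t' != t -> dot (w t) (c t') = 0}.
Proof.
move=> Px; suff /choice[w wP] : forall t, exists u, t \in act x ->
    dot u (c t) = 1 /\ {in act x, forall t', t' != t -> dot u (c t') = 0}.
  by exists w.
move=> t; have [tx|tx] := boolP (t \in act x); last by exists 0.
by have [u u1 u0] := pres_dual presP Px tx; exists u.
Qed.

Lemma dual_vector x (g : T -> R) : P x ->
  exists u, {in act x, forall t, dot u (c t) = g t}.
Proof.
move=> Px; have [w wP] := dual_family Px.
exists (\sum_(t in act x) g t *: w t) => t tx.
rewrite dot_suml (bigD1 t) //= dotZl (wP t tx).1 mulr1 big1 ?addr0 // => t' /andP[t'x ne].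
by rewrite dotZl (wP t' t'x).2 ?mulr0 // eq_sym.
Qed.

(** By linear independence of the active normals there is a direction that
    keeps A active and strictly relaxes the other inequalities. *)
Lemma face_point x (A : {set T}) : P x -> A \subset act x ->
  exists2 y, P y & act y = A.
Proof.
move=> Px Ax; have [u hu] := dual_vector (fun t => if t \in A then 0 else -1) Px.
have [|e e0 he] := @small_step x u Px.
  by move=> t tx; rewrite hu //; case: ifP => _; lra.
have [Py ay] := he e (introT andP (conj e0 (lexx e))).
exists (x + e *: u) => //; rewrite ay; apply/setP => t; rewrite [LHS]inE.
have [tx|tx] := boolP (t \in act x); last by rewrite (negPf (contra (fintype.subsetP Ax t) tx)).
by rewrite hu //; case: (t \in A); rewrite ?eqxx // oppr_eq0 oner_eq0.
Qed.

(** As the recession cone is trivial, the ray leaves P, and it does so through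
    an inequality that becomes active. *)
Lemma long_step x u : P x -> {in act x, forall t, dot u (c t) <= 0} -> u != 0 ->
  exists2 s, 0 < s & P (x + s *: u) /\ exists2 t, t \in act (x + s *: u) & 0 < dot u (c t).
Proof.
move=> Px hu u0; have [t0 t0u] := pres_bounded presP u0.
pose f t := (b t - dot x (c t)) / dot u (c t).
have [/= t tu tmin] := @arg_minP _ _ _ t0 (fun t => 0 < dot u (c t)) f t0u.
have tx : t \notin act x by apply/negP => /hu; rewrite leNgt tu.
have ft : 0 < f t.
  rewrite divr_gt0 // subr_gt0 lt_neqAle pres_le // andbT.
  by apply: contra tx; rewrite inE.
exists (f t) => //; split; last first.
  by exists t => //; apply/activeP; rewrite dotDl dotZl /f divfK ?gt_eqF //; ring.
apply/(pres_mem presP) => t'; rewrite dotDl dotZl.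
have [t'u|t'u] := ltP 0 (dot u (c t')); last by have := pres_le t' Px; nra.
by have := tmin t' t'u; rewrite [f t']/f ler_pdivlMr //; lra.
Qed.

Definition spanning (A : {set T}) :=
  forall u, {in A, forall t, dot u (c t) = 0} -> u = 0.

(** While the active normals do not span, a line on which they are constant
    leads, in the direction where w does not decrease, to a point with more
    active inequalities. *)
Lemma climb x (w : 'cV[R]_d) : P x -> exists v,
  [/\ P v, act x \subset act v, spanning (act v) & dot x w <= dot v w].
Proof.
have [n] := ubnP (#|T| - #|act x|)%N; elim: n x => // n IH x; rewrite ltnS => xn Px.
have [sp|/existsNP[u /not_implyP[hu /eqP u0]]] := pselect (spanning (act x)).
  by exists x.
wlog wu : u hu u0 / 0 <= dot u w.
  move=> W; have [|wu] := leP 0 (dot u w); first exact: W.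
  apply: (W (- u)); rewrite ?oppr_eq0 // ?dotNl ?oppr_ge0 ?ltW // => t tx.
  by rewrite dotNl hu // oppr0.
have [|s s0 [Py [t ty tu]]] := @long_step x u Px _ u0; first by move=> t /hu->.
have sub : act x \subset act (x + s *: u).
  apply/fintype.subsetP => t' t'x; apply/activeP; rewrite dotDl dotZl hu //.
  by rewrite mulr0 addr0; apply/activeP.
have lt : (#|act x| < #|act (x + s *: u)|)%N.
  apply: proper_card; apply/properP; split=> //; exists t => //.
  by apply/negP => /hu tu0; rewrite tu0 ltxx in tu.
have [|v [Pv sv spv le]] := IH (x + s *: u) _ Py.
  by apply: leq_trans xn; rewrite ltn_sub2l // (leq_trans lt) // max_card.
exists v; split=> //; first exact: fintype.subset_trans sub sv.
by apply: le_trans le; rewrite dotDl dotZl lerDl mulr_ge0 // ltW.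
Qed.

Lemma spanning_inj x v : spanning (act v) -> act v \subset act x -> x = v.
Proof.
move=> sp sub; apply/subr0_eq/sp => t tv; rewrite dotBl.
by move/activeP: (tv) => ->; move/activeP: (fintype.subsetP sub t tv) => ->; rewrite subrr.
Qed.

(** The sum of the active normals is maximal at v only. *)
Lemma spanning_vertex v : P v -> spanning (act v) -> vertex P v.
Proof.
move=> Pv sp; exists (\sum_(t in act v) c t), (\sum_(t in act v) b t); split.
  by move=> x Px; rewrite dot_sumr; apply: ler_sum => t _; apply: pres_le.
apply/seteqP; split=> x /=.
  by move=> ->; split=> //; rewrite dot_sumr; apply: eq_bigr => t /activeP.
case=> Px /eqP; rewrite dot_sumr => e; apply: spanning_inj => //.
apply/fintype.subsetP => t tv; apply/activeP/eqP; rewrite eq_le pres_le //= leNgt.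
apply/negP => lt; move: e; apply/negP; rewrite lt_eqF //.
rewrite (bigD1 t) //= [ltRHS](bigD1 t) //= ltr_leD // ler_sum // => t' _.
exact: pres_le.
Qed.

Lemma vertex_mem v : vertex P v -> P v.
Proof. by case=> w [e [_ /seteqP[/(_ v erefl)[]]]]. Qed.

(** A direction orthogonal to the active normals can be followed both ways
    inside P, so a functional that is maximal at v is constant along it. *)
Lemma vertex_spanning v : vertex P v -> spanning (act v).
Proof.
move=> vv; have Pv := vertex_mem vv; case: vv => w [e [le /seteqP[h1 h2]]] u hu.
have [_ /= vw] := h1 v erefl.
have [|e1 e10 s1] := @small_step v u Pv; first by move=> t /hu->.
have [|e2 e20 s2] := @small_step v (- u) Pv; first by move=> t /hu; rewrite dotNl => ->; rewrite oppr0.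
have [P1 _] := s1 e1 (introT andP (conj e10 (lexx e1))).
have [P2 _] := s2 e2 (introT andP (conj e20 (lexx e2))).
have wu : dot u w = 0.
  have := le _ P1; have := le _ P2; rewrite !dotE vw; nra.
have /h2/= /eqP : (P `&` [set x | dot x w = e])%classic (v + e1 *: u).
  by split=> //=; rewrite !dotE wu mulr0 addr0.
by rewrite -subr_eq0 [_ + _ - _]addrC addKr scaler_eq0 (gt_eqF e10) => /eqP.
Qed.

Lemma card_active x : P x -> (#|act x| <= d)%N.
Proof.
move=> Px; have [w wP] := dual_family Px.
pose W : 'M[R]_(#|act x|, d) := \matrix_i w (enum_val i).
pose C : 'M[R]_(d, #|act x|) := \matrix_(i, j) c (enum_val j) i 0.
have WC : W *m C = 1%:M.
  apply/matrixP => i j; rewrite mxE.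
  have -> : \sum_l W i l * C l j = dot (w (enum_val i)) (c (enum_val j)).
    by rewrite /dot mxE; apply: eq_bigr => l _; rewrite !mxE.
  rewrite mxE; have [<-|ij] := eqVneq i j; first by rewrite (wP _ (enum_valP i)).1.
  by rewrite (wP _ (enum_valP i)).2 ?enum_valP // (inj_eq enum_val_inj) eq_sym.
rewrite -[X in (X <= _)%N](mxrank1 R) -WC.
exact: leq_trans (mxrankM_maxl _ _) (rank_leq_col _).
Qed.

Lemma card_spanning A : spanning A -> (d <= #|A|)%N.
Proof.
move=> sp; pose C : 'M[R]_(d, #|A|) := \matrix_(i, j) c (enum_val j) i 0.
suff /eqP <- : row_free C by exact: rank_leq_col.
apply: inj_row_free => u uC; apply: sp => t tA.
have := congr1 (fun M : 'rV_#|A| => M 0 (enum_rank_in tA t)) uC.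
rewrite !mxE /dot mxE => e; rewrite -[RHS]e; apply: eq_bigr => l _.
by rewrite mxE enum_rankK_in.
Qed.

Lemma card_vertex v : vertex P v -> #|act v| = d.
Proof.
move=> vv; apply/eqP; rewrite eqn_leq (card_active (vertex_mem vv)) /=.
exact: card_spanning (vertex_spanning vv).
Qed.

End Presentation.

(** * The vertex cut *)

Section FaceComplex.
Variables (R : realType) (d : nat) (T : finType).

(** The complex of facets with a common point, before the facets are
    numbered. *)
Definition nerve (P : set 'rV[R]_d) (c : T -> 'cV[R]_d) (b : T -> R) : {set {set T}} :=
  [set J : {set T} | `[< exists2 x, P x & J \subset active c b x >]]%SET.

Lemma nerveP P c b (J : {set T}) :
  reflect (exists2 x, P x & J \subset active c b x) (J \in nerve P c b).
Proof. by rewrite inE; apply: asboolP. Qed.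

Definition image_complex (U : finType) (g : T -> U) (K : {set {set T}}) : {set {set U}} :=
  (fun J : {set T} => g @: J) @: K.

End FaceComplex.

Section Cut.
Variables (R : realType) (d : nat) (T : finType).
Variables (P : set 'rV[R]_d) (c : T -> 'cV[R]_d) (b : T -> R).
Hypothesis presP : presentation P c b.
Hypothesis d2 : (1 < d)%N.
Variables (v : 'rV[R]_d) (h : 'cV[R]_d) (e : R).
Hypotheses (vP : vertex P v) (vh : e < dot v h).
Hypothesis others : forall w, vertex P w -> w <> v -> dot w h < e.
Local Notation act := (active c b).
Let Q := (P `&` [set x | dot x h <= e])%classic.
Let I := act v.
Let Pv : P v := vertex_mem vP.
Let Iv : spanning c I := vertex_spanning presP vP.
Let Id : #|I| = d := card_vertex presP vP.

(** Climbing from x in the direction h leads to a vertex that is not strictly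
    below the hyperplane, hence to v. *)
Lemma cut_active x : P x -> e <= dot x h -> act x \subset I.
Proof.
move=> Px ex; have [w [Pw sw spw le]] := climb presP h Px.
have [wv|wv] := pselect (w = v); first by rewrite /I -wv.
have := others (spanning_vertex presP Pw spw) wv; lra.
Qed.

Lemma cut_active_eq x : I \subset act x -> x = v.
Proof. exact: spanning_inj. Qed.

(** The edge from v that leaves the facet i ends in another vertex y, which
    lies below the hyperplane; the point is where the edge crosses it. *)
Lemma cut_edge i : i \in I -> exists x, [/\ P x, I :\ i \subset act x & dot x h = e].
Proof.
move=> iI; have [u hu] := dual_vector presP (fun t => if t == i then -1 else 0) Pv.
have u0 : u != 0.
  apply/eqP => u0; have := hu i iI; rewrite u0 dot0l eqxx; lra.
have [|s s0 [Py [t ty tu]]] := long_step presP Pv _ u0.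
  by move=> t tI; rewrite hu //; case: eqP => _; lra.
set y := v + s *: u in Py ty.
have sub : I :\ i \subset act y.
  apply/fintype.subsetP => t'; rewrite !inE => /andP[/negPf t'i /eqP t'I].
  by rewrite dotDl dotZl hu ?inE ?t'I // t'i mulr0 addr0.
have sp : spanning c (act y).
  move=> z hz; pose z' := z + dot z (c i) *: u.
  have z'0 : z' = 0.
    apply: Iv => t' t'I; rewrite dotDl dotZl hu //.
    have [->|t'i] := eqVneq t' i; first by ring.
    by rewrite mulr0 addr0 hz // (fintype.subsetP sub) // finset.in_setD1 t'i.
  have : dot z' (c t) = 0 by rewrite z'0 dot0l.
  rewrite dotDl dotZl (hz _ ty) add0r => /eqP.
  rewrite mulf_eq0 (gt_eqF tu) orbF => /eqP zi.
  by move: z'0; rewrite /z' zi scale0r addr0.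
have yv : y <> v.
  move=> yv; have /eqP : s *: u = 0 by rewrite -[RHS](subrr v) -{1}yv /y addrC addKr.
  by rewrite scaler_eq0 (negPf u0) (gt_eqF s0).
have yh := others (spanning_vertex presP Py sp) yv.
(* The crossing point divides the segment from v to y in the ratio that makes h
   equal to e. *)
pose l := (dot v h - e) / (dot v h - dot y h).
have den : 0 < dot v h - dot y h by rewrite subr_gt0 (lt_trans yh vh).
have ldef : l * (dot v h - dot y h) = dot v h - e by rewrite /l divfK ?gt_eqF.
have l0 : 0 <= l by rewrite divr_ge0 ?(ltW den) // subr_ge0 ltW.
have l1 : l <= 1 by rewrite ler_pdivrMr // mul1r lerD2l lerN2 ltW.
pose x := (1 - l) *: v + l *: y.
have xE w : dot x w = (1 - l) * dot v w + l * dot y w by rewrite !dotE.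
exists x; split.
- apply/(pres_mem presP) => t'; rewrite xE.
  have := pres_le presP t' Pv; have := pres_le presP t' Py; nra.
- apply/fintype.subsetP => t' t'I; apply/activeP; rewrite xE.
  have /activeP-> := fintype.subsetP sub t' t'I.
  have /activeP-> : t' \in act v by move: t'I; rewrite inE => /andP[].
  by ring.
- rewrite xE mulrBl mul1r -addrA [- _ + _]addrC -mulrBr -opprB mulrN ldef.
  by rewrite opprB addrC subrK.
Qed.

Lemma cut_proper (J : {set T}) : J \proper I ->
  exists x, [/\ P x, J \subset act x & dot x h = e].
Proof.
case/properP=> JI [i iI iJ]; have [x [Px xI xh]] := cut_edge iI.
exists x; split=> //; apply: fintype.subset_trans xI.
apply/fintype.subsetP => t tJ; rewrite finset.in_setD1 (fintype.subsetP JI) // andbT.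
by apply: contraNneq iJ => <-.
Qed.

Definition cut_normal (o : option T) := if o is Some t then c t else h.
Definition cut_bound (o : option T) := if o is Some t then b t else e.

(** On the new facet, the active old inequalities are all active at v, so the
    direction from x to v is dual to h. Since [1 < d], each old facet through v
    contains an edge at v, which the hyperplane crosses: the facet is not cut
    off. *)
Lemma cut_presentation : presentation Q cut_normal cut_bound.
Proof.
have I0 : (0 < #|I|)%N by rewrite Id; apply: ltnW.
split.
- move=> x; split=> [[/(pres_mem presP) hx xe] [t|]|hx]; [exact: hx|exact: xe|].
  by split; [apply/(pres_mem presP) => t; exact: (hx (Some t))|exact: (hx None)].
- by move=> u /(pres_bounded presP)[t tu]; exists (Some t).
- have [i iI] := card_gt0P I0; have [x [Px _ xh]] := cut_edge iI.
  by exists x; split=> //=; rewrite xh.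
- move=> x o [Px /= xe] ox; have [lt|ge] := ltP (dot x h) e.
    case: o ox => [t|] /activeP/= ox; last by rewrite ox ltxx in lt.
    have [u u1 u0] := pres_dual presP Px (introT (activeP _ _ _ _) ox).
    exists u => // -[t'|] /activeP/= t'x ne; last by rewrite t'x ltxx in lt.
    by apply: u0; [exact/activeP|apply: contraNneq ne => ->].
  have xI := cut_active Px ge; pose y := (dot v h - e)^-1 *: (v - x).
  have xh : dot x h = e by lra.
  have yh : dot y h = 1.
    by rewrite dotZl dotBl xh mulVf // subr_eq0 gt_eqF.
  have yt t : t \in act x -> dot y (c t) = 0.
    move=> tx; rewrite dotZl dotBl; have /activeP-> := tx.
    by have /activeP-> := fintype.subsetP xI t tx; rewrite subrr mulr0.
  case: o ox => [t|] /activeP/= ox; last first.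
    exists y => // -[t|] //= /activeP/= tx _; apply: yt; exact/activeP.
  have [u u1 u0] := pres_dual presP Px (introT (activeP _ _ _ _) ox).
  exists (u - dot u h *: y); first by rewrite dotBl dotZl yt ?mulr0 ?subr0 //; apply/activeP.
  move=> [t'|] /activeP/= t'x ne; rewrite dotBl dotZl.
    rewrite yt ?mulr0 ?subr0; last exact/activeP.
    by apply: u0; [exact/activeP|apply: contraNneq ne => ->].
  by rewrite yh mulr1 subrr.
case=> [t|].
  have [tI|tI] := boolP (t \in I); last first.
    have [x Px tx] := pres_tight presP t; exists x; last first.
      by rewrite inE /=; move/activeP: tx => ->.
    split=> //=; rewrite leNgt; apply: contra tI => /ltW/(cut_active Px)/fintype.subsetP.
    exact.
  have : (0 < #|I :\ t|)%N.
    have e1 := cardsD1 t I; rewrite tI Id add1n in e1.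
    by move: d2; rewrite [X in (1 < X)%N]e1 ltnS.
  case/card_gt0P => i; rewrite !inE => /andP[it /eqP iI].
  have [|x [Px xI xh]] := @cut_edge i; first exact/activeP.
  exists x; first by split=> //=; rewrite xh.
  have : t \in act x by apply: (fintype.subsetP xI); rewrite finset.in_setD1 eq_sym it.
  by move/activeP => tx; rewrite inE /= tx.
have [i iI] := card_gt0P I0; have [x [Px _ xh]] := cut_edge iI.
by exists x; [split=> //=; rewrite xh|exact/activeP].
Qed.

Lemma active_cut x (J : {set T}) :
  (Some @: J \subset active cut_normal cut_bound x) = (J \subset act x).
Proof.
apply/fintype.subsetP/fintype.subsetP => sub t => [tJ|/imsetP[t' t'J ->]].
  by have := sub (Some t) (imset_f _ tJ); rewrite !inE.
by have := sub t' t'J; rewrite !inE.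
Qed.

(** The set I disappears because v is the only point where it is active. Its
    proper subsets are active somewhere on the hyperplane, and the other
    simplices only at points below it. *)
Lemma nerve_cut_old (J : {set T}) :
  (Some @: J \in nerve Q cut_normal cut_bound) = (J \in nerve P c b) && (J != I).
Proof.
apply/nerveP/andP => [[x [Px /= xe]]|[/nerveP[x Px Jx] JI]].
  rewrite active_cut => Jx; split; first by apply/nerveP; exists x.
  apply: contraTneq xe => JI; rewrite (cut_active_eq (x := x)) -?JI //.
  by rewrite -ltNge.
have [sJI|sJI] := boolP (J \subset I).
  have [|y [Py Jy yh]] := @cut_proper J; first by rewrite finset.properEneq JI.
  by exists y; [split=> //=; rewrite yh|rewrite active_cut].
exists x; last by rewrite active_cut.
split=> //=; rewrite leNgt; apply: contra sJI => /ltW/(cut_active Px).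
exact: fintype.subset_trans.
Qed.

Lemma nerve_cut_new (J : {set T}) :
  (None |: Some @: J \in nerve Q cut_normal cut_bound) = (J \proper I).
Proof.
have activeN x : (None \in active cut_normal cut_bound x) = (dot x h == e).
  by rewrite inE.
apply/nerveP/idP => [[x [Px xe]]|/cut_proper[x [Px Jx xh]]].
  rewrite finset.subUset finset.sub1set active_cut activeN => /andP[/eqP xh Jx].
  have xI : act x \subset I by apply: cut_active => //; rewrite xh.
  apply: sub_proper_trans Jx _; rewrite finset.properEneq xI andbT.
  apply: contraTneq vh => aI; rewrite -(cut_active_eq (x := x)) ?aI //.
  by rewrite xh ltxx.
exists x; first by split=> //=; rewrite xh.
by rewrite finset.subUset finset.sub1set active_cut activeN xh eqxx.
Qed.

Lemma stellar_cut (r : nat) (n : 'I_r -> nat) (U : finType) (g : option T -> U) :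
  injective g -> (\sum_i n i)%N = d ->
  stellar_at n ((g \o Some) @: [set: T]%SET) (image_complex (g \o Some) (nerve P c b))
    (g @: [set: option T]%SET) (image_complex g (nerve Q cut_normal cut_bound)).
Proof.
move=> gI nd; have gsI : injective (g \o Some) by apply: inj_comp gI _ => x y [].
have split (J : {set option T}) : J = Some @: [set t | Some t \in J] \/
    J = None |: Some @: [set t | Some t \in J].
  have [NJ|NJ] := boolP (None \in J); [right|left]; apply/finset.setP => -[t|].
  - by rewrite !inE /= mem_imset ?inE // => x y [].
  - by rewrite !inE NJ.
  - by rewrite mem_imset ?inE // => x y [].
  - by rewrite (negPf NJ); apply/esym/negbTE/imsetP => -[].
exists ((g \o Some) @: I), (g None); split.
- by apply/imset_f/nerveP; exists v.
- by rewrite card_imset // Id nd.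
- by apply/imsetP => -[t _ /gI].
- apply/finset.setP => u; rewrite !inE; apply/imsetP/orP => [[[t|] _ ->]|[/eqP->|/imsetP[t _ ->]]].
  + by right; apply/imsetP; exists t.
  + by left.
  + by exists None.
  + by exists (Some t).
apply/finset.setP => s; rewrite !inE; apply/imsetP/orP => [[J JQ ->]|[/andP[sI /imsetP[J JP sE]]|]].
- case: (split J) => JE; move: JQ; rewrite JE.
    rewrite nerve_cut_old => /andP[JP JI]; left; rewrite -imset_comp.
    by rewrite (inj_eq (imset_inj gsI)) JI imset_f.
  rewrite nerve_cut_new => JI; right; rewrite imsetU1 -imset_comp finset.setU11 finset.setU1K.
    by apply: imset_proper => // x y _ _; apply: gsI.
  by apply/imsetP => -[t _ /gI].
- exists (Some @: J); last by rewrite sE -imset_comp.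
  by rewrite nerve_cut_old JP; apply: contraNneq sI => <-; rewrite sE.
case/andP=> ws sI; pose J := [set t | g (Some t) \in s :\ g None].
have JE : (g \o Some) @: J = s :\ g None.
  apply/finset.setP => u; apply/imsetP/idP => [[t]|us]; first by rewrite inE => ? ->.
  have /imsetP[t _ ut] := fintype.subsetP (proper_sub sI) u us.
  by exists t; rewrite // finset.in_set -[g _]/((g \o Some) t) -ut.
exists (None |: Some @: J); last by rewrite imsetU1 -imset_comp JE finset.setD1K.
rewrite nerve_cut_new; move: sI; rewrite -JE.
rewrite !properE => /andP[s1 s2]; apply/andP; split.
  by apply/fintype.subsetP => t tJ; have := fintype.subsetP s1 _ (imset_f (g \o Some) tJ); rewrite mem_imset.
by apply: contra s2; apply: imsetS.
Qed.

End Cut.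

(** * Products of simplices *)

Section Simplex.
Variables (R : realType) (d : nat).

Lemma barycenter_row s (w : 'I_s -> R) (p : 'I_s -> 'rV[R]_d) :
  (\row_j w j) *m (\matrix_j row_mx (1%:M : 'M[R]_1) (p j)) =
  row_mx (\sum_j w j)%:M (\sum_j w j *: p j).
Proof.
apply/rowP => l; case: (splitP l) => l' e.
  have -> : l = lshift d l' by apply: val_inj.
  rewrite row_mxEl !mxE !ord1 mulr1n; apply: eq_bigr => j _.
  by rewrite mxE [X in _ * X]mxE row_mxEl mxE mulr1.
have -> : l = rshift 1 l' by apply: val_inj.
rewrite row_mxEr mxE summxE; apply: eq_bigr => j _.
by rewrite mxE [X in _ * X]mxE row_mxEr mxE.
Qed.

(** The affine functions [b j - dot x (c j)] are the barycentric coordinates,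
    obtained by inverting the matrix of the vertices. *)
Lemma simplex_coordinates (S : set 'rV[R]_d) : simplex S ->
  exists (c : 'I_d.+1 -> 'cV[R]_d) (b : 'I_d.+1 -> R) (p : 'I_d.+1 -> 'rV[R]_d),
  [/\ forall x, S x <-> forall j, dot x (c j) <= b j,
      forall j l, b j - dot (p l) (c j) = (l == j)%:R,
      forall x, \sum_j (b j - dot x (c j)) = 1
    & forall u, (forall j, dot u (c j) = 0) -> u = 0].
Proof.
case=> p free ->; pose M : 'M[R]_(1 + d) := \matrix_(j < d.+1) row_mx (1%:M : 'M[R]_1) (p j).
have uM : M \in unitmx by rewrite -row_free_unit.
pose B := invmx M.
pose c j : 'cV[R]_d := - col j (dsubmx B).
pose b (j : 'I_d.+1) : R := usubmx B 0 j.
have dotE' x j : dot x (c j) = - (x *m dsubmx B) 0 j.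
  rewrite /dot /c mulmxN mxE; congr (- _); rewrite [LHS]mxE [RHS]mxE.
  by apply: eq_bigr => l _; rewrite [col _ _ _ _]mxE.
have coordE x j : b j - dot x (c j) = (row_mx 1%:M x *m B) 0 j.
  by rewrite -[B in RHS]vsubmxK mul_row_col mul1mx mxE dotE' opprK.
have coord x : \row_j (b j - dot x (c j)) = row_mx 1%:M x *m B.
  by apply/rowP => j; rewrite mxE coordE.
have bary x : row_mx (\sum_j (b j - dot x (c j)))%:M
    (\sum_j (b j - dot x (c j)) *: p j) = row_mx 1%:M x.
  by rewrite -barycenter_row coord mulmxKV.
have sum1 x : \sum_j (b j - dot x (c j)) = 1.
  have [/matrixP/(_ 0 0)] := eq_row_mx (bary x).
  by rewrite !mxE /= !mulr1n.
exists c, b, p; split=> //.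
- move=> x; split=> [[w [w0 w1 xE]] j|hx].
    rewrite -subr_ge0 coordE.
    have -> : row_mx 1%:M x = (\row_j w j) *m M by rewrite barycenter_row w1 -xE.
    by rewrite mulmxK // mxE.
  exists (fun j => b j - dot x (c j)); split=> [j||]; [by rewrite subr_ge0|exact: sum1|].
  by have [_ e] := eq_row_mx (bary x); rewrite -[LHS]e.
- move=> j l; have pM : row_mx 1%:M (p l) = row l M by rewrite rowK.
  by rewrite coordE pM -row_mul mulmxV // !mxE.
move=> u hu; have [_ e] := eq_row_mx (bary u); have [_ e0] := eq_row_mx (bary 0).
by rewrite -[LHS]e -[RHS]e0; apply: eq_bigr => j _; rewrite hu dot0l.
Qed.
End Simplex.

Section ProductOfSimplices.
Variables (R : realType) (r : nat) (n : 'I_r -> nat).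
Hypothesis n_gt0 : forall i, (0 < n i)%N.
Variable S : forall i, set 'rV[R]_(n i).
Arguments S : clear implicits.
Hypothesis hS : forall i, simplex (S i).
Let d := (\sum_i n i)%N.

Definition facet_index := {i : 'I_r & 'I_(n i).+1}.

Definition embed_normal i (w : 'cV[R]_(n i)) : 'cV[R]_(\sum_i n i) :=
  submxrow (1%:M : 'M_(\sum_i n i)) i *m w.

Lemma dot_embed i x w : dot x (embed_normal w) = dot (submxrow x i) w.
Proof. by rewrite /dot mulmxA mul_submxrow mulmx1. Qed.

(** At any point some barycentric coordinate of each factor is positive, so the
    active inequalities never contain a whole block. Conversely, leaving out
    one inequality per block gives a set that is active at a product of
    vertices. These points also provide the dual vectors: changing one of the
    vertices changes exactly two coordinates. *)
Lemma product_presentation : exists (c : facet_index -> 'cV[R]_(\sum_i n i)) (b : facet_index -> R),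
  presentation (polytope_prod S) c b /\
  forall (U : finType) (g : facet_index -> U), injective g ->
    block_join n (g @: [set: facet_index]%SET)
      (image_complex g (nerve (polytope_prod S) c b)).
Proof.
have coords i := cid (simplex_coordinates (hS i)).
pose c0 i := sval (coords i).
have coords1 i : {b & {p | [/\ forall x, S i x <-> forall j, dot x (c0 i j) <= b j,
      forall j l, b j - dot (p l) (c0 i j) = (l == j)%:R,
      forall x, \sum_j (b j - dot x (c0 i j)) = 1
    & forall u, (forall j, dot u (c0 i j) = 0) -> u = 0]}}.
  by have [b hb] := cid (svalP (coords i)); exists b; apply: cid.
pose b0 i := projT1 (coords1 i).
pose p0 i := sval (projT2 (coords1 i)).
have c0P i : [/\ forall x, S i x <-> forall j, dot x (c0 i j) <= b0 i j,
      forall j l, b0 i j - dot (p0 i l) (c0 i j) = (l == j)%:R,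
      forall x, \sum_j (b0 i j - dot x (c0 i j)) = 1
    & forall u, (forall j, dot u (c0 i j) = 0) -> u = 0].
  exact: (svalP (projT2 (coords1 i))).
pose c (t : facet_index) := embed_normal (c0 (tag t) (tagged t)).
pose b (t : facet_index) := b0 (tag t) (tagged t).
have memS i x : S i x <-> forall j, dot x (c0 i j) <= b0 i j by case: (c0P i).
have vert i j l : dot (p0 i l) (c0 i j) = b0 i j - (l == j)%:R.
  by case: (c0P i) => _ /(_ j l) <- _ _; rewrite opprB addrC subrK.
have sum1 i x : \sum_j (b0 i j - dot x (c0 i j)) = 1 by case: (c0P i).
have sep i u : (forall j, dot u (c0 i j) = 0) -> u = 0 by case: (c0P i) => _ _ _; apply.
pose pt (f : forall i, 'I_(n i).+1) : 'rV[R]_(\sum_i n i) := \mxrow_i p0 i (f i).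
have dotc x i j : dot x (c (existT _ i j)) = dot (submxrow x i) (c0 i j).
  exact: dot_embed.
have dotpt f i j : dot (pt f) (c (existT _ i j)) = b0 i j - (f i == j)%:R.
  by rewrite dotc mxrowK vert.
have memP x : polytope_prod S x <-> forall t, dot x (c t) <= b t.
  split=> [Sx [i j]|hx i].
    by rewrite dotc; have /memS := Sx i; apply.
  by apply/memS => j; rewrite -dotc; apply: (hx (existT _ i j)).
have ptP f : polytope_prod S (pt f).
  by apply/memP => -[i j]; rewrite dotpt /b /= gerBl ler0n.
have inactive x i : exists j, existT _ i j \notin active c b x.
  apply/not_existsP => all; have := sum1 i (submxrow x i).
  rewrite big1 => [/eqP|j _]; first by rewrite eq_sym oner_eq0.
  have := all j; move/negP; rewrite negbK => /activeP; rewrite dotc => ->.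
  by rewrite /b /= subrr.
exists c, b; split.
  split=> //.
  - move=> u u0; apply/not_existsP => all; case/eqP: u0.
    rewrite -(submxrowK u) -[RHS](submxrowK 0); apply/eq_mxrowP => i.
    rewrite submxrow0; apply: sep => j.
    have le0 l : 0 <= - dot (submxrow u i) (c0 i l).
      by rewrite oppr_ge0 -dotc leNgt; apply/negP/all.
    have := sum1 i (submxrow u i); rewrite -(sum1 i 0) => /eqP.
    rewrite -subr_eq0 -sumrB => /eqP.
    under eq_bigr do rewrite dot0l subr0 addrAC subrr add0r.
    move/psumr_eq0P => /(_ (fun l _ => le0 l) j isT) /eqP.
    by rewrite oppr_eq0 => /eqP.
  - by exists (pt (fun=> ord0)).
  - move=> x [i j] Px jx.
    pose f i' := sval (cid (inactive x i')).
    have fP i' : existT _ i' (f i') \notin active c b x := svalP (cid (inactive x i')).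
    (* The vertices [pt f] and [pt f'] are told apart only by the inequality j
       and by [f i], which is inactive at x. *)
    pose f' := dfwith f (i := i) j.
    have dotu i' j' : dot (pt f - pt f') (c (existT _ i' j')) = (f' i' == j')%:R - (f i' == j')%:R.
      by rewrite dotBl !dotpt; ring.
    exists (pt f - pt f').
      rewrite dotu /f' dfwith_in eqxx; have := fP i.
      by case: eqP => [->|_ _]; rewrite ?jx // subr0.
    move=> [i' j'] t'x ne; rewrite dotu.
    have fj : (f i' == j') = false by apply: contraNF (fP i') => /eqP->.
    rewrite fj subr0 /f'; have [ii'|ii'] := eqVneq i i'; last by rewrite dfwith_out ?fj.
    subst i'; rewrite dfwith_in; suff -> : (j == j') = false by [].
    by apply: contraNF ne => /eqP->.
  - move=> [i j].
    have [l lj] : exists l : 'I_(n i).+1, l != j.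
      have [->|j0] := eqVneq j ord0; last by exists ord0; rewrite eq_sym.
      by exists ord_max; rewrite -val_eqE /= -lt0n.
    exists (pt (@dfwith _ (fun i => 'I_(n i).+1 : Type) (fun=> ord0) i l)) => //; apply/activeP.
    by rewrite dotpt dfwith_in (negPf lj) subr0.
move=> U g gI; pose B i : {set U} := [set g (existT _ i j) | j : 'I_(n i).+1]%SET.
have BP i u : reflect (exists j, u = g (existT _ i j)) (u \in B i).
  by apply: (iffP imsetP) => [[j _ ->]|[j ->]]; exists j.
exists B; split.
- move=> i; rewrite card_imset ?card_ord // => j j' /gI /eqP.
  by rewrite eq_Tagged => /eqP.
- move=> i i' ii'; apply/pred0P => u /=; apply/negbTE/negP => /andP[/BP[j ->] /BP[j']].
  by move=> /gI /(congr1 (@tag _ _)) /= e; rewrite e eqxx in ii'.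
- apply/finset.setP => u; apply/imsetP/bigcupP => [[[i j] _ ->]|[i _ /BP[j ->]]].
    by exists i => //; apply/BP; exists j.
  by exists (existT _ i j).
apply/finset.setP => s; rewrite [RHS]inE; apply/imsetP/andP => [[J /nerveP[x Px Jx] ->]|].
  split; first by apply: imsetS; apply: finset.subsetT.
  apply/forallP => i; have [j jx] := inactive x i.
  apply: contra jx => /fintype.subsetP/(_ (g (existT _ i j))).
  have -> : g (existT _ i j) \in B i by apply/BP; exists j.
  by move=> /(_ isT) /imsetP[t tJ /gI ->]; apply: (fintype.subsetP Jx).
case=> sV /forallP sB.
have out i : exists j, g (existT _ i j) \notin s.
  have /fintype.subsetPn[u /BP[j ->] us] := sB i; by exists j.
pose f i := sval (cid (out i)).
have fP i : g (existT _ i (f i)) \notin s := svalP (cid (out i)).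
pose J := [set t | g t \in s]%SET; exists J.
  apply/nerveP; exists (pt f) => //; apply/fintype.subsetP => -[i j].
  rewrite inE => js; apply/activeP; rewrite dotpt.
  by rewrite (_ : f i == j = false) ?subr0 //; apply: contraNF (fP i) => /eqP->.
apply/finset.setP => u; apply/idP/imsetP => [us|[t]]; last by rewrite inE => ? ->.
have /imsetP[t _ ut] := fintype.subsetP sV u us.
by exists t; rewrite // inE -ut.
Qed.
End ProductOfSimplices.

(** * Facets and dimension *)

Section AffineIndependence.
Variables (R : realType) (d : nat).
Implicit Types (F P : set 'rV[R]_d).

Lemma affinely_independentP s (p : 'I_s -> 'rV[R]_d) :
  affinely_independent p <->
  forall w : 'I_s -> R, \sum_i w i = 0 -> \sum_i w i *: p i = 0 -> forall i, w i = 0.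
Proof.
split=> [free w w1 wp i|indep].
  have /rowP/(_ i) : \row_i w i = 0.
    apply: (row_free_inj free); rewrite mul0mx barycenter_row w1 wp.
    by rewrite -row_mx0; congr row_mx; apply/matrixP => a b; rewrite !mxE mul0rn.
  by rewrite !mxE.
apply: inj_row_free => v hv; pose w i := v 0 i.
have vE : v = \row_i w i by apply/rowP => i; rewrite mxE.
move: hv; rewrite vE barycenter_row -row_mx0 => /eq_row_mx[/matrixP/(_ 0 0)].
rewrite !mxE mulr1n => w1 wp; apply/rowP => i; rewrite !mxE.
exact: indep.
Qed.

Lemma affinely_independent_comp s s' (p : 'I_s -> 'rV[R]_d) (f : 'I_s' -> 'I_s) :
  injective f -> affinely_independent p -> affinely_independent (p \o f).
Proof.
move=> fI /affinely_independentP ip; apply/affinely_independentP => w w1 wp i.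
pose w' j := \sum_(l | f l == j) w l.
have w'f l : w' (f l) = w l.
  by rewrite /w' (big_pred1 l) // => l'; rewrite (inj_eq fI).
rewrite -w'f; apply: ip.
  by rewrite -[RHS]w1 [RHS](partition_big f xpredT) //=.
rewrite -[RHS]wp [RHS](partition_big f xpredT) //=; apply: eq_bigr => j _.
by rewrite scaler_suml; apply: eq_bigr => l /eqP ->.
Qed.

Lemma affinely_independent_card s (p : 'I_s -> 'rV[R]_d) :
  affinely_independent p -> (s <= d.+1)%N.
Proof. by move=> /eqP <-; exact: rank_leq_col. Qed.

(** The matrix of the points is killed by the nonzero column [(- b, c)]. *)
Lemma affinely_independent_hyperplane s (p : 'I_s -> 'rV[R]_d) c b :
  c != 0 -> (forall i, dot (p i) c = b) -> affinely_independent p -> (s <= d)%N.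
Proof.
move=> c0 pc; set M := \matrix_(i < s) row_mx (1%:M : 'M[R]_1) (p i) => /eqP <-.
pose k : 'cV[R]_(1 + d) := col_mx (- b)%:M c.
have Mk : M *m k = 0.
  apply/row_matrixP => i; rewrite row_mul rowK mul_row_col mul1mx row0.
  apply/matrixP => a e; rewrite !ord1 [LHS]mxE [X in X + _]mxE mulr1n -[X in _ + X]/(dot _ _).
  by rewrite pc addNr mxE.
have k0 : \rank k = 1%N.
  apply/eqP; rewrite eqn_leq rank_leq_col lt0n mxrank_eq0 -col_mx0.
  by apply: contra c0 => /eqP/eq_col_mx[_ ->].
by have := mulmx0_rank_max Mk; rewrite k0 addn1 ltnS.
Qed.

Lemma has_dim_uniq F e e' : has_dim F e -> has_dim F e' -> e = e'.
Proof.
suff lt e1 e2 : has_dim F e1 -> has_dim F e2 -> (e1 <= e2)%N.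
  by move=> h h'; apply/eqP; rewrite eqn_leq !lt.
move=> [[p ip pF] _] [_ no]; rewrite leqNgt; apply/negP => le.
have le' : (e2.+2 <= e1.+1)%N by [].
have := no (p \o widen_ord le') (fun i => pF _).
rewrite affinely_independent_comp // => i j /(congr1 val) /= ij; exact: val_inj.
Qed.

Lemma affinely_independent_frame e (x : 'rV[R]_d) (W : 'M[R]_(e, d)) :
  row_free W ->
  affinely_independent (fun i : 'I_e.+1 =>
    if unlift ord0 i is Some j then x + row j W else x).
Proof.
move=> free; apply/affinely_independentP => w.
rewrite !big_ord_recl unlift_none.
move=> w1; under eq_bigr do rewrite liftK scalerDr.
rewrite big_split /= -scaler_suml addrA -scalerDl w1 scale0r add0r => wW.
have wl j : w (lift ord0 j) = 0.
  have : (\row_j w (lift ord0 j)) = 0.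
    apply: (row_free_inj free); rewrite mul0mx mulmx_sum_row -[RHS]wW.
    by apply: eq_bigr => l _; rewrite mxE.
  by move/rowP/(_ j); rewrite !mxE.
move=> i; case: (unliftP ord0 i) => [j ->|->]; first exact: wl.
by move: w1; rewrite big1 ?addr0 // => j _; apply: wl.
Qed.

End AffineIndependence.

Section Facets.
Variables (R : realType) (d : nat) (T : finType).
Variables (P : set 'rV[R]_d) (c : T -> 'cV[R]_d) (b : T -> R).
Hypothesis presP : presentation P c b.
Hypothesis d_gt0 : (0 < d)%N.
Local Notation act := (active c b).

Definition pres_facet t : set 'rV[R]_d := (P `&` [set x | dot x (c t) = b t])%classic.

Lemma frame_in e x (W : 'M[R]_(e, d)) : P x -> row_free W ->
  (forall i, {in act x, forall t, dot (row i W) (c t) = 0}) ->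
  exists2 p : 'I_e.+1 -> 'rV[R]_d, affinely_independent p &
    forall i, P (p i) /\ act x \subset act (p i).
Proof.
move=> Px free W0; have [|s s0 hs] := @uniform_eps R 'I_e (fun i s =>
    P (x + s *: row i W) /\ act x \subset act (x + s *: row i W)).
  move=> i; have [|s s0 hs] := @small_step _ _ _ _ _ _ presP x (row i W) Px.
    by move=> t /W0->.
  exists s => // s' /hs[Ps ->]; split=> //; apply/fintype.subsetP => t tx.
  by rewrite inE tx W0 /=.
exists (fun i : 'I_e.+1 => if unlift ord0 i is Some j then x + row j (s *: W) else x).
  by apply: affinely_independent_frame; rewrite /row_free mxrank_scale_nz // gt_eqF.
move=> i; case: (unlift ord0 i) => [j|//].
have -> : row j (s *: W) = s *: row j W by rewrite linearZ.
by apply: hs; rewrite s0 lexx.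
Qed.

Lemma normal_neq0 t : c t != 0.
Proof.
apply/eqP => c0; have [x Px tx] := pres_tight presP t.
have [u u1 _] := pres_dual presP Px tx.
by move: u1; rewrite c0 /dot mulmx0 mxE => /eqP; rewrite eq_sym oner_eq0.
Qed.

Lemma pres_has_dim : has_dim P d.
Proof.
split; last first.
  move=> p _; apply/negP => /affinely_independent_card; by rewrite ltnn.
have [x0 Px0] := pres_nonempty presP.
have [x Px ax] := face_point presP Px0 (finset.sub0set _).
have [||p ip pP] := @frame_in d x 1%:M Px; first by rewrite row_free_unit unitmx1.
  by move=> i t; rewrite ax inE.
by exists p => // i; case: (pP i).
Qed.

(** From a point where only t is active one can move a little in all directions
    of the hyperplane. *)
Lemma pres_facet_face t : facet P (pres_facet t).
Proof.
split; first by exists (c t), (b t); split=> // x /(pres_mem presP).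
pose e := \rank (kermx (c t)).
have de : e.+1 = d.
  rewrite /e mxrank_ker; have -> : \rank (c t) = 1%N.
    by apply/eqP; rewrite eqn_leq rank_leq_col lt0n mxrank_eq0 normal_neq0.
  by rewrite subn1 prednK.
exists e; rewrite de; split; first exact: pres_has_dim.
have [x0 Px0 tx0] := pres_tight presP t.
have [|x Px ax] := face_point presP (A := [set t]%SET) Px0; first by rewrite finset.sub1set.
split.
  have [||p ip pP] := @frame_in e x (row_base (kermx (c t))) Px.
  - exact: row_base_free.
  - move=> i t'; rewrite ax inE => /eqP ->; rewrite /dot.
    have /sub_kermxP -> : (row i (row_base (kermx (c t))) <= kermx (c t))%MS.
      by apply: submx_trans (row_sub _ _) _; rewrite eq_row_base.
    by rewrite mxE.
  exists p => // i; have [Pi /fintype.subsetP/(_ t)] := pP i.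
  by rewrite ax inE eqxx => /(_ isT) /activeP.
move=> p pF; apply/negP => /(affinely_independent_hyperplane (normal_neq0 t)).
by move/(_ (b t) (fun i => (pF i).2)); rewrite de ltnn.
Qed.

Lemma pres_facet_inj : injective pres_facet.
Proof.
move=> t t' e; have [x0 Px0 tx0] := pres_tight presP t.
have [|x Px ax] := face_point presP (A := [set t]%SET) Px0; first by rewrite finset.sub1set.
have : pres_facet t x by split=> //=; apply/activeP; rewrite ax finset.set11.
rewrite e => -[_ /= xt']; have : t' \in act x by apply/activeP.
by rewrite ax inE => /eqP.
Qed.

(** Let h be a supporting functional of F. The barycentre x of an affine frame
    of F maximizes h on P, so some inequality t is active at x; as x is an
    average, t is active on the whole frame. The frame has d points and
    determines its hyperplane, so h is a multiple of the normal of t. *)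
Lemma facet_pres_facet F : facet P F -> exists t, pres_facet t = F.
Proof.
case=> -[h [e [le FE]]] [f [dimP dimF]].
have fd : f.+1 = d := has_dim_uniq dimP pres_has_dim.
have [[p ip pF] _] := dimF.
have pP i : P (p i) by have := pF i; rewrite FE => -[].
have ph i : dot (p i) h = e by have := pF i; rewrite FE => -[].
have h0 : h != 0.
  apply/eqP => h0; have e0 : e = 0 by rewrite -(ph ord0) h0 /dot mulmx0 mxE.
  have FP : F = P.
    rewrite FE; apply/seteqP; split=> x; first by case.
    by move=> Px; split=> //=; rewrite h0 e0 /dot mulmx0 mxE.
  by have := has_dim_uniq dimP; rewrite -FP => /(_ _ dimF) /eqP; rewrite eqn_leq ltnn.
pose x := f.+1%:R^-1 *: \sum_i p i.
have fpos : 0 < f.+1%:R :> R by rewrite ltr0n.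
have dotx k : dot x k = f.+1%:R^-1 * \sum_i dot (p i) k.
  by rewrite /x dotZl dot_suml.
have Px : P x.
  apply/(pres_mem presP) => t; rewrite dotx mulrC ler_pdivrMr //.
  apply: (le_trans (y := \sum_(i < f.+1) b t)).
    by apply: ler_sum => i _; apply: pres_le presP _ _ (pP i).
  by rewrite sumr_const card_ord mulr_natr.
have xh : dot x h = e.
  rewrite dotx (eq_bigr (fun=> e)) // sumr_const card_ord -[e *+ _]mulr_natl mulKf ?gt_eqF //.
have [a0|[t tx]] := set_0Vmem (act x).
  case/eqP: h0; apply/matrixP => i j; rewrite ord1.
  (* At an interior point h increases in its own direction. *)
  pose u : 'rV[R]_d := h^T.
  have [|s s0 hs] := @small_step _ _ _ _ _ _ presP x u Px.
    by move=> t; rewrite a0 inE.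
  have [Pu _] := hs s (introT andP (conj s0 (lexx s))).
  have := le _ Pu; rewrite dotDl xh [dot (s *: u) h]dotZl gerDl => hu.
  have sq0 : \sum_j h j 0 * h j 0 = 0.
    apply/eqP; rewrite eq_le sumr_ge0 ?andbT => [|l _]; last exact: sqr_ge0.
    have -> : \sum_j h j 0 * h j 0 = dot u h.
      by rewrite /dot mxE; apply: eq_bigr => l _; rewrite mxE.
    by rewrite leNgt; apply/negP => pos; move: hu; rewrite leNgt mulr_gt0.
  move/psumr_eq0P: sq0 => /(_ (fun l _ => sqr_ge0 _) i isT) /eqP.
  by rewrite mulf_eq0 orbb mxE => /eqP.
exists t; move/activeP: tx => tx.
have pt i : dot (p i) (c t) = b t.
  have sum0 : \sum_i (b t - dot (p i) (c t)) = 0.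
    rewrite sumrB sumr_const card_ord -[b t *+ _]mulr_natl -tx dotx mulrA mulfV ?gt_eqF //.
    by rewrite mul1r subrr.
  apply/eqP; rewrite eq_sym -subr_eq0; apply/eqP.
  apply: (psumr_eq0P _ sum0) => // l _; rewrite subr_ge0.
  by apply: (pres_le presP).
(* Both hyperplanes give vectors in the kernel of the transposed matrix of the
   frame, which is a line. *)
pose Q := \matrix_(i < f.+1) row_mx (1%:M : 'M[R]_1) (p i).
have kQ (k : 'cV[R]_d) a : (forall i, dot (p i) k = a) ->
    (row_mx (- a)%:M k^T <= kermx Q^T)%MS.
  move=> pk; apply/sub_kermxP; apply: trmx_inj; rewrite trmx_mul trmxK trmx0.
  rewrite tr_row_mx trmxK tr_scalar_mx; apply/row_matrixP => i.
  rewrite row_mul rowK mul_row_col mul1mx row0.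
  apply/matrixP => l l'; rewrite !ord1 [LHS]mxE [X in X + _]mxE mulr1n -[X in _ + X]/(dot _ _).
  by rewrite pk addNr mxE.
pose k2 := row_mx (- b t)%:M (c t)^T.
have k20 : k2 != 0.
  apply: contra (normal_neq0 t); rewrite -row_mx0 => /eqP/eq_row_mx[_ /(congr1 trmx)].
  by rewrite trmxK trmx0 => ->.
have rK : \rank (kermx Q^T) = 1%N.
  have := eqP ip; rewrite mxrank_ker mxrank_tr -/Q => ->.
  by rewrite fd add1n subSnn.
have Kk2 : (kermx Q^T <= k2)%MS.
  have := mxrank_leqif_sup (kQ _ _ pt) => /leqifP; case: ifP => // _.
  by rewrite rK ltnS leqn0 mxrank_eq0 (negPf k20).
have /sub_rVP[a ka] := submx_trans (kQ _ _ ph) Kk2.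
move: ka; rewrite /k2 scale_row_mx => /eq_row_mx[/matrixP/(_ 0 0) ea /(congr1 trmx)].
rewrite linearZ /= !trmxK => ha.
have {}ea : e = a * b t by move: ea; rewrite !mxE /= !mulr1n mulrN => /oppr_inj.
have a0 : a != 0 by apply: contra h0 => /eqP a0; rewrite ha a0 scale0r.
have dota y : dot y h = a * dot y (c t).
  by rewrite /dot ha -scalemxAr mxE.
rewrite FE /pres_facet; congr (_ `&` _)%classic; apply/seteqP; split=> y /=.
  by move=> yt; rewrite dota yt.
by rewrite dota ea => /(mulfI a0).
Qed.

End Facets.

(** * Betti numbers of generalized truncation polytopes *)

Section Assembly.
Variables (R : realType) (r k : nat) (n : 'I_r -> nat) (P : set 'rV[R]_(\sum_i n i)).
Hypotheses (hr : (1 <= r)%N) (n_gt0 : forall i, (1 <= n i)%N).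
Hypothesis hP : generalized_truncation_polytope k n P.
Hypothesis hd : k = 0%N \/ (2 <= \sum_i n i)%N.
Local Notation d := (\sum_i n i)%N.

Lemma truncation_presentation :
  exists (T : finType) (c : T -> 'cV[R]_d) (b : T -> R), presentation P c b /\
  forall (U : finType) (g : T -> U), injective g ->
    truncation n k (g @: [set: T]%SET) (image_complex g (nerve P c b)).
Proof.
case: hP => S hS; elim: (k) hd (P) => [|k' IH] hd' P0 /=.
  move=> ->; have [c [b [pres blocks]]] := product_presentation n_gt0 hS.
  by exists (facet_index n), c, b.
have d2 : (2 <= d)%N by case: hd'.
case=> P' /(IH (or_intror d2))[T [c [b [pres tr]]]] [v [h [e [vP _ vh others ->]]]].
exists (option T), (cut_normal c h), (cut_bound b e); split.
  exact: (cut_presentation pres d2 vP vh others).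
move=> U g gI; exists ((g \o Some) @: [set: T]%SET), (image_complex (g \o Some) (nerve P' c b)).
split; last exact: (stellar_cut pres vP vh others gI (erefl _)).
by apply: tr; apply: inj_comp gI _ => x y [].
Qed.

Lemma labelling_truncation m (F : 'I_m -> set 'rV[R]_d) : facet_labelling P F ->
  truncation n k [set: 'I_m]%SET (facet_complex F).
Proof.
case=> FI FP; have [T [c [b [pres tr]]]] := truncation_presentation.
have d0 : (0 < d)%N.
  by rewrite (bigD1 (Ordinal hr)) //= ltn_addr.
have /choice[g gE] : forall t, exists i, F i = pres_facet P c b t.
  by move=> t; apply/FP; apply: pres_facet_face.
have gI : injective g.
  by move=> t t' e; apply: (pres_facet_inj pres); rewrite -!gE e.
have gS i : exists t, g t = i.
  have /(facet_pres_facet pres)[t tE] : facet P (F i) by apply/FP; exists i.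
  by exists t; apply: FI; rewrite gE.
have -> : [set: 'I_m]%SET = g @: [set: T]%SET.
  apply/finset.setP => i; rewrite inE; apply/esym/imsetP.
  by have [t <-] := gS i; exists t.
suff -> : simplices (facet_complex F) = image_complex g (nerve P c b) by apply: tr.
apply/finset.setP => I; rewrite [LHS]inE; apply/asboolP/imsetP => [[x xI]|[J /nerveP[x Px Jx] ->]].
  pose J := [set t | g t \in I]%SET; exists J; last first.
    apply/finset.setP => i; apply/idP/imsetP => [iI|[t]]; last by rewrite inE => ? ->.
    by have [t te] := gS i; exists t; rewrite // inE te.
  apply/nerveP; have [J0|[t tJ]] := set_0Vmem J.
    by have [y Py] := pres_nonempty pres; exists y; rewrite // J0 finset.sub0set.
  have facetx t' : t' \in J -> pres_facet P c b t' x.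
    by rewrite inE -gE; apply: xI.
  exists x; first by case: (facetx _ tJ).
  by apply/fintype.subsetP => t' /facetx[_ ?]; apply/activeP.
exists x => i /imsetP[t tJ ->]; rewrite gE; split=> //=.
by apply/activeP/(fintype.subsetP Jx).
Qed.

End Assembly.

Lemma binz_sub (k i s : nat) :
  binz k%:Z (i%:Z - s%:Z) = (if (s <= i)%N then 'C(k, i - s) else 0)%N%:Z.
Proof.
case: leqP => si; first by rewrite subzn.
have [p ->] : exists p, s = (i + p.+1)%N by exists (s - i).-1; lia.
by rewrite PoszD opprD addrA subrr add0r.
Qed.

Lemma block_term_int r (n : 'I_r -> nat) k i q : (block_term n k i q)%:Z =
  \sum_(I : {set 'I_r} | (\sum_(t in I) n t == q)%N) binz k%:Z (i%:Z - #|I|%:Z).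
Proof.
rewrite /block_term (big_morph Posz PoszD (erefl _)).
by apply: eq_bigr => I _; rewrite binz_sub.
Qed.

Theorem theorem2p4 (R : realType) (kk : idomainType)
    (hkk : char0_field_or_int kk)
    (r k : nat) (n : 'I_r -> nat) (P : set 'rV[R]_(\sum_i n i))
    (hr : (1 <= r)%N)
    (n_decr : forall i j : 'I_r, (i <= j)%N -> (n j <= n i)%N)
    (n_gt0 : forall i, (1 <= n i)%N)
    (hP : generalized_truncation_polytope k n P)
    (* a vertex cut of a segment is a segment: no new facet *)
    (hd : k = 0%N \/ (2 <= \sum_i n i)%N) :
  let d := (\sum_i n i)%N in
  let m := (d + r + k)%N in
  let a := #|[set i : 'I_r | n i == 1%N]%SET| in
  has_dim P d /\
  (exists F : 'I_m -> set 'rV[R]_d, facet_labelling P F) /\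
  forall F : 'I_m -> set 'rV[R]_d, facet_labelling P F ->
  let beta := betti kk (facet_complex F) in
  (* (a) *)
  (forall i l : nat, (1 <= i <= k + r - 1)%N -> (1 < l < d - 1)%N ->
     (beta i (i + l)%N)%:Z =
     \sum_(I : {set 'I_r} | (\sum_(t in I) n t == l)%N)
        binz k%:Z (i%:Z - #|I|%:Z)) /\
  (* (b); for d = 2 and k > 0 the two strands coincide and the formula fails,
     as for the pentagon *)
  (k = 0%N \/ (3 <= d)%N ->
   forall i : nat, (1 <= i <= k + r - 1)%N ->
     beta i (i + 1)%N = beta (k + r - i)%N (d + k + r - i - 1)%N /\
     (beta i (i + 1)%N)%:Z =
     k%:Z * binz (k%:Z + r%:Z - 1) i%:Z - binz k%:Z (i%:Z + 1)
     + a%:Z * binz k%:Z (i%:Z - 1)) /\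
  (* (c) *)
  (beta 0%N 0%N = 1%N /\ beta (m - d)%N m = 1%N) /\
  (* all others *)
  (forall i j : nat, (i <= m)%N -> (j <= m)%N ->
     ~~ ((1 <= i <= k + r - 1)%N && (i + 1 <= j <= i + (d - 1))%N) ->
     (i, j) <> (0%N, 0%N) -> (i, j) <> ((m - d)%N, m) ->
     beta i j = 0%N).
Proof.
move=> d m a.
have d0 : (0 < d)%N by rewrite /d (bigD1 (Ordinal hr)) //= ltn_addr.
have rd : (r <= d)%N.
  rewrite -[X in (X <= _)%N]card_ord -sum1_card; exact: leq_sum.
have [T [c [b [pres tr]]]] := truncation_presentation n_gt0 hP hd.
have cT : #|T| = m.
  have := inv_card (truncation_inv rat n_gt0 hd (tr T id (fun _ _ e => e))).
  by rewrite imset_id cardsT /m /d; lia.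
split; first exact: pres_has_dim pres.
split.
  exists (fun i => pres_facet P c b (enum_val (cast_ord (esym cT) i))); split.
    by move=> i j /(pres_facet_inj pres)/enum_val_inj/cast_ord_inj.
  move=> G; split=> [/(facet_pres_facet pres)[t <-]|[i <-]].
    by exists (cast_ord cT (enum_rank t)); rewrite cast_ordK enum_rankK.
  exact: pres_facet_face.
move=> F FL beta; have {}tr := labelling_truncation hr n_gt0 hP hd FL.
pose s := @hochster_sign m {fraction kk}.
have hs J : sign_system (s J) by apply: hochster_sign_system.
have betaE i q : beta i (i + q)%N = total_coh s [set: 'I_m]%SET (facet_complex F) q (i + q)%N.
  by rewrite /beta betti_hochster leq_addr addKn.
have strand i q : (0 < q < d)%N -> beta i (i + q)%N = (block_term n k i q +
    (q == 1) * point_term r k i + (q.+1 == d) * hole_term r k i)%N.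
  by move=> qd; rewrite betaE; apply: total_formula.
split; last split; last split.
- move=> i l hi hl; rewrite strand; last by lia.
  have -> : (l == 1%N) = false by lia.
  have -> : (l.+1 == d) = false by lia.
  by rewrite !mul0n !addn0 block_term_int.
- move=> hd3 i hi.
  have d2 : (2 <= d)%N by case: hd3; lia.
  have e1 : beta i (i + 1)%N = (block_term n k i 1 + point_term r k i)%N.
    rewrite strand // mul1n; case: hd3 => [k0|d3]; first by rewrite k0 /= muln0 addn0.
    have -> : (2 == d)%N = false by lia.
    by rewrite mul0n addn0.
  (* The lowest and the highest strand are exchanged by duality. *)
  have e2 : beta (k + r - i)%N (d + k + r - i - 1)%N =
      (block_term n k i 1 + point_term r k i)%N.
    have -> : (d + k + r - i - 1 = (k + r - i) + (d - 1))%N by lia.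
    rewrite strand; last by lia.
    rewrite block_term_dual //; last by lia.
    have -> : ((d - 1).+1 == d) = true by lia.
    rewrite mul1n hole_termE // ifT; last by lia.
    have -> : (k + r - (k + r - i) = i)%N by lia.
    case: hd3 => [k0|d3]; first by rewrite k0 /= !muln0 !addn0.
    have -> : (d - 1 == 1)%N = false by lia.
    by rewrite mul0n addn0.
  split; first by rewrite e1 e2.
  have := point_termE hr k i; rewrite e1; case: i hi {e1 e2} => [|i] hi // pE.
  rewrite block_term1 //; have -> : k%:Z + r%:Z - 1 = (k + r - 1)%N%:Z by lia.
  have -> : i.+1%:Z + 1 = i.+2%:Z by lia.
  have binE x y : binz (Posz x) (Posz y) = 'C(x, y)%:Z by [].
  have -> : i.+1%:Z - 1 = i%:Z by lia.
  rewrite !binE -!PoszM -pE /a.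
  by rewrite !PoszD addrK addrC.
- split.
    by rewrite (betaE 0%N 0%N) (total0 n_gt0 _ hd tr hs).
  have -> : (m - d = k + r)%N by rewrite /m; lia.
  have mE : m = (k + r + d)%N by rewrite /m; lia.
  by rewrite [X in beta _ X]mE betaE (total_top n_gt0 _ hd tr hs) addnC eqxx.
move=> i j im jm nij n00 nmd; have [ij|ji] := leqP i j; last first.
  by rewrite /beta betti_hochster leqNgt ji.
rewrite -(subnKC ij); set q := (j - i)%N.
have jE : j = (i + q)%N by rewrite subnKC.
have [q0|q0] := posnP q.
  rewrite q0 betaE (total0 n_gt0 _ hd tr hs) addn0; case: eqP => // i0.
  by case: n00; rewrite jE q0 i0.
have [qd|dq|qd] := ltngtP q d.
- have out : (i == 0%N) || (k + r <= i)%N by move: nij; rewrite jE; lia.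
  rewrite strand ?q0 // (block_term_out _ out) ?q0 //.
  case/orP: out => [/eqP->|ki]; first by rewrite point_term0 hole_term0 !muln0.
  by rewrite (point_term_out hr ki) ?(hole_term_out hr ki) ?muln0.
- by rewrite betaE (total_large n_gt0 _ _ hd tr).
rewrite qd betaE (total_top n_gt0 _ hd tr hs); case: eqP => // e.
case: nmd; rewrite jE qd; congr (_, _); rewrite /m; move: e; rewrite -/d; lia.
Qed.
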